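(* Let $n\ge3$. Each non-negative $\mathrm{SO}(n-1)$ invariant measure $\mu$ on $\mathbb{S}^{n-1}$ with center of mass at the origin induces a monotone Asplund endomorphism $\Psi_{\mu}:\mathrm{LC_c}(\mathbb{R}^n)\to\mathrm{LC_c}(\mathbb{R}^n)$ by $$h(\Psi_{\mu} f,\cdot) = h(f,\cdot) \circledast \mu, \qquad f \in \mathrm{LC_c}(\mathbb{R}^n).$$ Moreover, the measure $\mu$ is uniquely determined by $\Psi_{\mu}$.
   Context: All measures are finite Borel measures. Fix a pole $\bar e\in\mathbb{S}^{n-1}$; $\mathrm{SO}(n-1)$ is the subgroup of $\mathrm{SO}(n)$ fixing $\bar e$. Center of mass at the origin means $\int_{\mathbb{S}^{n-1}}v\,d\mu(v)=o$. $\mathrm{Cvx}(\mathbb{R}^n)$ is the set of convex, lower semi-continuous functions $\varphi:\mathbb{R}^n\to(-\infty,\infty]$ not identically $+\infty$; $\mathrm{dom}\,\varphi=\{\varphi<\infty\}$; $\mathrm{Cvx}_{(o)}(\mathbb{R}^n)=\{\varphi\in\mathrm{Cvx}(\mathbb{R}^n): o\in\mathrm{int}\,\mathrm{dom}\,\varphi\}$. $\mathrm{LC_c}(\mathbb{R}^n)$ is the set of functions $f=e^{-\varphi}$ with $\varphi\in\mathrm{Cvx}(\mathbb{R}^n)$ coercive, i.e. $\lim_{\|x\|\to\infty}\varphi(x)=+\infty$ (functions equal almost everywhere are not identified). The Legendre transform is $(\mathcal{L}\varphi)(x)=\sup_{y}\,(x\cdot y-\varphi(y))$, and the support function of $f \in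 \mathrm{LC_c}(\mathbb{R}^n)$ is $h(f,\cdot)=\mathcal{L}(-\log f)$. One has $f\in\mathrm{LC_c}(\mathbb{R}^n)$ if and only if $h(f,\cdot)\in\mathrm{Cvx}_{(o)}(\mathbb{R}^n)$, and $f$ is determined by $h(f,\cdot)$. For $\varphi\in\mathrm{Cvx}_{(o)}(\mathbb{R}^n)$ and a non-negative $\mathrm{SO}(n-1)$ invariant measure $\mu$ on $\mathbb{S}^{n-1}$, $(\varphi\circledast\mu)(x)=\int_{\mathbb{S}^{n-1}}\varphi(\|x\|\vartheta_xv)\,d\mu(v)$ for $x\ne o$, where $\vartheta_x\in\mathrm{SO}(n)$ is any rotation with $\vartheta_x\bar e=x/\|x\|$, and $(\varphi\circledast\mu)(o)=\liminf_{\|x\|\to0}(\varphi\circledast\mu)(x)$. Epi-convergence $\varphi_k\to\varphi$: for every $x$, (1) $\varphi(x)\le\liminf_k\varphi_k(x_k)$ for every sequence $x_k\to x$, and (2) there is a sequence $x_k\to x$ with $\varphi(x)=\lim_k\varphi_k(x_k)$. $\mathrm{LC_c}(\mathbb{R}^n)$ carries the topology induced by this: $e^{-\varphi_k}\to e^{-\varphi}$ iff $\varphi_k$ epi-converges to $\varphi$. The Asplund sum is $(f\star g)(x)=\sup_{x_1+x_2=x}f(x_1)g(x_2)$. An Asplund endomorphism is a continuous map $\Psi:\mathrm{LC_c}(\mathbb{R}^n)\to\mathrm{LC_c}(\mathbb{R}^n)$ which is Asplund additive ($\Psi(f\star g)=\Psi f\star\Psi g$), translation invariant ($\Psi(f(\cdot-y))=\Psi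 f$ for all $y\in\mathbb{R}^n$), and commutes with the $\mathrm{SO}(n)$ action $(\vartheta f)(x)=f(\vartheta^{-1}x)$. It is monotone if $f\le g$ implies $\Psi f\le\Psi g$. *)

(* Defs.v *)
From HB Require Import structures.
From mathcomp Require Import all_boot all_order all_algebra.
From mathcomp Require Import all_classical all_reals all_analysis.

Set Implicit Arguments.
Unset Strict Implicit.
Unset Printing Implicit Defensive.

Import Order.TTheory GRing.Theory Num.Theory.
Import numFieldNormedType.Exports.

Local Open Scope classical_set_scope.
Local Open Scope ring_scope.

(* R^n is ['cV[R]_n] for an arbitrary [R : realType]. *)

(* ['cV[R]_n] with its Borel sigma-algebra, generated by the open sets of the
   product topology, which is the Euclidean one. *)
Notation borelRn R n := (g_sigma_algebraType (@open 'cV[R]_n)).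

Section Euclidean.
Context {R : realType} {n : nat}.
Implicit Types (x y : 'cV[R]_n).

Definition dot x y : R := \sum_i x i 0 * y i 0.

(* The library norm [`|x|] on ['cV[R]_n] is the sup norm, hence this one. *)
Definition enorm x : R := Num.sqrt (dot x x).

Definition sphere : set 'cV[R]_n := [set v | enorm v = 1].

Definition SO : set 'M[R]_n := [set A | A^T *m A = 1%:M /\ \det A = 1].

Definition SO_fixing (e : 'cV[R]_n) : set 'M[R]_n :=
  [set A | SO A /\ A *m e = e].

(* Some rotation taking the pole e to x / |x|; one exists when n >= 2,
   e is a unit vector and x != 0. *)
Definition rot_to (e x : 'cV[R]_n) : 'M[R]_n :=
  xget 1%:M [set A | SO A /\ A *m e = (enorm x)^-1 *: x].

End Euclidean.

Section SphereMeasures.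
Context {R : realType} {n : nat}.
Implicit Types (mu : {finite_measure set (borelRn R n) -> \bar R}).

(* Finite Borel measures on the sphere are represented by the finite Borel
   measures on R^n that give no mass to the complement of the sphere. *)
Definition on_sphere mu := mu (~` sphere) = 0%E.

Definition SO_fixing_invariant (e : 'cV[R]_n) mu :=
  forall A : 'M[R]_n, SO_fixing e A ->
  forall B : set (borelRn R n), measurable B -> mu (mulmx A @^-1` B) = mu B.

Definition centered mu :=
  forall i : 'I_n, (\int[mu]_(v in sphere) (v i 0)%:E = 0)%E.

End SphereMeasures.

Section ConvexFunctions.
Context {R : realType} {n : nat}.
Implicit Types (phi : 'cV[R]_n -> \bar R).
Local Open Scope ereal_scope.

Definition convexe phi :=
  forall (x y : 'cV[R]_n) (t : R), (0 <= t <= 1)%R ->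
    phi (t *: x + (1 - t) *: y)%R <= t%:E * phi x + (1 - t)%:E * phi y.

Definition Cvx : set ('cV[R]_n -> \bar R) :=
  [set phi | [/\ forall x, phi x != -oo, convexe phi,
                 lower_semicontinuous phi & exists x, phi x != +oo]].

Definition coercive phi :=
  forall M : R, exists r : R, forall x, (r < enorm x)%R -> M%:E < phi x.

Definition legendre phi (x : 'cV[R]_n) : \bar R :=
  ereal_sup [set (dot x y)%:E - phi y | y in setT].

Definition epi_cvg (phi_ : nat -> 'cV[R]_n -> \bar R) phi :=
  forall x,
    (forall u : nat -> 'cV[R]_n, u @ \oo --> x ->
       phi x <= limn_einf (fun k => phi_ k (u k))) /\
    (exists2 u : nat -> 'cV[R]_n, u @ \oo --> x &
       (fun k => phi_ k (u k)) @ \oo --> phi x).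

Definition sphere_conv_ne0 (e : 'cV[R]_n)
    (mu : {finite_measure set (borelRn R n) -> \bar R}) phi (x : 'cV[R]_n) :=
  \int[mu]_(v in sphere) phi (enorm x *: (rot_to e x *m v))%R.

(* [0^'] is the punctured neighbourhood filter: the value at the origin is the
   lower limit of the values away from the origin. *)
Definition sphere_conv e mu phi (x : 'cV[R]_n) : \bar R :=
  if x == 0%R then limf_einf (sphere_conv_ne0 e mu phi) (0%R : 'cV[R]_n)^'
  else sphere_conv_ne0 e mu phi x.

End ConvexFunctions.

Section LogConcave.
Context {R : realType} {n : nat}.
Implicit Types (f g : 'cV[R]_n -> R) (Psi : ('cV[R]_n -> R) -> 'cV[R]_n -> R).

Definition LCc : set ('cV[R]_n -> R) :=
  [set f | exists phi : 'cV[R]_n -> \bar R,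
     [/\ Cvx phi, coercive phi & forall x, (f x)%:E = expeR (- phi x)%E]].

(* [lne 0 = -oo], so that [neglog f] is [phi] when [f = e^(- phi)]. *)
Definition neglog f (x : 'cV[R]_n) : \bar R := (- lne (f x)%:E)%E.

Definition supp f : 'cV[R]_n -> \bar R := legendre (neglog f).

(* The supremum is that of a nonempty bounded set when f and g are in LCc. *)
Definition asplund_sum f g (x : 'cV[R]_n) : R :=
  sup [set f z.1 * g z.2 | z in [set z : 'cV[R]_n * 'cV[R]_n | z.1 + z.2 = x]].

(* A map LCc -> LCc is represented by a map on all functions that sends LCc to
   LCc; its values outside LCc are irrelevant. The topology of epi-convergence
   being metrizable, continuity is stated with sequences. *)
Record asplund_endomorphism Psi : Prop := AsplundEndomorphism {
  asplund_LCc : forall f, LCc f -> LCc (Psi f);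
  asplund_continuous : forall (f_ : nat -> 'cV[R]_n -> R) f,
    (forall k, LCc (f_ k)) -> LCc f ->
    epi_cvg (fun k => neglog (f_ k)) (neglog f) ->
    epi_cvg (fun k => neglog (Psi (f_ k))) (neglog (Psi f));
  asplund_additive : forall f g, LCc f -> LCc g ->
    Psi (asplund_sum f g) = asplund_sum (Psi f) (Psi g);
  asplund_translation : forall f (y : 'cV[R]_n), LCc f ->
    Psi (fun x => f (x - y)) = Psi f;
  asplund_rotation : forall f (A : 'M[R]_n), LCc f -> SO A ->
    Psi (fun x => f (invmx A *m x)) = (fun x => Psi f (invmx A *m x)) }.

Definition monotone_on_LCc Psi :=
  forall f g, LCc f -> LCc g -> (forall x, f x <= g x) ->
  forall x, Psi f x <= Psi g x.

Definition induced_by (e : 'cV[R]_n)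
    (mu : {finite_measure set (borelRn R n) -> \bar R}) Psi :=
  forall f, LCc f -> LCc (Psi f) /\ supp (Psi f) = sphere_conv e mu (supp f).

End LogConcave.

(* Main.v *)
(** A measure on the sphere invariant under the rotations fixing the pole is also
    invariant under the reflections fixing it, so in the transform [H phi = phi * mu]
    one may use any orthogonal map taking the pole to [x / |x|]. Choosing for points of
    a plane the rotations of that plane, and symmetrizing the component orthogonal to
    the plane, shows that [H phi] is convex; Fatou's lemma gives lower semicontinuity,
    and boundedness near the origin is inherited. By Fenchel-Moreau, [H (supp f)] is
    then the support function of a unique function of LCc, which defines the
    endomorphism; additivity, equivariance and monotonicity are read off the integral,
    and translations of [f] add to [supp f] a linear function, of integral 0.
    For continuity, let [psi_k] epi-converge to [psi]. The conjugates converge pointwise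
    and locally boundedly in the interior of the domain of the limit conjugate [h].
    Shrinking by a factor [t < 1] moves the closed domain into the interior, so that
    dominated convergence gives [H h_k (t x) -> H h (t x)]; with the Fatou lower bound
    this suffices for the epi-convergence of the conjugates of [H h_k].
    Finally, evaluating at the pole recovers the integrals against [mu] of convex
    Lipschitz functions; indicators of open boxes are limits of differences of these,
    so [mu] is determined. *)
Require Import Defs.
From HB Require Import structures.
From mathcomp Require Import all_boot all_order all_algebra.
From mathcomp Require Import all_classical all_reals all_analysis.
From mathcomp Require Import measurable_realfun ring lra.

Set Implicit Arguments.
Unset Strict Implicit.
Unset Printing Implicit Defensive.

Import Order.TTheory GRing.Theory Num.Theory.
Import numFieldNormedType.Exports.

Local Open Scope classical_set_scope.
Local Open Scope ring_scope.

(** Rotations fixing the pole would not be enough. The map symmetrizing the component orthogonal to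
    a plane is [-1] on a space of dimension [n - 2], so it has determinant [-1] for odd [n]; the
    continuous choice [- refl (a + b)] of a map taking a unit vector [a] to a nearby [b] has
    determinant [-1] for even [n]. This is why invariance under all orthogonal maps fixing the pole
    is settled before the transform is studied, and why [n >= 3] is assumed: the argument uses a
    circle of unit vectors orthogonal to the pole. The factor [t < 1] in the continuity proof cannot
    be dropped: at a boundary point of the domain of [h] where [h] is finite, all [h_k] may be
    infinite, so [H h_k] need not converge to [H h] on the domain of [H h]. Epi-convergence of the
    conjugates is therefore derived from upper bounds at the points [t x] only. Topology, balls and
    Lipschitz constants refer to the sup norm; passing to the inner product costs the factors [n] in
    the constants. *)

Ltac colring := apply/matrixP => ? ?; rewrite !mxE; ring.

(** * Inner product, Euclidean norm and sup norm *)

Section Dot.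
Context {R : realType} {n : nat}.
Implicit Types (x y z : 'cV[R]_n).

Lemma dotC x y : dot x y = dot y x.
Proof. by apply: eq_bigr => i _; rewrite mulrC. Qed.

Lemma dotDl x y z : dot (x + y) z = dot x z + dot y z.
Proof. by rewrite -big_split; apply: eq_bigr => i _; rewrite mxE mulrDl. Qed.

Lemma dotDr x y z : dot x (y + z) = dot x y + dot x z.
Proof. by rewrite dotC dotDl !(dotC x). Qed.

Lemma dotZl a x y : dot (a *: x) y = a * dot x y.
Proof. by rewrite mulr_sumr; apply: eq_bigr => i _; rewrite mxE mulrA. Qed.

Lemma dotZr a x y : dot x (a *: y) = a * dot x y.
Proof. by rewrite dotC dotZl dotC. Qed.

Lemma dotNl x y : dot (- x) y = - dot x y.
Proof. by rewrite -scaleN1r dotZl mulN1r. Qed.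

Lemma dotNr x y : dot x (- y) = - dot x y.
Proof. by rewrite dotC dotNl dotC. Qed.

Lemma dotBl x y z : dot (x - y) z = dot x z - dot y z.
Proof. by rewrite dotDl dotNl. Qed.

Lemma dotBr x y z : dot x (y - z) = dot x y - dot x z.
Proof. by rewrite dotDr dotNr. Qed.

Lemma dot0l x : dot 0 x = 0.
Proof. by rewrite -(scale0r 0) dotZl mul0r. Qed.

Lemma dot0r x : dot x 0 = 0.
Proof. by rewrite dotC dot0l. Qed.

Lemma dot_ge0 x : 0 <= dot x x.
Proof. by apply: sumr_ge0 => i _; rewrite -expr2 sqr_ge0. Qed.

Lemma dot_eq0 x : (dot x x == 0) = (x == 0).
Proof.
apply/eqP/eqP => [|->]; last exact: dot0l.
move/psumr_eq0P => h; apply/colP => i; rewrite mxE.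
by apply/eqP; rewrite -sqrf_eq0 expr2 h// => j _; rewrite -expr2 sqr_ge0.
Qed.

Lemma dot_gt0 x : x != 0 -> 0 < dot x x.
Proof. by move=> x0; rewrite lt_def dot_eq0 x0 dot_ge0. Qed.

Lemma dot_mulmx (A : 'M[R]_n) x y : dot (A *m x) y = dot x (A^T *m y).
Proof.
have E u v : dot u v = (u^T *m v) 0 0.
  by rewrite !mxE; apply: eq_bigr => i _; rewrite !mxE.
by rewrite !E trmx_mul mulmxA.
Qed.

Lemma cauchy_schwarz x y : dot x y ^+ 2 <= dot x x * dot y y.
Proof.
have [->|y0] := eqVneq y 0; first by rewrite !dot0r expr0n mulr0.
have := dot_ge0 (dot y y *: x - dot x y *: y).
rewrite !dotBl !dotBr !dotZl !dotZr (dotC y x) => h.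
have yy := dot_gt0 y0.
suff : 0 <= dot y y * (dot x x * dot y y - dot x y ^+ 2).
  by rewrite pmulr_rge0// subr_ge0.
by apply: le_trans h _; rewrite le_eqVlt; apply/orP; left; apply/eqP; ring.
Qed.

Lemma enorm_ge0 x : 0 <= enorm x. Proof. exact: sqrtr_ge0. Qed.

Lemma sqr_enorm x : enorm x ^+ 2 = dot x x.
Proof. by rewrite sqr_sqrtr ?dot_ge0. Qed.

Lemma enorm_eq0 x : (enorm x == 0) = (x == 0).
Proof. by rewrite -sqrf_eq0 sqr_enorm dot_eq0. Qed.

Lemma enorm0 : enorm (0 : 'cV[R]_n) = 0.
Proof. by apply/eqP; rewrite enorm_eq0. Qed.

Lemma enorm_gt0 x : (0 < enorm x) = (x != 0).
Proof. by rewrite lt_def enorm_ge0 andbT enorm_eq0. Qed.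

Lemma enormZ a x : enorm (a *: x) = `|a| * enorm x.
Proof.
by rewrite /enorm dotZl dotZr mulrA -expr2 sqrtrM ?sqr_ge0// sqrtr_sqr.
Qed.

Lemma dot_enorm x y : dot x y <= enorm x * enorm y.
Proof.
apply: le_trans (ler_norm _) _.
rewrite -(ler_pXn2r (ltn0Sn 1)) ?nnegrE ?mulr_ge0 ?enorm_ge0//.
by rewrite real_normK ?num_real// exprMn !sqr_enorm cauchy_schwarz.
Qed.

Lemma enormD x y : enorm (x + y) <= enorm x + enorm y.
Proof.
rewrite -(ler_pXn2r (ltn0Sn 1)) ?nnegrE ?addr_ge0 ?enorm_ge0//.
rewrite sqrrD !sqr_enorm dotDl !dotDr (dotC y x).
have := dot_enorm x y; lra.
Qed.

Lemma norm_coord x i : `|x i 0| <= `|x|.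
Proof. by rewrite [leRHS]/Num.norm /= mx_normrE; apply: (@le_bigmax _ _ _ _ (fun ij : 'I_n * 'I_1 => `|x ij.1 ij.2|) (i, 0)). Qed.

Lemma norm_le_coord x c : 0 <= c -> (forall i, `|x i 0| <= c) -> `|x| <= c.
Proof.
move=> c0 h; rewrite [leLHS]/Num.norm /= mx_normrE; apply/bigmax_leP; split=> //.
by move=> [i j] _ /=; rewrite ord1.
Qed.

Lemma norm_enorm x : `|x| <= enorm x.
Proof.
apply: norm_le_coord (enorm_ge0 _) _ => i.
rewrite -(ler_pXn2r (ltn0Sn 1)) ?nnegrE ?enorm_ge0// real_normK ?num_real//.
rewrite sqr_enorm /dot (bigD1 i)//= expr2 lerDl.
by apply: sumr_ge0 => j _; rewrite -expr2 sqr_ge0.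
Qed.

Lemma dot_norm x y : `|dot x y| <= n%:R * `|x| * `|y|.
Proof.
apply: le_trans (ler_norm_sum _ _ _) _.
apply: le_trans (_ : \sum_(i < n) `|x| * `|y| <= _).
  by apply: ler_sum => i _; rewrite normrM ler_pM// norm_coord.
by rewrite sumr_const card_ord -[X in X <= _]mulr_natl mulrA.
Qed.

Lemma enorm_norm x : enorm x <= n%:R * `|x|.
Proof.
rewrite -(ler_pXn2r (ltn0Sn 1)) ?nnegrE ?enorm_ge0 ?mulr_ge0// sqr_enorm.
apply: le_trans (ler_norm _) _; apply: le_trans (dot_norm _ _) _.
case: n x => [|m] x; first by rewrite !mul0r expr0n.
rewrite exprMn !expr2 !mulrA ler_wpM2r// ler_wpM2r//.
by rewrite -[leLHS]mulr1 ler_wpM2l// ler1n.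
Qed.

End Dot.

(** Comparisons with extended reals mostly go through real thresholds, which keeps sums and products
    of infinite values out of the arguments. *)
Lemma lee_fin_bound {R : realType} (u : \bar R) c :
  (forall r, (u <= r%:E)%E -> c <= r) -> (c%:E <= u)%E.
Proof.
case: u => [u|_|h]; last by have := h (c - 1) (leNye _); rewrite leNgt ltrBlDr ltrDl ltr01.
  by move=> /(_ u (lexx _)); rewrite lee_fin.
exact: leey.
Qed.

Lemma lip_continuous {R : realType} (V W : normedModType R) (f : V -> W) (C : R) :
  (forall x y, `|f x - f y| <= C * `|x - y|) -> continuous f.
Proof.
move=> h x; apply/cvgrPdist_le => e e0; near=> z.
apply: le_trans (h x z) _.
(* [C] may vanish, so the radius is divided by [1 + |C|]. *)
have C0 : 0 < 1 + `|C| by rewrite ltr_pwDl.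
have : `|x - z| <= e / (1 + `|C|).
  by near: z; apply: cvgr_dist_le; [exact: cvg_id|rewrite divr_gt0].
rewrite ler_pdivlMr// => /(le_trans _); apply; rewrite mulrC ler_wpM2l//.
by have := ler_norm C; lra.
Unshelve. all: by end_near. Qed.

(** * Convex functions and the Legendre transform *)

Section Convex.
Context {R : realType} {n : nat}.
Implicit Types (x y z : 'cV[R]_n) (phi : 'cV[R]_n -> \bar R).

(** With real bounds in place of values no infinite term has to be combined. Only [t = 0] and
    [t = 1] need separate care in the converse; there [0 * +oo = 0] makes [convexe] trivial. *)
Lemma convexeP phi : (forall x, phi x != -oo%E) -> convexe phi <->
  forall x y t a b, 0 <= t <= 1 -> (phi x <= a%:E)%E -> (phi y <= b%:E)%E ->
    (phi (t *: x + (1 - t) *: y)%R <= (t * a + (1 - t) * b)%:E)%E.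
Proof.
move=> phiN; split=> [c x y t a b t01 xa yb|c x y t t01].
  apply: le_trans (c x y t t01) _; case/andP: t01 => t0 t1.
  rewrite (EFinD (t * a)) (EFinM t a) (EFinM (1 - t) b); apply: leeD; apply: lee_wpmul2l => //.
  by rewrite lee_fin subr_ge0.
have [t0|t0] := eqVneq t 0.
  by rewrite t0 scale0r add0r subr0 scale1r mul0e add0e mul1e.
have [t1|t1] := eqVneq t 1.
  by rewrite t1 scale1r subrr scale0r addr0 mul0e adde0 mul1e.
case/andP: (t01) => t_ge0 t_le1.
have tp : 0 < t by rewrite lt_def t0.
have t'p : 0 < 1 - t by rewrite subr_gt0 lt_def eq_sym t1.
have := phiN x; have := phiN y; have := c x y t.
case: (phi x) => [a| |] //; case: (phi y) => [b| |] // h _ _.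
- by rewrite -!EFinM -EFinD; apply: h.
- by rewrite gt0_muley ?lte_fin// addey ?leey.
- by rewrite gt0_muley ?lte_fin// addye ?leey.
- by rewrite !gt0_muley ?lte_fin// leey.
Qed.

Definition cball x r : set 'cV[R]_n := [set y | `|y - x| <= r].

Lemma norm_trmx (v : 'rV[R]_n) : `|v^T| <= `|v|.
Proof.
apply: norm_le_coord => // i; rewrite mxE [leRHS]/Num.norm /= mx_normrE.
by apply: (@le_bigmax _ _ _ _ (fun ij : 'I_1 * 'I_n => `|v ij.1 ij.2|) (0, i)).
Qed.

(** The ball is the image of a product of segments in the space of row vectors under the continuous
    map [v |-> v^T + x]. *)
Lemma cball_compact x r : compact (cball x r).
Proof.
have trc : continuous (fun v : 'rV[R]_n => v^T + x).
  apply: (@lip_continuous _ _ _ _ 1) => v w; rewrite mul1r.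
  by rewrite opprD addrACA subrr addr0 -linearB norm_trmx.
have K : compact [set v : 'rV[R]_n | forall i, v ord0 i \in `[(- r), r]].
  apply: (@rV_compact _  _ (fun=> `[(- r), r]%classic)).
  by move=> _; apply: segment_compact.
have [r0|r0] := ltP r 0.
  rewrite (_ : cball x r = set0); first exact: compact0.
  by apply/seteqP; split=> y //= /le_lt_trans/(_ r0); rewrite normr_lt0.
have -> : cball x r = (fun v : 'rV[R]_n => v^T + x) @` [set v : 'rV[R]_n | forall i, v ord0 i \in `[(- r), r]].
  apply/seteqP; split => [y /= yr|_ [v /= vr <-]].
    exists (y - x)^T; last by rewrite trmxK subrK.
    by move=> i; rewrite in_itv /= -ler_norml mxE (le_trans (norm_coord _ _)).
  rewrite /cball /= addrK; apply: norm_le_coord => // i.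
  by rewrite mxE ler_norml; have := vr i; rewrite in_itv.
apply: continuous_compact => //; exact: continuous_subspaceT.
Qed.

Lemma dot_continuous y : continuous (dot^~ y).
Proof.
apply: (@lip_continuous _ _ _ _ (n%:R * `|y|)) => x z.
by rewrite -dotBl mulrAC dot_norm.
Qed.

(** Lower semicontinuity bounds [phi] below near each point. Compactness in its near-covering form,
    with the bound as a parameter tending to [-oo], makes the bound uniform. *)
Lemma lsc_bounded_below phi (K : set 'cV[R]_n) : (forall x, phi x != -oo%E) ->
  lower_semicontinuous phi -> compact K ->
  exists b, forall x, K x -> (b%:E <= phi x)%E.
Proof.
move=> phiN phil /compact_near_coveringP
  /(_ R -oo%R (fun b x => (b%:E <= phi x)%E) _) h.
have /h [b [bR hb]] : forall x, K x -> \forall x' \near x & b \near -oo%R, (b%:E <= phi x')%E.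
  move=> x _; have [a xa] : exists a, (a%:E < phi x)%E.
    have := phiN x; case: (phi x) => [r _| _|//]; last by exists 0; rewrite ltey.
    by exists (r - 1); rewrite lte_fin ltrBlDr ltrDl.
  have [V Vx Va] := phil _ _ xa.
  exists (V, [set b | b <= a]) => /=.
    by split=> //; apply: nbhs_ninfty_le; rewrite num_real.
  by move=> [x' b] /= [/Va h1 h2]; rewrite (le_trans _ (ltW h1))// lee_fin.
exists (b - 1) => x Kx; have := hb (b - 1); rewrite ltrBlDr ltrDl ltr01 => /(_ isT).
exact.
Qed.

(** The point [z] of the segment from [x0] to [x] at distance [rho] from [x0] has weight
    [rho / |x - x0|] on [x]; slopes of a convex function increase along the segment. *)
Lemma convex_growth phi x0 (a m rho : R) : (forall x, phi x != -oo%E) ->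
  convexe phi -> (phi x0 <= a%:E)%E -> 0 < rho ->
  (forall x, `|x - x0| = rho -> (m%:E <= phi x)%E) ->
  forall x, rho <= `|x - x0| -> ((a + (m - a) / rho * `|x - x0|)%:E <= phi x)%E.
Proof.
move=> phiN /(convexeP phiN) c x0a rho0 hm x xr; apply: lee_fin_bound => r xr'.
set s := `|x - x0| in xr *.
have s0 : 0 < s by apply: lt_le_trans xr.
have s1 : 0 <= rho / s <= 1.
  by apply/andP; split; [apply: divr_ge0; apply: ltW|rewrite ler_pdivrMr// mul1r].
have h := c x x0 _ r a s1 xr' x0a.
set z := (_ + _)%R in h; have zE : z - x0 = (rho / s) *: (x - x0).
  by rewrite /z scalerBl scale1r scalerBr addrA addrAC addrK.
have /hm : `|z - x0| = rho.
  by case/andP: (s1) => s10 _; rewrite zE normrZ (ger0_norm s10) -/s divfK ?gt_eqF.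
move=> /le_trans /(_ h); rewrite lee_fin => h'.
have : (m - a) <= rho / s * (r - a) by lra.
move=> /(ler_wpM2r (ltW s0)); rewrite [leRHS]mulrAC divfK ?gt_eqF// => h2.
suff : (m - a) / rho * s <= r - a by lra.
by rewrite mulrAC ler_pdivrMr// mulrC [leRHS]mulrC mulrC.
Qed.

Lemma Cvx_fin phi : Cvx phi -> exists x a, phi x = a%:E.
Proof.
move=> [phiN _ _ [x xy]]; exists x.
by have := phiN x; case: (phi x) xy => // a _ _; exists a.
Qed.

(** Inside the unit ball about [x0] compactness gives a bound [B]; outside, [convex_growth]
    continues it linearly. The number [|B| + |a|] dominates both [|B|] and the slope [|B - a|], and
    [1 + |x0|] absorbs the change of centre from [x0] to the origin. *)
Lemma Cvx_linear_lower phi : Cvx phi ->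
  exists2 b, 0 <= b & forall x, ((- b * (1 + `|x|))%:E <= phi x)%E.
Proof.
move=> Cphi; have [x0 [a x0a]] := Cvx_fin Cphi; case: (Cphi) => phiN c l _.
have [B hB] := lsc_bounded_below phiN l (@cball_compact x0 1).
have K0 : 0 <= (`|B| + `|a|) * (1 + `|x0|) by rewrite mulr_ge0 ?addr_ge0.
exists ((`|B| + `|a|) * (1 + `|x0|) + (`|B| + `|a|)); first by rewrite addr_ge0 ?addr_ge0.
move=> x; have sx : `|x - x0| <= `|x| + `|x0| by apply: ler_normB.
have [x1|x1] := leP `|x - x0| 1.
  apply: le_trans (hB _ x1); rewrite lee_fin.
  have := normr_ge0 x; have := normr_ge0 a; have := normr_ge0 x0.
  have := ler_norm (- B); have := normr_ge0 B; rewrite normrN; move: `|B| `|a| `|x0| `|x| => p q r s s0 q0 r0 p0 Bp.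
  have : 0 <= (p + q) * (r * (1 + s)) by rewrite !mulr_ge0 ?addr_ge0.
  have : 0 <= p * s by rewrite mulr_ge0.
  have : 0 <= q * s by rewrite mulr_ge0.
  nra.
apply: le_trans (@convex_growth phi x0 a B 1 phiN c _ ltr01 _ x (ltW x1)).
- rewrite lee_fin divr1.
  have : - (`|B| + `|a|) * `|x - x0| <= (B - a) * `|x - x0|.
    rewrite ler_wpM2r// -lerN2 opprK opprB.
    by have := ler_norm (- B); have := ler_norm a; rewrite normrN; lra.
  have := ler_norm (- a); rewrite normrN.
  have := normr_ge0 a; have := normr_ge0 B; have := normr_ge0 x0; have := normr_ge0 x; have := normr_ge0 (x - x0).
  move: (B - a) sx; move: `|B| `|a| `|x0| `|x| `|x - x0| => p q r s u v.
  move=> us u0 s0 r0 p0 q0 aq h.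
  have : 0 <= (p + q) * (r * s) by rewrite !mulr_ge0 ?addr_ge0.
  have : 0 <= (p + q) * r by rewrite mulr_ge0 ?addr_ge0.
  have : 0 <= (p + q) * s by rewrite mulr_ge0 ?addr_ge0.
  have : (p + q) * u <= (p + q) * (s + r) by rewrite ler_wpM2l ?addr_ge0.
  nra.
- by rewrite x0a.
- by move=> y yx0; apply: hB; rewrite /cball /= yx0.
Qed.

(** Where [l = 0], the concave [g] lies below [phi]. Two points on opposite sides of this hyperplane
    combine to a point on it, so each slope forced where [l < 0] is at most each slope allowed where
    [l > 0]; any value in between serves as [s]. *)
Lemma slope_step phi (g l : 'cV[R]_n -> R) (m : R) : (forall x, phi x != -oo%E) ->
  convexe phi -> 0 <= m ->
  (forall x y (t : R), 0 <= t <= 1 -> t * g x + (1 - t) * g y <= g (t *: x + (1 - t) *: y)) ->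
  (forall x y t, l (t *: x + (1 - t) *: y) = t * l x + (1 - t) * l y) ->
  (forall x, ((g x - m * `|l x|)%:E <= phi x)%E) ->
  exists2 s, `|s| <= m & forall x, ((g x + s * l x)%:E <= phi x)%E.
Proof.
move=> phiN /(convexeP phiN) c m0 gc lc h.
(* The slopes forced from the side [l x < 0]; the element [- m] keeps the set nonempty and its
   supremum at least [- m]. *)
pose S : set R := [set s | s = - m \/ exists x a, [/\ (phi x <= a%:E)%E, l x < 0 & s = (a - g x) / l x]].
have hr x a : (phi x <= a%:E)%E -> g x - m * `|l x| <= a.
  by move=> /(le_trans (h x)); rewrite lee_fin.
have S0 : S !=set0 by exists (- m); left.
have Sm : ubound S m.
  move=> _ [->|[x [a [xa lx ->]]]]; first lra.
  rewrite ler_ndivrMr//; have := hr _ _ xa; rewrite ltr0_norm//; lra.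
have supS : has_sup S by split => //; exists m.
exists (sup S).
  rewrite ler_norml; apply/andP; split; first by apply: ub_le_sup; [exists m|left].
  exact: sup_le_ub.
move=> x; apply: lee_fin_bound => a xa.
have [lx|lx|lx] := ltgtP (l x) 0.
- have : (a - g x) / l x <= sup S.
    by apply: ub_le_sup; [exists m|right; exists x, a].
  rewrite ler_ndivrMr//; lra.
- have : sup S <= (a - g x) / l x.
    apply: sup_le_ub => // _ [->|[y [b [yb ly ->]]]].
      rewrite ler_pdivlMr//; have := hr _ _ xa; rewrite gtr0_norm//; lra.
    have d0 : 0 < l x - l y by lra.
    (* The weight for which [l] vanishes at [t y + (1 - t) x]. *)
    pose t := l x / (l x - l y).
    have tE : t * (l x - l y) = l x by rewrite /t divfK ?gt_eqF.
    have t01 : 0 <= t <= 1.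
      by rewrite /t divr_ge0 ?(ltW lx) ?(ltW d0)//= ler_pdivrMr// mul1r; lra.
    have := hr _ _ (c y x t b a t01 yb xa); rewrite lc.
    have -> : t * l y + (1 - t) * l x = 0 by lra.
    rewrite normr0 mulr0 subr0 => h1; have := le_trans (gc _ _ _ t01) h1.
    move=> h2; rewrite ler_ndivrMr// mulrAC ler_pdivrMr//.
    have : 0 <= (t * (b - g y) + (1 - t) * (a - g x)) * (l x - l y).
      by rewrite mulr_ge0 ?(ltW d0)//; lra.
    rewrite mulrDl mulrAC tE mulrAC mulrBl mul1r tE; lra.
  rewrite ler_pdivlMr//; lra.
- have := hr _ _ xa; rewrite lx normr0 !mulr0; lra.
Qed.

(* Hahn-Banach, one coordinate at a time. *)
Lemma sandwich phi x0 (c m : R) : (forall x, phi x != -oo%E) -> convexe phi ->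
  0 <= m -> (forall x, ((c - m * \sum_i `|(x - x0) i 0|)%:E <= phi x)%E) ->
  exists2 y : 'cV[R]_n, `|y| <= m & forall x, ((c + dot y (x - x0))%:E <= phi x)%E.
Proof.
move=> phiN cphi m0 h.
(* The first [k] coordinates are already linear, the others still carry the concave weight. The sum
   of absolute values decouples the coordinates, so each slope is bounded by [m] on its own. *)
suff : forall k, exists2 y : 'cV[R]_n, `|y| <= m & forall x,
    ((c + \sum_(i < n) (if (i < k)%N then y i 0 * (x - x0) i 0
                        else - m * `|(x - x0) i 0|))%:E <= phi x)%E.
  move=> /(_ n) [y ym hy]; exists y => // x; apply: le_trans (hy x).
  rewrite lee_fin lerD2l le_eqVlt; apply/orP; left; apply/eqP.
  by apply: eq_bigr => i _; rewrite ltn_ord.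
elim=> [|k [y ym hy]].
  exists 0; first by rewrite normr0.
  move=> x; apply: le_trans (h x); rewrite lee_fin lerD2l mulr_sumr -sumrN.
  by apply: ler_sum => i _; rewrite mulNr.
have [kn|kn] := ltnP k n; last first.
  exists y => // x; apply: le_trans (hy x); rewrite lee_fin lerD2l.
  by apply: ler_sum => i _; rewrite !(leq_trans (ltn_ord i))// leqW.
pose ik := Ordinal kn.
pose G x := c + \sum_(i < n | i != ik) (if (i < k)%N then y i 0 * (x - x0) i 0
                        else - m * `|(x - x0) i 0|).
have [|||s sm hs] := @slope_step phi G (fun x => (x - x0) ik 0) m phiN cphi m0.
- move=> u v t /andP[t0 t1]; rewrite /G.
  set A := \sum_(i < n | _) _; set B := \sum_(i < n | _) _; set C := \sum_(i < n | _) _.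
  suff : t * A + (1 - t) * B <= C by lra.
  rewrite /A /B /C !mulr_sumr -big_split /=; apply: ler_sum => i _.
  have E : (t *: u + (1 - t) *: v - x0) i 0 = t * (u - x0) i 0 + (1 - t) * (v - x0) i 0.
    by rewrite !mxE; ring.
  case: ifP => _; rewrite E; first lra.
  have := ler_normD (t * (u - x0) i 0) ((1 - t) * (v - x0) i 0).
  rewrite !normrM (ger0_norm t0) (@ger0_norm _ (1 - t)) ?subr_ge0//.
  move: `|(u - x0) i 0| `|(v - x0) i 0| => p q /(ler_wpM2l m0); lra.
- by move=> u v t; rewrite !mxE; ring.
- move=> x; apply: le_trans (hy x).
  rewrite lee_fin [in leRHS](bigD1 ik)//= ltnn /G mulNr; lra.
exists (\col_i if i == ik then s else y i 0).
  apply: norm_le_coord => // i; rewrite mxE; case: ifP => // _.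
  exact: le_trans (norm_coord _ _) ym.
move=> x; apply: le_trans (hs x); rewrite lee_fin (bigD1 ik)//= mxE eqxx ltnSn /G.
rewrite -addrA lerD2l addrC lerD2r; apply: ler_sum => i ik'.
rewrite ltnS leq_eqVlt mxE (negbTE ik') /=.
by have /negbTE -> : (i : nat) != k by apply: contraNneq ik' => ik'; apply/eqP/val_inj.
Qed.

End Convex.

(** * Conjugation, Fenchel-Moreau and support functions *)

Section Legendre.
Context {R : realType} {n : nat}.
Implicit Types (x y z : 'cV[R]_n) (phi h : 'cV[R]_n -> \bar R).

Lemma legendre_leP phi x c : (legendre phi x <= c%:E)%E <->
  forall y, ((dot x y - c)%:E <= phi y)%E.
Proof.
split=> [h y|h].
  have := le_trans (ereal_sup_ubound (S := [set ((dot x y)%:E - phi y)%E | y in setT]) (ex_intro2 _ _ y I erefl)) h.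
  by case: (phi y) => [r| |]//=; rewrite ?leey// -EFinB !lee_fin; lra.
apply: ge_ereal_sup => _ [y _ <-]; have := h y.
by case: (phi y) => [r| |]//=; rewrite ?leNye// -EFinB !lee_fin; lra.
Qed.

Lemma legendre_ge phi x y r : (phi y <= r%:E)%E ->
  ((dot x y - r)%:E <= legendre phi x)%E.
Proof.
move=> yr; apply: lee_fin_bound => c /legendre_leP /(_ y) /le_trans /(_ yr).
by rewrite lee_fin; lra.
Qed.

(** A steep downward cone with apex [(x, c)] lies below [phi]: near [x] by lower semicontinuity,
    further away by the linear bound of [Cvx_linear_lower]. [sandwich] replaces the cone by an
    affine function. *)
Lemma affine_minorant phi x (c : R) : Cvx phi -> (c%:E < phi x)%E ->
  exists y, forall z, ((c + dot y (z - x))%:E <= phi z)%E.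
Proof.
move=> Cphi cx; case: (Cphi) => phiN cphi l _.
have [b b0 hb] := Cvx_linear_lower Cphi.
have [V Vx hV] := l _ _ cx.
have /nbhs_ballP[d /= d0 dV] := Vx.
(* [b] matches the slope of the linear lower bound; the second term makes up for its constant, and
   for [c], from distance [d] on. *)
pose m := b + (`|c| + b * (1 + `|x|)) / d.
have m0 : 0 <= m by rewrite addr_ge0// divr_ge0 ?(ltW d0)// addr_ge0// mulr_ge0// addr_ge0.
have [|y _ hy] := @sandwich _ _ phi x c m phiN cphi m0; last by exists y.
move=> z.
have zx : `|z - x| <= \sum_i `|(z - x) i 0|.
  apply: norm_le_coord => [|i]; first exact: sumr_ge0.
  by rewrite (bigD1 i)//= lerDl sumr_ge0.
have [zd|zd] := ltP `|z - x| d.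
  apply: le_trans (ltW (hV z _)).
    by rewrite lee_fin gerBl mulr_ge0 ?sumr_ge0.
  by apply: dV; rewrite -ball_normE /= distrC.
apply: le_trans (hb z); rewrite lee_fin.
have : m * `|z - x| <= m * \sum_i `|(z - x) i 0| by rewrite ler_wpM2l.
have : b * `|z| <= b * (`|z - x| + `|x|).
  by rewrite ler_wpM2l// -[in leLHS](subrK x z) ler_normD.
have : `|c| + b * (1 + `|x|) <= (`|c| + b * (1 + `|x|)) / d * `|z - x|.
  rewrite mulrAC ler_pdivlMr// ler_wpM2l// addr_ge0// mulr_ge0// addr_ge0//.
have := ler_norm c; rewrite /m; lra.
Qed.

(** If the biconjugate were below some [c < phi x], the affine minorant through [(x, c)], of slope
    [y], would bound the conjugate at [y] above and hence the biconjugate at [x] below by [c]. *)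
Lemma legendreK phi : Cvx phi -> legendre (legendre phi) = phi.
Proof.
move=> Cphi; case: (Cphi) => phiN _ _ _; apply/funext => x.
apply/eqP; rewrite eq_le; apply/andP; split.
  have := phiN x; case E : (phi x) => [r| |] // _; last exact: leey.
  apply/legendre_leP => y; rewrite dotC; apply: legendre_ge.
  by rewrite E.
rewrite leNgt; apply/negP => h.
have [c /andP[c1 c2]] : exists c : R, (legendre (legendre phi) x < c%:E < phi x)%E.
  move: h; have := phiN x; case: (phi x) => [r| |] // _.
    case: (legendre _ x) => [s| |] // h; last first.
      by exists (r - 1); rewrite ltNyr lte_fin ltrBlDr ltrDl ltr01.
    by exists ((s + r) / 2); rewrite !lte_fin in h *; apply/andP; split; lra.
  case: (legendre _ x) => [s| |] // _; last by exists 0; rewrite ltNyr ltry.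
  by exists (s + 1); rewrite ltry lte_fin ltrDl ltr01.
have [y hy] := affine_minorant Cphi c2.
have /legendre_leP : forall z, ((dot y z - (dot y x - c))%:E <= phi z)%E.
  by move=> z; have := hy z; rewrite dotBr opprB addrCA addrA.
move/(@legendre_ge _ x); rewrite dotC opprB addrC subrK => /le_lt_trans /(_ c1).
by rewrite ltxx.
Qed.

Lemma legendre_Cvx phi : Cvx phi -> Cvx (legendre phi).
Proof.
move=> Cphi; have [x0 [a x0a]] := Cvx_fin Cphi; case: (Cphi) => phiN cphi l _.
have LN x : legendre phi x != -oo%E.
  apply/eqP => E; have := @legendre_ge phi x x0 a.
  by rewrite x0a E => /(_ (lexx _)).
split=> //.
- apply/convexeP => // x y t a' b /andP[t0 t1] /legendre_leP xa /legendre_leP yb.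
  apply/legendre_leP => z; apply: lee_fin_bound => r zr.
  have := le_trans (xa z) zr; have := le_trans (yb z) zr.
  rewrite !lee_fin dotDl !dotZl => h1 h2.
  have := ler_wpM2l t0 h2; have : 0 <= 1 - t by lra.
  move=> /ler_wpM2l /(_ _ _ h1); lra.
- move=> x c /ereal_sup_gt[_ [y _ <-]].
  have := phiN y; case E : (phi y) => [r| |] // _; rewrite -EFinB lte_fin => h.
  exists [set x' | c < dot x' y - r].
    have := @dot_continuous R n y x.
    move=> /(@cvgr_gt _ _ (nbhs x)) /(_ (c + r)); rewrite -ltrBrDr => /(_ h).
    by apply: filterS => z /=; rewrite ltrBrDr.
  move=> z /= cz; apply: lt_le_trans (_ : (dot z y - r)%:E <= _)%E.
    by rewrite lte_fin.
  by apply: legendre_ge; rewrite E.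
- have [|y hy] := @affine_minorant phi x0 (a - 1) Cphi.
    by rewrite x0a lte_fin ltrBlDr ltrDl ltr01.
  exists y; rewrite -ltey; apply: le_lt_trans (ltry (dot y x0 - (a - 1))).
  apply/legendre_leP => z; apply: le_trans (hy z).
  by rewrite lee_fin dotBr; lra.
Qed.

(** For convex functions this says that the origin is interior to the domain. In this form it is
    dual to linear growth and passes to integrals at once. *)
Definition bounded0 h := exists2 rho : R, 0 < rho &
  exists M : R, forall x, `|x| <= rho -> (h x <= M%:E)%E.

(* Beyond the sphere of radius [K], coercivity forces linear growth. *)
Lemma linear_growth phi x0 (a K B : R) : (forall x, phi x != -oo%E) ->
  convexe phi -> (phi x0 <= a%:E)%E -> 0 < K ->
  (forall x, `|x - x0| = K -> ((a + 1)%:E <= phi x)%E) ->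
  (forall x, `|x - x0| <= K -> (B%:E <= phi x)%E) ->
  forall x, ((K^-1 * `|x| - (K^-1 * `|x0| + 1 + `|a| + `|B|))%:E <= phi x)%E.
Proof.
move=> phiN cphi x0a K0 hK hB x.
have : K^-1 * `|x| <= K^-1 * (`|x - x0| + `|x0|).
  by rewrite ler_wpM2l ?invr_ge0 ?(ltW K0)// -[in leLHS](subrK x0 x) ler_normD.
have [xK|xK] := leP `|x - x0| K => h1.
  apply: le_trans (hB x xK); rewrite lee_fin.
  have : K^-1 * `|x - x0| <= 1 by rewrite mulrC ler_pdivrMr// mul1r.
  have := ler_norm (- B); rewrite normrN.
  have := normr_ge0 a; lra.
have := convex_growth phiN cphi x0a K0 hK (ltW xK).
apply: le_trans; rewrite lee_fin (_ : a + 1 - a = 1) ?mul1r; last by ring.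
have := ler_norm (- a); rewrite normrN; have := normr_ge0 B; lra.
Qed.

Lemma coercive_linear phi : Cvx phi -> coercive phi ->
  exists2 rho : R, 0 < rho & exists M : R, forall x, ((rho * `|x| - M)%:E <= phi x)%E.
Proof.
move=> Cphi cphi; have [x0 [a x0a]] := Cvx_fin Cphi; case: (Cphi) => phiN c l _.
have [r hr] := cphi (a + 1).
(* On the sphere [|x - x0| = K] one has [|x| > r], hence [enorm x > r], and coercivity applies. *)
pose K := `|r| + `|x0| + 1.
have K0 : 0 < K by rewrite ltr_wpDl// addr_ge0.
have [B hB] := lsc_bounded_below phiN l (@cball_compact R n x0 K).
exists K^-1; first by rewrite invr_gt0.
exists (K^-1 * `|x0| + 1 + `|a| + `|B|).
apply: (@linear_growth phi x0) => //; first by rewrite x0a.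
move=> x xK; apply/ltW/hr/lt_le_trans/norm_enorm.
have := ler_normB x x0; rewrite xK /K; have := ler_norm r; lra.
Qed.

Lemma legendre_bounded0 phi : Cvx phi -> coercive phi -> bounded0 (legendre phi).
Proof.
move=> Cphi /(coercive_linear Cphi)[rho rho0 [M hM]].
have n0 : 0 < 1 + n%:R :> R by rewrite ltr_pwDl.
(* [dot_norm] costs a factor [n]; [1 + n] also covers [n = 0]. *)
exists (rho / (1 + n%:R)); first by rewrite divr_gt0.
exists M => x xr; apply/legendre_leP => y; apply: le_trans (hM y).
rewrite lee_fin lerD2r; apply: le_trans (ler_norm _) _.
apply: le_trans (dot_norm _ _) _; rewrite ler_wpM2r//.
move: xr; rewrite ler_pdivlMr// mulrDr mulr1; have := normr_ge0 x; lra.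
Qed.

(** The supremum is tested at [(rho / enorm y) y], whose sup norm is at most [rho]. *)
Lemma legendre_enorm_growth h (rho M : R) : 0 < rho ->
  (forall x, `|x| <= rho -> (h x <= M%:E)%E) ->
  forall y, ((rho * enorm y - M)%:E <= legendre h y)%E.
Proof.
move=> rho0 hM y; have [->|y0] := eqVneq y 0.
  rewrite enorm0 mulr0 -(dot0r (0 : 'cV[R]_n)); apply: legendre_ge.
  by apply: hM; rewrite normr0 ltW.
have ey : 0 < enorm y by rewrite enorm_gt0.
have -> : rho * enorm y = dot y ((rho / enorm y) *: y).
  by rewrite dotZr -sqr_enorm expr2 mulrA divfK ?gt_eqF.
apply/legendre_ge/hM; rewrite normrZ ger0_norm ?divr_ge0 ?(ltW rho0) ?(ltW ey)//.
by rewrite mulrAC ler_pdivrMr// ler_wpM2l ?(ltW rho0)// norm_enorm.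
Qed.

Lemma bounded0_coercive h : bounded0 h -> coercive (legendre h).
Proof.
move=> [rho rho0 [M hM]] c; exists ((c + M) / rho) => y.
rewrite ltr_pdivrMr// => cy; apply: lt_le_trans (legendre_enorm_growth rho0 hM y).
by rewrite lte_fin mulrC; lra.
Qed.

Lemma neglogE f phi : (forall x : 'cV[R]_n, (f x)%:E = expeR (- phi x)%E) ->
  neglog f = phi.
Proof. by move=> h; apply/funext => x; rewrite /neglog h expeRK oppeK. Qed.

Lemma expeR_neglog (f : 'cV[R]_n -> R) x : 0 <= f x -> (f x)%:E = expeR (- neglog f x)%E.
Proof. by move=> f0; rewrite oppeK; apply/esym/eqP; rewrite lneK_eq lee_fin. Qed.

Lemma LCcP f : LCc f <->
  [/\ Cvx (neglog f), coercive (neglog f) & forall x : 'cV[R]_n, 0 <= f x].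
Proof.
split=> [[phi [c1 c2 h]]|[c1 c2 f0]].
  by rewrite (neglogE h); split=> // x; rewrite -lee_fin h expeR_ge0.
by exists (neglog f); split => // x; apply: expeR_neglog.
Qed.

Lemma LCc_supp f : LCc f ->
  [/\ Cvx (supp f), bounded0 (supp f) & legendre (supp f) = neglog f].
Proof.
move=> /LCcP[c1 c2 _]; split; first exact: legendre_Cvx.
  exact: legendre_bounded0.
exact: legendreK.
Qed.

Lemma supp_inj (f g : 'cV[R]_n -> R) : LCc f -> LCc g -> supp f = supp g -> f = g.
Proof.
move=> Lf Lg fg; apply/funext => x; apply/eqP; rewrite -(inj_eq (@EFin_inj R)).
have [_ _ f0] := (LCcP f).1 Lf; have [_ _ g0] := (LCcP g).1 Lg.
have [_ _ Ef] := LCc_supp Lf; have [_ _ Eg] := LCc_supp Lg.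
by rewrite !expeR_neglog// -Ef -Eg fg.
Qed.

(** [fine] loses nothing when [phi] avoids [-oo]: the exponential is then finite. *)
Definition expN phi x : R := fine (expeR (- phi x)%E).

Lemma expNE phi x : phi x != -oo%E -> (expN phi x)%:E = expeR (- phi x)%E.
Proof. by rewrite /expN; case: (phi x). Qed.

Lemma LCc_expN phi : Cvx phi -> coercive phi -> LCc (expN phi).
Proof. by move=> c1 c2; exists phi; split=> // x; apply: expNE; case: c1. Qed.

Lemma neglog_expN phi : (forall x, phi x != -oo%E) -> neglog (expN phi) = phi.
Proof. by move=> phiN; apply: neglogE => x; apply: expNE. Qed.

(** This makes every admissible [h] a support function; both the definition of the endomorphism and
    the choice of test functions for uniqueness rest on it. *)
Lemma LCc_of_supp h : Cvx h -> bounded0 h ->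
  LCc (expN (legendre h)) /\ supp (expN (legendre h)) = h.
Proof.
move=> c1 c2; have c := legendre_Cvx c1.
split; first by apply: LCc_expN => //; apply: bounded0_coercive.
by rewrite /supp neglog_expN ?legendreK//; case: c.
Qed.

End Legendre.

Lemma nbhs_cVP {R : realType} {n : nat} (x : 'cV[R]_n) (V : set 'cV[R]_n) :
  nbhs x V <-> exists2 d : R, 0 < d & forall y, `|y - x| < d -> V y.
Proof.
split=> [/nbhs_ballP[d /= d0 dV]|[d d0 dV]].
  by exists d => // y yd; apply: dV; rewrite -ball_normE /= distrC.
apply/nbhs_ballP; exists d => // y; rewrite -ball_normE /= distrC; exact: dV.
Qed.

(** * The Asplund sum *)

Section AsplundSum.
Context {R : realType} {n : nat}.
Implicit Types (x y z : 'cV[R]_n) (phi : 'cV[R]_n -> \bar R) (f g : 'cV[R]_n -> R).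

Lemma neglogN f x : neglog f x != -oo%E.
Proof. by rewrite /neglog /lne; case: ifP. Qed.

Lemma neglog_le f x a : 0 <= f x -> (neglog f x <= a%:E)%E = (expR (- a) <= f x).
Proof. by move=> f0; rewrite -leeN2 -lee_expeR -expeR_neglog. Qed.

Lemma neglog_ge f x c : 0 <= f x -> (c%:E <= neglog f x)%E = (f x <= expR (- c)).
Proof. by move=> f0; rewrite -leeN2 -lee_expeR -expeR_neglog. Qed.

Lemma linear_coercive phi (rho M : R) : 0 < rho ->
  (forall x, ((rho * `|x| - M)%:E <= phi x)%E) -> coercive phi.
Proof.
move=> rho0 h c; have n0 : 0 < 1 + n%:R :> R by rewrite ltr_pwDl.
exists ((c + M) / rho * (1 + n%:R)) => x cx; apply: lt_le_trans (h x).
rewrite lte_fin.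
suff : c + M < rho * `|x| by lra.
rewrite -ltr_pdivrMl// mulrC -(ltr_pM2r n0); apply: lt_le_trans cx _.
apply: le_trans (enorm_norm x) _; have := normr_ge0 x; lra.
Qed.

(** Serves to apply lower semicontinuity to each summand separately, also at infinite values. *)
Lemma lt_split (u v : \bar R) (c : R) : u != -oo%E -> v != -oo%E ->
  (forall a b, (u <= a%:E)%E -> (v <= b%:E)%E -> c < a + b) ->
  exists al be, [/\ (al%:E < u)%E, (be%:E < v)%E & c <= al + be].
Proof.
case: u => [r| |] //; case: v => [s| |] // _ _ h.
- have := h r s (lexx _) (lexx _) => rs.
  exists (r - (r + s - c) / 2), (s - (r + s - c) / 2).
  by rewrite !lte_fin; split; lra.
- by exists (r - 1), (c - r + 1); rewrite lte_fin ltry; split => //; lra.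
- by exists (c - s + 1), (s - 1); rewrite lte_fin ltry; split => //; lra.
- by exists c, 0; rewrite !ltry; split => //; lra.
Qed.

Section Sum.
Variables (f g : 'cV[R]_n -> R).
Hypotheses (Lf : LCc f) (Lg : LCc g).
(** This is the infimal convolution of [neglog f] and [neglog g]; [q_le], [q_ge] and [q_lt] below
    express this with real bounds. *)
Let q := neglog (asplund_sum f g).

Let f0 x : 0 <= f x. Proof. by have [] := (LCcP f).1 Lf. Qed.
Let g0 x : 0 <= g x. Proof. by have [] := (LCcP g).1 Lg. Qed.

Let S x := [set f z.1 * g z.2 | z in [set z : 'cV[R]_n * 'cV[R]_n | z.1 + z.2 = x]].

Lemma LCc_bounded (h : 'cV[R]_n -> R) : LCc h -> exists C, forall x, h x <= C.
Proof.
move=> Lh; have [c1 c2 h0] := (LCcP h).1 Lh.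
have [rho rho0 [M hM]] := coercive_linear c1 c2.
exists (expR (- - M)) => x; rewrite -neglog_ge//; apply: le_trans (hM x).
by rewrite lee_fin lerDr mulr_ge0// ltW.
Qed.

Let S_ub x : has_ubound (S x).
Proof.
have [C hC] := LCc_bounded Lf; have [D hD] := LCc_bounded Lg.
by exists (C * D) => _ [z _ <-]; apply: ler_pM.
Qed.

Let Sn0 x : S x !=set0.
Proof. by exists (f x * g 0); exists (x, 0) => //=; rewrite addr0. Qed.

Lemma asplund_sum_ge0 x : 0 <= asplund_sum f g x.
Proof.
have [s Ss] := Sn0 x; apply: le_trans (ub_le_sup (S_ub x) Ss).
by case: Ss => z _ <-; apply: mulr_ge0.
Qed.

Let q_le z1 z2 a b : (neglog f z1 <= a%:E)%E -> (neglog g z2 <= b%:E)%E ->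
  (q (z1 + z2) <= (a + b)%:E)%E.
Proof.
rewrite /q !neglog_le ?asplund_sum_ge0// => h1 h2.
apply: le_trans (_ : f z1 * g z2 <= _).
  by rewrite opprD expRD; apply: ler_pM => //; exact: expR_ge0.
by apply: ub_le_sup (S_ub _) _ _; exists (z1, z2).
Qed.

Let q_ge x c : (forall z1 z2 a b, z1 + z2 = x -> (neglog f z1 <= a%:E)%E ->
  (neglog g z2 <= b%:E)%E -> c <= a + b) -> (c%:E <= q x)%E.
Proof.
move=> h; rewrite /q neglog_ge ?asplund_sum_ge0//; apply: ge_sup (Sn0 x) _.
move=> _ [[z1 z2] /= zx <-].
have [->|fz] := eqVneq (f z1) 0; first by rewrite mul0r expR_ge0.
have [->|gz] := eqVneq (g z2) 0; first by rewrite mulr0 expR_ge0.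
have fp : 0 < f z1 by rewrite lt_def fz f0.
have gp : 0 < g z2 by rewrite lt_def gz g0.
have := h z1 z2 (- ln (f z1)) (- ln (g z2)) zx.
rewrite !neglog_le// !opprK !lnK ?posrE// => /(_ (lexx _) (lexx _)) hc.
rewrite -[X in X * _ <= _]lnK ?posrE// -[X in _ * X <= _]lnK ?posrE//.
by rewrite -expRD ler_expR; lra.
Qed.

Let q_lt x c : (q x < c%:E)%E -> exists z1 z2 a b, [/\ z1 + z2 = x,
  (neglog f z1 <= a%:E)%E, (neglog g z2 <= b%:E)%E & a + b < c].
Proof.
move=> qx; apply: contrapT => h; move: qx; apply/negP; rewrite -leNgt.
apply: q_ge => z1 z2 a b zx fa gb; rewrite leNgt; apply/negP => ab.
by apply: h; exists z1, z2, a, b.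
Qed.

Let growth : exists rho M : R, 0 < rho /\ forall z1 z2 a b,
  (neglog f z1 <= a%:E)%E -> (neglog g z2 <= b%:E)%E ->
  rho * (`|z1| + `|z2|) - M <= a + b.
Proof.
have [c1 c2 _] := (LCcP f).1 Lf; have [d1 d2 _] := (LCcP g).1 Lg.
have [r1 r10 [M1 h1]] := coercive_linear c1 c2.
have [r2 r20 [M2 h2]] := coercive_linear d1 d2.
exists (Num.min r1 r2), (M1 + M2); split; first by rewrite lt_min r10.
move=> z1 z2 a b /(le_trans (h1 _)) + /(le_trans (h2 _)); rewrite !lee_fin.
have : Num.min r1 r2 * `|z1| <= r1 * `|z1| by rewrite ler_wpM2r// ge_min lexx.
have : Num.min r1 r2 * `|z2| <= r2 * `|z2| by rewrite ler_wpM2r// ge_min lexx orbT.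
lra.
Qed.

(** An infimum over all decompositions [x' = z1 + z2] need not be lower semicontinuous. By [growth]
    only [z1] in a ball independent of [x'] can give a value below [c'], and over this ball
    compactness makes the local estimates uniform. *)
Lemma asplund_sum_lsc : lower_semicontinuous q.
Proof.
move=> x c cq.
have [c1 _ _] := (LCcP f).1 Lf; have [d1 _ _] := (LCcP g).1 Lg.
have [c' /andP[cc' c'q]] : exists c', (c%:E < c'%:E < q x)%E.
  move: cq; have := neglogN (asplund_sum f g) x; rewrite -/q.
  case: (q x) => [r| |] // _; last by exists (c + 1); rewrite ltry lte_fin ltrDl ltr01.
  by rewrite lte_fin => h; exists ((c + r) / 2); rewrite !lte_fin; apply/andP; split; lra.
have [rho [M [rho0 hg]]] := growth.
pose K := (c' + M) / rho.
have Knear : \forall x' \near x, cball (0 : 'cV[R]_n) K `<=` (fun z => forall a b,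
    (neglog f z <= a%:E)%E -> (neglog g (x' - z) <= b%:E)%E -> c' <= a + b).
  apply: ((@compact_near_coveringP _ _).1 (@cball_compact R n 0 K) _ (nbhs x)
    (fun x' z => forall a b, (neglog f z <= a%:E)%E -> (neglog g (x' - z) <= b%:E)%E -> c' <= a + b)
    (nbhs_filter x)).
  move=> z _; have [|al [be [h1 h2 h3]]] :=
      @lt_split (neglog f z) (neglog g (x - z)) c' (neglogN _ _) (neglogN _ _).
    move=> a b fa gb.
    by have := q_le fa gb; rewrite addrC subrK => /(lt_le_trans c'q); rewrite lte_fin.
  case: c1 => _ _ /(_ _ _ h1) [V /nbhs_cVP[d d0 dV] hV] _.
  case: d1 => _ _ /(_ _ _ h2) [W /nbhs_cVP[r r0 rW] hW] _.
  (* [x' - z'] moves by both displacements, hence the halves of [r]. *)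
  exists ([set z' | `|z' - z| < Num.min d (r / 2)], [set x' | `|x' - x| < r / 2]).
    split => /=; apply/nbhs_cVP; [exists (Num.min d (r / 2)) | exists (r / 2)] => //.
      by rewrite lt_min d0 divr_gt0.
    by rewrite divr_gt0.
  move=> [z' x'] /= [+ h5]; rewrite lt_min => /andP[h4 h4'] a b fa gb.
  apply: le_trans h3 _; apply: lerD.
    by rewrite -lee_fin; apply: le_trans fa; apply/ltW/hV/dV.
  rewrite -lee_fin; apply: le_trans gb; apply/ltW/hW/rW.
  have -> : x' - z' - (x - z) = (x' - x) - (z' - z) by colring.
  by apply: le_lt_trans (ler_normB _ _) _; lra.
have /nbhs_cVP[d d0 hd] := Knear.
exists [set x' | `|x' - x| < d]; first by apply/nbhs_cVP; exists d.
move=> x' /hd h; apply: lt_le_trans (_ : c'%:E <= _)%E; first exact: cc'.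
apply: q_ge => z1 z2 a b zx fa gb.
have [zK|zK] := leP (`|z1 - 0|) K.
  by apply: (h z1) fa _ => //; rewrite -zx addrAC subrr add0r.
have := hg _ _ _ _ fa gb; move: zK; rewrite subr0 ltr_pdivrMr//.
have : 0 <= rho * `|z2| by rewrite mulr_ge0// ltW.
lra.
Qed.

Lemma asplund_sum_LCc : LCc (asplund_sum f g).
Proof.
apply/LCcP; have [c1 _ _] := (LCcP f).1 Lf; have [d1 _ _] := (LCcP g).1 Lg.
split; last exact: asplund_sum_ge0.
- split.
  + by move=> x; apply: neglogN.
  + apply/convexeP; first by move=> x; apply: neglogN.
    move=> x y t a b /andP[t0 t1] xa yb; apply/lee_addgt0Pr => e e0.
    have [|z1 [z2 [a1 [a2 [zx h1 h2 h3]]]]] := @q_lt x (a + e).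
      by apply: le_lt_trans xa _; rewrite lte_fin ltrDl.
    have [|w1 [w2 [b1 [b2 [wy k1 k2 k3]]]]] := @q_lt y (b + e).
      by apply: le_lt_trans yb _; rewrite lte_fin ltrDl.
    have t01 : 0 <= t <= 1 by rewrite t0.
    have := q_le ((convexeP (neglogN f)).1 (let: And4 _ c _ _ := c1 in c) _ _ _ _ _ t01 h1 k1)
      ((convexeP (neglogN g)).1 (let: And4 _ c _ _ := d1 in c) _ _ _ _ _ t01 h2 k2).
    rewrite addrACA -!scalerDr zx wy => /le_trans; apply.
    rewrite -EFinD lee_fin.
    have := ler_wpM2l t0 (ltW h3); have : 0 <= 1 - t by lra.
    by move=> /ler_wpM2l /(_ _ _ (ltW k3)); lra.
  + exact: asplund_sum_lsc.
  + have [x [a xa]] := Cvx_fin c1; have [y [b yb]] := Cvx_fin d1.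
    exists (x + y); rewrite -ltey; apply: le_lt_trans (ltry (a + b)).
    by apply: q_le; rewrite ?xa ?yb.
- have [rho [M [rho0 hg]]] := growth.
  apply: (@linear_coercive _ rho M) => // x; apply: q_ge => z1 z2 a b zx fa gb.
  apply: le_trans (hg _ _ _ _ fa gb); rewrite lerD2r ler_wpM2l ?(ltW rho0)//.
  by rewrite -zx ler_normD.
Qed.

(** Conjugation turns infimal convolution into addition. For the harder inequality the joint bound
    [H] is optimized in [z1] with [z2] fixed and then in [z2]; a point where [neglog g] is finite
    shows beforehand that [supp f x] is finite. *)
Lemma supp_asplund_sum x : supp (asplund_sum f g) x = (supp f x + supp g x)%E.
Proof.
have [[c1 _ _ _] _ _] := LCc_supp Lf; have [[d1 _ _ _] _ _] := LCc_supp Lg.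
have [[e1 _ _ _] _ _] := LCc_supp asplund_sum_LCc.
apply/eqP; rewrite eq_le; apply/andP; split.
  have := c1 x; have := d1 x; case Es : (supp f x) => [s| |] //; case Et : (supp g x) => [t| |] // _ _; rewrite ?leey//.
  have /legendre_leP hs : (supp f x <= s%:E)%E by rewrite Es.
  have /legendre_leP ht : (supp g x <= t%:E)%E by rewrite Et.
  apply/legendre_leP => y; apply: q_ge => z1 z2 a b <- fa gb.
  have := le_trans (hs _) fa; have := le_trans (ht _) gb.
  by rewrite !lee_fin dotDr; lra.
have := e1 x; case E : (supp (asplund_sum f g) x) => [r| |] // _; last exact: leey.
have /legendre_leP hr : (supp (asplund_sum f g) x <= r%:E)%E by rewrite E.
have H z1 z2 a b : (neglog f z1 <= a%:E)%E -> (neglog g z2 <= b%:E)%E ->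
    dot x z1 + dot x z2 - r <= a + b.
  by move=> fa gb; have := le_trans (hr _) (q_le fa gb); rewrite lee_fin dotDr.
have Hf z2 b : (neglog g z2 <= b%:E)%E -> (supp f x <= (r + b - dot x z2)%:E)%E.
  move=> gb; apply/legendre_leP => z1; apply: lee_fin_bound => a fa.
  by have := H _ _ _ _ fa gb; lra.
have [Cg _ _] := (LCcP g).1 Lg; have [z0 [b0 zb]] := Cvx_fin Cg.
have := Hf z0 b0; rewrite zb lexx => /(_ isT).
have := c1 x; case Es : (supp f x) => [s| |] // _ _.
have Hg : (supp g x <= (r - s)%:E)%E.
  apply/legendre_leP => z2; apply: lee_fin_bound => b gb.
  by have := Hf _ _ gb; rewrite Es lee_fin; lra.
apply: le_trans (leeD (lexx _) Hg) _; rewrite -EFinD lee_fin; lra.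
Qed.

End Sum.
End AsplundSum.

(** * Reflections and rotations *)

Section Orthogonal.
Context {R : realType} {n : nat}.
Implicit Types (x y z u w a b e : 'cV[R]_n) (A : 'M[R]_n).

Definition orthmx A := A^T *m A = 1%:M.

Lemma orthmxV A : orthmx A -> A *m A^T = 1%:M.
Proof. exact: mulmx1C. Qed.

Lemma orthmx_tr A : orthmx A -> orthmx A^T.
Proof. by move=> /orthmxV; rewrite /orthmx trmxK. Qed.

Lemma orthmxM A B : orthmx A -> orthmx B -> orthmx (A *m B).
Proof.
by move=> oA oB; rewrite /orthmx trmx_mul mulmxA -(mulmxA B^T) oA mulmx1.
Qed.

Lemma orthmx1 : orthmx 1%:M.
Proof. by rewrite /orthmx trmx1 mul1mx. Qed.

Lemma SO_orthmx A : SO A -> orthmx A. Proof. by case. Qed.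

Lemma dot_orthmx A x y : orthmx A -> dot (A *m x) (A *m y) = dot x y.
Proof. by move=> oA; rewrite dot_mulmx mulmxA oA mul1mx. Qed.

Lemma enorm_orthmx A x : orthmx A -> enorm (A *m x) = enorm x.
Proof. by move=> oA; rewrite /enorm dot_orthmx. Qed.

Lemma orthmx_unitmx A : orthmx A -> A \in unitmx.
Proof. by move=> /orthmxV/mulmx1_unit[]. Qed.

Lemma orthmx_invmx A : orthmx A -> invmx A = A^T.
Proof.
move=> oA; rewrite -[LHS]mul1mx -oA -mulmxA mulmxV ?mulmx1//.
exact: orthmx_unitmx.
Qed.

Lemma orthmx_det A : orthmx A -> \det A = 1 \/ \det A = -1.
Proof.
move=> oA; have : \det A ^+ 2 == 1 by rewrite expr2 -{1}det_tr -det_mulmx oA det1.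
by rewrite sqrf_eq1 => /orP[/eqP|/eqP]; [left|right].
Qed.

(** By polarization [A] preserves all inner products; then [A^T A y - y] is orthogonal to every
    vector, itself included. *)
Lemma orthmx_dotP A : (forall x, dot (A *m x) (A *m x) = dot x x) -> orthmx A.
Proof.
move=> h.
have h2 x y : dot x ((A^T *m A) *m y) = dot x y.
  rewrite -mulmxA -dot_mulmx; have := h (x + y).
  rewrite mulmxDr !dotDl !dotDr !h (dotC (A *m y)) (dotC y x); lra.
have h3 y : (A^T *m A) *m y = y.
  apply/eqP; rewrite -subr_eq0 -dot_eq0; apply/eqP.
  by rewrite dotBr h2 subrr.
apply/matrixP => i j; have := h3 (delta_mx j 0).
rewrite -colE => /colP /(_ i); rewrite !mxE => ->.
by rewrite eqxx andbT.
Qed.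

Definition refl u : 'M[R]_n := 1%:M - (2 / dot u u) *: (u *m u^T).

Lemma reflE u w : refl u *m w = w - (2 * dot u w / dot u u) *: u.
Proof.
rewrite mulmxBl mul1mx -scalemxAl -mulmxA; congr (_ - _).
have -> : u^T *m w = (dot u w)%:M.
  apply/matrixP => i j; rewrite !ord1 !mxE eqxx mulr1n.
  by apply: eq_bigr => k _; rewrite mxE.
by rewrite mul_mx_scalar scalerA mulrAC.
Qed.

Lemma refl_orthmx u : u != 0 -> orthmx (refl u).
Proof.
move=> /dot_gt0 u0; apply: orthmx_dotP => x.
rewrite reflE !dotBl !dotBr !dotZl !dotZr (dotC x u); field.
by rewrite gt_eqF.
Qed.

(** In the block identity the outer factors have determinant 1, so the middle factor and the
    right-hand side have equal determinants. *)
Lemma det_1Dmul (c : 'cV[R]_n) (r : 'rV[R]_n) :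
  \det (1%:M + c *m r) = 1 + (r *m c) 0 0.
Proof.
have : block_mx 1%:M 0 r 1%:M *m block_mx (1%:M + c *m r) c 0 1%:M *m
   block_mx 1%:M 0 (- r) 1%:M = block_mx 1%:M c 0 (1%:M + r *m c).
  rewrite !mulmx_block !mul1mx !mulmx1 !mul0mx !mulmx0 !addr0 !add0r.
  rewrite mulmxN addrK mulmxDr mulmx1 mulmxN mulmxDl mul1mx mulmxA.
  by rewrite [r *m c *m r + r]addrC subrr [r *m c + _]addrC.
move/(congr1 determinant); rewrite !det_mulmx !det_lblock !det_ublock !det1.
by rewrite !mul1r !mulr1 => ->; rewrite det_mx11 !mxE eqxx.
Qed.

Lemma refl_det u : u != 0 -> \det (refl u) = -1.
Proof.
move=> /dot_gt0 u0; rewrite /refl scalemxAl -mulNmx det_1Dmul mxE.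
rewrite (_ : \sum_j _ = - 2); first by ring.
rewrite (eq_bigr (fun j => - (2 / dot u u) * (u j 0 * u j 0))).
  by rewrite -mulr_sumr -/(dot u u) mulNr divfK// gt_eqF.
by move=> j _; rewrite !mxE; ring.
Qed.

Lemma refl_swap a b : dot a a = dot b b -> a != b -> refl (a - b) *m a = b.
Proof.
move=> ab; rewrite -subr_eq0 => /dot_gt0 ab0; rewrite reflE.
have -> : 2 * dot (a - b) a / dot (a - b) (a - b) = 1.
  have E : 2 * dot (a - b) a = dot (a - b) (a - b).
    by rewrite !dotBl !dotBr -ab (dotC b a); ring.
  by rewrite E divff// gt_eqF.
by rewrite scale1r subKr.
Qed.

Lemma refl_fix u w : dot u w = 0 -> refl u *m w = w.
Proof. by move=> uw; rewrite reflE uw mulr0 mul0r scale0r subr0. Qed.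

Lemma kernel_col k (M : 'M[R]_(n, k)) : (k < n)%N ->
  exists2 w, w != 0 & (w^T *m M = 0 :> 'rV_k).
Proof.
move=> kn; have : kermx M != 0.
  rewrite -mxrank_eq0 mxrank_ker subn_eq0 -ltnNge.
  exact: leq_ltn_trans (rank_leq_col _) kn.
move=> /matrix0Pn[i [j kij]].
exists (row i (kermx M))^T.
  by apply: contraNneq kij => /(congr1 trmx); rewrite trmxK trmx0 => /rowP/(_ j); rewrite !mxE => ->.
by rewrite trmxK -row_mul mulmx_ker row0.
Qed.

Lemma normalize_dot w : w != 0 -> dot ((enorm w)^-1 *: w) ((enorm w)^-1 *: w) = 1.
Proof.
move=> w0; by rewrite dotZl dotZr -sqr_enorm expr2 mulrA -mulrA mulKf ?mulVf ?enorm_eq0.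
Qed.

Lemma dot_trmx w a : (w^T *m a) 0 0 = dot w a.
Proof. by rewrite mxE; apply: eq_bigr => i _; rewrite mxE. Qed.

Lemma unit_perp a : (2 <= n)%N -> exists w, dot w w = 1 /\ dot w a = 0.
Proof.
move=> n2; have [w w0 wa] := kernel_col a n2.
exists ((enorm w)^-1 *: w); split; first exact: normalize_dot.
by rewrite dotZl -dot_trmx wa mxE mulr0.
Qed.

(** Dimension at least 3 enters here: with [a] the pole, it provides a second direction orthogonal
    to it. *)
Lemma unit_perp2 a b : (3 <= n)%N ->
  exists w, [/\ dot w w = 1, dot w a = 0 & dot w b = 0].
Proof.
move=> n3; have [w w0] := kernel_col (row_mx a b) n3.
rewrite mul_mx_row -[0]hsubmxK => /eq_row_mx[wa wb].
exists ((enorm w)^-1 *: w); split; first exact: normalize_dot.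
  by rewrite dotZl -dot_trmx wa !mxE mulr0.
by rewrite dotZl -dot_trmx wb !mxE mulr0.
Qed.

Lemma SO1 : SO (1%:M : 'M[R]_n).
Proof. by split; [exact: orthmx1|rewrite det1]. Qed.

(** The reflection along [a - b] swaps [a] and [b]; a second one, along a vector orthogonal to [a],
    corrects the determinant. *)
Lemma SO_transitive a b : (2 <= n)%N -> dot a a = 1 -> dot b b = 1 ->
  exists2 A, SO A & A *m a = b.
Proof.
move=> n2 aa bb; have [<-|ab] := eqVneq a b.
  by exists 1%:M; [exact: SO1|rewrite mul1mx].
have [w [ww wa]] := unit_perp a n2.
have w0 : w != 0 by rewrite -dot_eq0 ww oner_eq0.
have ab0 : a - b != 0 by rewrite subr_eq0.
exists (refl (a - b) *m refl w).
  split; first by apply: orthmxM; apply: refl_orthmx.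
  by rewrite det_mulmx !refl_det// mulrNN mulr1.
by rewrite -mulmxA (refl_fix wa) refl_swap// aa bb.
Qed.

Lemma sphere_dot a : sphere a <-> dot a a = 1.
Proof.
split=> [|aa]; first by rewrite -sqr_enorm => ->; rewrite expr1n.
by rewrite /sphere /= /enorm aa sqrtr1.
Qed.

Lemma rot_toP e x : (2 <= n)%N -> sphere e -> x != 0 ->
  SO (Defs.rot_to e x) /\ Defs.rot_to e x *m e = (enorm x)^-1 *: x.
Proof.
move=> n2 /sphere_dot ee x0.
have [A SA Ae] := SO_transitive n2 ee (normalize_dot x0).
exact: (@xgetPex _ 1%:M [set A | SO A /\ A *m e = (enorm x)^-1 *: x]
  (ex_intro _ A (conj SA Ae))).
Qed.

Lemma sphere_orthmx A x : orthmx A -> sphere (A *m x) <-> sphere x.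
Proof. by move=> oA; rewrite /sphere /= enorm_orthmx. Qed.

(** Gram-Schmidt; when [x] or the remainder of [y] vanishes, an arbitrary orthogonal unit vector
    completes the frame. *)
Lemma plane_frame x y : (2 <= n)%N -> exists a b, [/\ dot a a = 1, dot b b = 1,
  dot a b = 0 & (exists al be, x = al *: a + be *: b) /\
                (exists ga de, y = ga *: a + de *: b)].
Proof.
move=> n2.
have [a [aa [al xa]]] : exists a, dot a a = 1 /\ exists al, x = al *: a.
  have [->|x0] := eqVneq x 0.
    have [a [aa _]] := unit_perp 0 n2; exists a; split=> //; exists 0.
    by rewrite scale0r.
  exists ((enorm x)^-1 *: x); split; first exact: normalize_dot.
  by exists (enorm x); rewrite scalerA mulfV ?enorm_eq0// scale1r.
pose y' := y - dot y a *: a.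
have y'a : dot y' a = 0 by rewrite dotBl dotZl aa mulr1 subrr.
have [b [bb ab [de yb]]] : exists b, [/\ dot b b = 1, dot a b = 0 & exists de, y' = de *: b].
  have [->|y0] := eqVneq y' 0.
    have [b [bb ba]] := unit_perp a n2; exists b; split; rewrite 1?dotC//.
    by exists 0; rewrite scale0r.
  exists ((enorm y')^-1 *: y'); split; first exact: normalize_dot.
    by rewrite dotC dotZl y'a mulr0.
  by exists (enorm y'); rewrite scalerA mulfV ?enorm_eq0// scale1r.
exists a, b; split=> //; split.
  by exists al, 0; rewrite scale0r addr0.
by exists (dot y a), de; rewrite -yb addrC subrK.
Qed.

End Orthogonal.

(** * Borel measures on the sphere *)

Section BoundedBelow.
Context d (T : measurableType d) (R : realType).
Variables (mu : {finite_measure set T -> \bar R}) (D : set T) (mD : measurable D).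
Implicit Types (f g : T -> \bar R) (b k c : R).
Local Open Scope ereal_scope.

Let muD_fin : mu D \is a fin_num. Proof. exact: fin_num_measure. Qed.

Let cst_fin c : c%:E * mu D \is a fin_num.
Proof. by rewrite fin_numM. Qed.

Lemma integral_shift_ge0 f k : measurable_fun D f -> (0 <= k)%R ->
  (forall x, D x -> (- k)%:E <= f x) ->
  \int[mu]_(x in D) (f x + k%:E) = \int[mu]_(x in D) f x + k%:E * mu D.
Proof.
move=> mf k0 fk.
have fk0 x : D x -> 0 <= f x + k%:E.
  by move=> /fk; rewrite EFinN -leeBlDr// sub0e.
have mfk : measurable_fun D (fun x => f x + k%:E) by apply: emeasurable_funD.
have mp : measurable_fun D f^\+ by apply: measurable_funepos.
have mn : measurable_fun D f^\- by apply: measurable_funeneg.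
have nk x : D x -> f^\- x <= k%:E.
  move=> /fk; rewrite funenegE ge_max lee_fin k0 andbT.
  by case: (f x) => [r| |] //=; rewrite ?leNye// !lee_fin; lra.
have In : \int[mu]_(x in D) f^\- x \is a fin_num.
  rewrite ge0_fin_numE; last by apply: integral_ge0.
  apply: le_lt_trans (_ : k%:E * mu D < +oo); last by rewrite ltey_eq cst_fin.
  rewrite -integral_cst//; apply: ge0_le_integral => //.
have : \int[mu]_(x in D) (f x + k%:E) + \int[mu]_(x in D) f^\- x =
       \int[mu]_(x in D) f^\+ x + k%:E * mu D.
  rewrite -integral_cst// -!ge0_integralD//.
  apply: eq_integral => x /[!inE] /fk; rewrite funeposE funenegE.
  case: (f x) => [r| |] //=; last 1 first.
    by rewrite maxNye maxye addye// adde0 addye.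
  move=> _.
  by rewrite -!EFin_max -!EFinD /Num.max; do 2 case: ltP => ?; congr EFin; lra.
move=> /(congr1 (fun u => u - \int[mu]_(x in D) f^\- x)).
by rewrite addeK// addeAC => ->; rewrite [in RHS]integralE.
Qed.

(** For [k] of either sign, add a large [l] for which the previous lemma applies to [f] with [k + l]
    and to [f + k] with [l], and cancel [l * mu D]. *)
Lemma integral_shift f b k : measurable_fun D f ->
  (forall x, D x -> b%:E <= f x) ->
  \int[mu]_(x in D) (f x + k%:E) = \int[mu]_(x in D) f x + k%:E * mu D.
Proof.
move=> mf fb.
have H g : measurable_fun D g -> (exists c, forall x, D x -> c%:E <= g x) ->
  exists2 l0 : R, (0 <= l0)%R & forall l, (l0 <= l)%R -> \int[mu]_(x in D) (g x + l%:E) = \int[mu]_(x in D) g x + l%:E * mu D.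
  move=> mg [c gc]; exists `|c|%R => // l cl; apply: integral_shift_ge0 => //.
    exact: le_trans cl.
  move=> x /gc; apply: le_trans; rewrite lee_fin.
  by have := ler_norm (- c)%R; rewrite normrN; lra.
have [l0 l00 h] := H f mf (ex_intro _ b fb).
have mfk : measurable_fun D (fun x => f x + k%:E) by apply: emeasurable_funD.
have fkb : exists c, forall x, D x -> c%:E <= f x + k%:E.
  by exists (b + k)%R => x /fb h'; rewrite EFinD; apply: leeD.
have [l1 l10 h'] := H _ mfk fkb.
pose l := (l0 + l1 + `|k|)%R.
have kn := ler_norm (- k)%R; rewrite normrN in kn.
have := h' l; rewrite /l => /(_ ltac:(have := normr_ge0 k; lra)).
under eq_integral do rewrite -addeA -EFinD.
rewrite h; last by rewrite /l; lra.
rewrite EFinD muleDl// ?fin_num_adde_defr// addeA => /(congr1 (fun u => u - l%:E * mu D)).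
by rewrite !addeK.
Qed.

(** As in the lemmas that follow, constants make the functions nonnegative, where infinite integrals
    are harmless, and [integral_shift] removes the constants afterwards. *)
Lemma bb_integralD f g b c : measurable_fun D f -> measurable_fun D g ->
  (forall x, D x -> b%:E <= f x) -> (forall x, D x -> c%:E <= g x) ->
  \int[mu]_(x in D) (f x + g x) = \int[mu]_(x in D) f x + \int[mu]_(x in D) g x.
Proof.
move=> mf mg fb gc.
have mfg : measurable_fun D (fun x => f x + g x) by apply: emeasurable_funD.
have h := @integral_shift (fun x => f x + g x) (b + c) (- b - c) mfg _.
have {}h := h ltac:(by move=> x Dx; rewrite EFinD; apply: leeD; [exact: fb|exact: gc]).
have hf := integral_shift (- b)%R mf fb; have hg := integral_shift (- c)%R mg gc.
have : \int[mu]_(x in D) ((f x + g x) + (- b - c)%:E) =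
   \int[mu]_(x in D) (f x + (- b)%:E) + \int[mu]_(x in D) (g x + (- c)%:E).
  rewrite -ge0_integralD//.
  - by apply: eq_integral => x _; rewrite EFinD addeACA.
  - by move=> x /fb; rewrite EFinN sube_ge0.
  - exact: emeasurable_funD.
  - by move=> x /gc; rewrite EFinN sube_ge0.
  - exact: emeasurable_funD.
rewrite h hf hg EFinD muleDl// ?fin_num_adde_defr// addeACA.
move=> /(congr1 (fun u => u - ((- b)%:E * mu D + (- c)%:E * mu D))).
by rewrite !addeK// fin_numD !cst_fin.
Qed.

Lemma bb_integralZ f b c : measurable_fun D f -> (0 <= c)%R ->
  (forall x, D x -> b%:E <= f x) ->
  \int[mu]_(x in D) (c%:E * f x) = c%:E * \int[mu]_(x in D) f x.
Proof.
move=> mf c0 fb.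
have mcf : measurable_fun D (fun x => c%:E * f x) by apply: measurable_funeM.
have h := @integral_shift (fun x => c%:E * f x) (c * b) (c * - b) mcf _.
have {}h := h ltac:(by move=> x Dx; rewrite EFinM; apply: lee_wpmul2l; [rewrite lee_fin|exact: fb]).
have hf := integral_shift (- b)%R mf fb.
have : \int[mu]_(x in D) (c%:E * f x + (c * - b)%:E) =
  c%:E * \int[mu]_(x in D) (f x + (- b)%:E).
  rewrite -ge0_integralZl_EFin//.
  - by apply: eq_integral => x _; rewrite muleDr ?fin_num_adde_defl.
  - by move=> x /fb; rewrite EFinN sube_ge0.
  - exact: emeasurable_funD.
rewrite h hf muleDr ?fin_num_adde_defl// muleA -EFinM.
move=> /(congr1 (fun u => u - (c * - b)%:E * mu D)).
by rewrite !addeK.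
Qed.

Lemma bb_integral_le f g b : measurable_fun D f -> measurable_fun D g ->
  (forall x, D x -> b%:E <= f x) -> (forall x, D x -> f x <= g x) ->
  \int[mu]_(x in D) f x <= \int[mu]_(x in D) g x.
Proof.
move=> mf mg fb fg.
have gb x : D x -> b%:E <= g x by move=> Dx; apply: le_trans (fg x Dx); exact: fb.
have hf := integral_shift (- b)%R mf fb; have hg := integral_shift (- b)%R mg gb.
rewrite -(leeD2rE (x := (- b)%:E * mu D))// -hf -hg; apply: ge0_le_integral => //.
- by move=> x /fb; rewrite EFinN sube_ge0.
- exact: emeasurable_funD.
- exact: emeasurable_funD.
- by move=> x Dx; apply: leeD => //; exact: fg.
Qed.

Lemma bb_integral_ge f b : measurable_fun D f -> (forall x, D x -> b%:E <= f x) ->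
  b%:E * mu D <= \int[mu]_(x in D) f x.
Proof.
by move=> mf fb; rewrite -integral_cst//; apply: (@bb_integral_le _ _ b) => //=.
Qed.

Lemma bb_fatou (f_ : nat -> T -> \bar R) f b :
  (forall m, measurable_fun D (f_ m)) -> measurable_fun D f ->
  (forall m x, D x -> b%:E <= f_ m x) -> (forall x, D x -> b%:E <= f x) ->
  (forall x, D x -> f x <= limn_einf (f_ ^~ x)) ->
  \int[mu]_(x in D) f x <= limn_einf (fun m => \int[mu]_(x in D) f_ m x).
Proof.
move=> mf_ mf fb_ fb fl.
have h := integral_shift (- b)%R mf fb.
have h_ m := integral_shift (- b)%R (mf_ m) (fb_ m).
have := @fatou _ _ _ mu D mD (fun m x => f_ m x + (- b)%:E)
  (fun m => emeasurable_funD (mf_ m) (measurable_cst _)).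
have p m x : D x -> 0 <= f_ m x + (- b)%:E by move=> /fb_; rewrite EFinN sube_ge0.
move=> /(_ p).
have Eh : (fun m => \int[mu]_(x in D) (f_ m x + (- b)%:E)) =
    (fun m => (- b)%:E * mu D + \int[mu]_(x in D) f_ m x).
  by apply/funext => m; rewrite h_ addeC.
move=> h0; have {h0} h1 : \int[mu]_(x in D) limn_einf (fun m => f_ m x + (- b)%:E) <=
    limn_einf (fun m => (- b)%:E * mu D + \int[mu]_(x in D) f_ m x).
  by rewrite -Eh; exact: h0.
rewrite limn_einf_shift// in h1.
rewrite -(leeD2lE (x := (- b)%:E * mu D))//; apply: le_trans h1.
rewrite addeC -h; apply: ge0_le_integral => //.
- by move=> x /fb; rewrite EFinN sube_ge0.
- exact: emeasurable_funD.
- apply: measurableT_comp; first exact: oppe_measurable.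
  apply: measurable_fun_limn_esup => m; apply: measurableT_comp; first exact: oppe_measurable.
  exact: emeasurable_funD.
- move=> x Dx; under eq_fun do rewrite addeC.
  by rewrite limn_einf_shift// addeC leeD2lE// fl.
Qed.

End BoundedBelow.

(** * Borel measurability, Lipschitz convex functions and boxes *)

Section Borel.
Context {R : realType} {n : nat}.
Implicit Types (x y v : 'cV[R]_n) (phi : 'cV[R]_n -> \bar R) (A : 'M[R]_n).
Local Notation T := (borelRn R n).

Lemma open_measurableRn (U : set 'cV[R]_n) : open U -> measurable (U : set T).
Proof. exact: sub_sigma_algebra. Qed.

Lemma continuous_measurableRn (f : 'cV[R]_n -> 'cV[R]_n) : continuous f ->
  measurable_fun setT (f : T -> T).
Proof.
move=> cf; apply: (@measurability _ _ T T setT f (@open 'cV[R]_n)) => //.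
move=> _ [U oU <-]; rewrite setTI; apply: open_measurableRn.
by move/continuousP : cf; exact.
Qed.

Lemma lsc_measurableRn phi : lower_semicontinuous phi ->
  measurable_fun setT (phi : T -> \bar R).
Proof.
move=> scif; apply: (measurability _ (ErealGenOInfty.measurableE R)).
move=> /= _ [_ [a ->]] <-; rewrite setTI; apply: open_measurableRn.
by rewrite preimage_itvoy; move/lower_semicontinuousP : scif; exact.
Qed.

Lemma continuous_lsc (f : 'cV[R]_n -> R) : continuous f ->
  lower_semicontinuous (fun v => (f v)%:E).
Proof.
move=> cf x a; rewrite lte_fin => ax.
exists [set y | a < f y]; last by move=> y; rewrite lte_fin.
exact: (cvgr_gt (f x) (cf x)).
Qed.

Lemma continuous_comp_lsc (f : 'cV[R]_n -> 'cV[R]_n) phi : continuous f ->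
  lower_semicontinuous phi -> lower_semicontinuous (phi \o f).
Proof.
move=> cf lphi x a /lphi [V xV hV]; exists (f @^-1` V); first exact: cf.
by move=> y /hV.
Qed.

Lemma enorm_continuous : continuous (@enorm R n).
Proof.
apply: (@lip_continuous _ _ _ _ n%:R) => x y.
apply: le_trans (enorm_norm _).
have h (u w : 'cV[R]_n) : enorm u - enorm w <= enorm (u - w).
  by rewrite lerBlDr -{1}(subrK w u) enormD.
rewrite ler_norml h andbT lerNl opprB.
by apply: le_trans (h _ _) _; rewrite -opprB -scaleN1r enormZ normrN1 mul1r.
Qed.

Lemma sphere_measurable : measurable (@sphere R n : set T).
Proof.
rewrite -[X in measurable X]setCK; apply: measurableC; apply: open_measurableRn.
apply: closed_openC.
apply: (@preimage_closed _ _ enorm [set 1]); last exact: closed_eq.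
by move=> x _; exact: enorm_continuous.
Qed.

Lemma mulmx_norm A x : `|A *m x| <= n%:R * `|A| * `|x|.
Proof.
apply: norm_le_coord => [|i]; first by rewrite !mulr_ge0.
rewrite mxE; apply: le_trans (ler_norm_sum _ _ _) _.
apply: le_trans (_ : \sum_(j < n) `|A| * `|x| <= _).
  apply: ler_sum => j _; rewrite normrM ler_pM ?norm_coord//.
  rewrite [leRHS]/Num.norm /= mx_normrE.
  by apply: (@le_bigmax _ _ _ _ (fun ij : 'I_n * 'I_n => `|A ij.1 ij.2|) (i, j)).
by rewrite sumr_const card_ord -[X in X <= _]mulr_natl mulrA.
Qed.

Lemma mulmx_continuous A : continuous (mulmx A : 'cV[R]_n -> 'cV[R]_n).
Proof.
apply: (@lip_continuous _ _ _ _ (n%:R * `|A|)) => x y.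
by rewrite -mulmxBr mulmx_norm.
Qed.

Lemma mulmx_measurable A : measurable_fun setT (mulmx A : T -> T).
Proof. exact: continuous_measurableRn (@mulmx_continuous A). Qed.

Definition preserves (mu : {finite_measure set T -> \bar R}) A :=
  forall B : set T, measurable B -> mu (mulmx A @^-1` B) = mu B.

Lemma integral_mulmx (mu : {finite_measure set T -> \bar R}) A phi :
  orthmx A -> preserves mu A -> measurable_fun setT (phi : T -> \bar R) ->
  (\int[mu]_(v in sphere) phi (A *m v) = \int[mu]_(v in sphere) phi v)%E.
Proof.
move=> oA muA mphi.
have H (g : T -> \bar R) : measurable_fun setT g -> (forall v, 0 <= g v)%E ->
    (\int[mu]_(v in sphere) g (A *m v) = \int[mu]_(v in sphere) g v)%E.
  move=> mg g0.
  have := @ge0_integral_pushforward _ _ T T R _ (mulmx_measurable A) mu sphere g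
     sphere_measurable (measurable_funS measurableT (@subsetT _ _) mg) (fun v _ => g0 v).
  rewrite (_ : mulmx A @^-1` sphere = sphere); last first.
    by apply/seteqP; split => v /= /(sphere_orthmx v oA).
  move=> <-; apply: eq_measure_integral; first exact: mulmx_measurable.
  by move=> mA B mB _; exact: muA.
rewrite [LHS]integralE [RHS]integralE; congr (_ - _)%E.
  rewrite -[RHS]H//; last exact: measurable_funepos.
  by apply: eq_integral => v _; rewrite !funeposE.
rewrite -[RHS]H//; last exact: measurable_funeneg.
by apply: eq_integral => v _; rewrite !funenegE.
Qed.


Definition convex_fun (C : 'cV[R]_n -> R) := forall x y (t : R), 0 <= t <= 1 ->
  C (t *: x + (1 - t) *: y) <= t * C x + (1 - t) * C y.

Definition lipschitz_fun (K : R) (C : 'cV[R]_n -> R) :=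
  forall x y, `|C x - C y| <= K * `|x - y|.

Lemma convex_fun_max C1 C2 : convex_fun C1 -> convex_fun C2 ->
  convex_fun (fun v => Num.max (C1 v) (C2 v)).
Proof.
move=> h1 h2 x y t /[dup] /andP[t0 t1] t01; rewrite ge_max.
have t1' : 0 <= 1 - t by lra.
apply/andP; split; [apply: le_trans (h1 _ _ _ t01) _|apply: le_trans (h2 _ _ _ t01) _];
  by apply: lerD; rewrite ler_wpM2l// le_max lexx ?orbT.
Qed.

Lemma lipschitz_fun_max K C1 C2 : lipschitz_fun K C1 -> lipschitz_fun K C2 ->
  lipschitz_fun K (fun v => Num.max (C1 v) (C2 v)).
Proof.
move=> h1 h2 x y; have := h1 x y; have := h2 x y; rewrite !ler_norml.
by rewrite /Num.max; do 2 case: ltP => ?; move=> /andP[? ?] /andP[? ?]; apply/andP; split; lra.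
Qed.

Lemma lipschitz_bounded K C v : 0 <= K -> lipschitz_fun K C -> `|v| <= 1 ->
  `|C v| <= `|C 0| + K.
Proof.
move=> K0 /(_ v 0); rewrite subr0 => h v1.
have : `|C v| <= `|C v - C 0| + `|C 0| by rewrite -{1}(subrK (C 0) (C v)) ler_normD.
have : K * `|v| <= K by rewrite -[leRHS]mulr1 ler_wpM2l.
lra.
Qed.

Lemma sphere_norm v : sphere v -> `|v| <= 1.
Proof. by move=> vs; rewrite (le_trans (norm_enorm v)) ?vs. Qed.

Section Box.
Variables l r : 'cV[R]_n.

Definition box : set 'cV[R]_n := [set v | forall i, l i 0 < v i 0 < r i 0].

(** As a maximum of affine functions with slopes at most 1 this is convex and Lipschitz. The base
    value [-1] is negative and so does not affect the sign test of [box_gaugeE]. *)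
Definition box_gauge v : R :=
  \big[Num.max/-1]_i Num.max (l i 0 - v i 0) (v i 0 - r i 0).

Lemma box_gaugeE v : box v <-> box_gauge v < 0.
Proof.
split=> [bv|/bigmax_ltP[_ h] i].
  apply/bigmax_ltP; split; first by rewrite ltrN10.
  by move=> i _; have := bv i; rewrite gt_max !subr_lt0.
by have := h i isT; rewrite gt_max !subr_lt0.
Qed.

Lemma box_gauge_convex : convex_fun box_gauge.
Proof.
move=> x y t t01; rewrite /box_gauge.
elim: (index_enum _) => [|i s IH]; first by rewrite !big_nil; lra.
rewrite !big_cons.
pose g v := Num.max (l i 0 - v i 0) (v i 0 - r i 0).
have gc : convex_fun g.
  by apply: convex_fun_max => u w a _; rewrite !mxE; lra.
rewrite ge_max; case/andP: (t01) => t0 t1; have t1' : 0 <= 1 - t by lra.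
apply/andP; split; [apply: le_trans (gc _ _ _ t01) _|apply: le_trans IH _];
  by apply: lerD; rewrite ler_wpM2l// le_max lexx ?orbT.
Qed.

Lemma box_gauge_lipschitz : lipschitz_fun 1 box_gauge.
Proof.
move=> x y; rewrite /box_gauge.
elim: (index_enum _) => [|i s IH]; first by rewrite !big_nil subrr normr0 mul1r.
rewrite !big_cons.
have : lipschitz_fun 1 (fun v => Num.max (l i 0 - v i 0) (v i 0 - r i 0)).
  apply: lipschitz_fun_max => u w; rewrite mul1r; apply: le_trans (norm_coord _ i).
    by rewrite (_ : _ - _ = - ((u - w) i 0)) ?normrN// !mxE; ring.
  by rewrite !mxE (_ : _ - _ = u i 0 - w i 0)//; ring.
move=> /(_ x y); move: IH; rewrite !ler_norml.
move: (\big[_/_]_(_ <- _) _) (\big[_/_]_(_ <- _) _) => p q.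
move: (Num.max (l i 0 - x i 0) _) (Num.max (l i 0 - y i 0) _) => p' q'.
by rewrite /Num.max; do 2 case: ltP => ?; move=> /andP[? ?] /andP[? ?]; apply/andP; split; lra.
Qed.

End Box.

Lemma box_setI l r l' r' : box l r `&` box l' r' =
  box (\col_i Num.max (l i 0) (l' i 0)) (\col_i Num.min (r i 0) (r' i 0)).
Proof.
apply/seteqP; split=> v /=.
  by move=> [h h'] i; rewrite !mxE gt_max lt_min; have := h i; have := h' i; do 2 move=> /andP[-> ->].
by move=> h; split=> i; have := h i; rewrite !mxE gt_max lt_min => /andP[/andP[? ?] /andP[? ?]]; apply/andP.
Qed.

Lemma open_box l r : open (box l r).
Proof.
have -> : box l r = @box_gauge l r @^-1` [set x | x < 0].
  by apply/seteqP; split => v /box_gaugeE.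
apply: open_comp; last exact: open_lt.
by move=> v _; apply: lip_continuous (box_gauge_lipschitz l r) _.
Qed.

Lemma open_rat_boxes (U : set 'cV[R]_n) v : open U -> U v ->
  exists p q : 'cV[rat]_n, box (map_mx ratr p) (map_mx ratr q) v /\
    box (map_mx ratr p) (map_mx ratr q) `<=` U.
Proof.
move=> oU Uv; have /nbhs_cVP[d d0 dU] : nbhs v U by apply: open_nbhs_nbhs.
have h1 i : exists p : rat, v i 0 - d / 2 < ratr p < v i 0.
  have lt1 : v i 0 - d / 2 < v i 0 by lra.
  by have [p] := rat_in_itvoo lt1; rewrite in_itv /=; exists p.
have h2 i : exists p : rat, v i 0 < ratr p < v i 0 + d / 2.
  have lt1 : v i 0 < v i 0 + d / 2 by lra.
  by have [p] := rat_in_itvoo lt1; rewrite in_itv /=; exists p.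
have [p hp] := choice h1; have [q hq] := choice h2.
exists (\col_i p i), (\col_i q i); split=> [i|w hw].
  by rewrite !mxE; have /andP[_ ->] := hp i; have /andP[-> _] := hq i.
apply: dU; apply: le_lt_trans (_ : d / 2 < d); last by lra.
apply: norm_le_coord => [|i]; first by lra.
have := hw i; rewrite !mxE ler_norml => /andP[a b].
have /andP[a1 b1] := hp i; have /andP[a2 b2] := hq i.
by apply/andP; split; lra.
Qed.

Definition boxes : set (set 'cV[R]_n) := [set box l r | l in setT & r in setT].

End Borel.

(** * Determination of a measure by integrals of convex functions *)

Section MeasureDetermination.
Context {R : realType} {n : nat}.
Implicit Types (x y v : 'cV[R]_n) (phi : 'cV[R]_n -> \bar R) (A : 'M[R]_n).
Local Notation T := (borelRn R n).

(** An open set is the union of the rational boxes contained in it; [unpickle] enumerates them. *)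
Lemma boxes_generate : @measurable _ T = <<s @boxes R n >>.
Proof.
apply/seteqP; split.
  apply: smallest_sub; first exact: smallest_sigma_algebra.
  move=> U oU.
  pose F k := if unpickle k is Some (p, q) then
      let B := box (map_mx ratr p) (map_mx ratr q) : set 'cV[R]_n in
      if `[< B `<=` U >] then B else set0 else set0.
  have -> : U = \bigcup_k F k.
    apply/seteqP; split=> [v Uv|v [k _]].
      have [p [q [pq pqU]]] := open_rat_boxes oU Uv.
      by exists (pickle (p, q)) => //; rewrite /F pickleK /=; case: asboolP.
    by rewrite /F; case: unpickle => [[p q]|//] /=; case: asboolP => // h /h.
  apply: sigma_algebra_bigcup => k; rewrite /F.
  case: unpickle => [[p q]|] /=; last exact: sigma_algebra0.
  case: asboolP => _; last exact: sigma_algebra0.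
  by apply: sub_sigma_algebra; exists (map_mx ratr p) => //; exists (map_mx ratr q).
apply: smallest_sub; first exact: smallest_sigma_algebra.
move=> _ [l _ [r _ <-]]; apply: sub_sigma_algebra; exact: open_box.
Qed.

Lemma continuous_measurable (C : 'cV[R]_n -> R) (D : set T) : continuous C ->
  measurable_fun D (fun v : T => (C v)%:E).
Proof.
move=> cC; apply: (measurable_funS measurableT (@subsetT _ _)).
exact: lsc_measurableRn (continuous_lsc cC).
Qed.

Lemma lipschitz_continuous (K : R) (C : 'cV[R]_n -> R) : lipschitz_fun K C -> continuous C.
Proof. exact: lip_continuous. Qed.

Lemma lipschitz_integrable (mu : {finite_measure set T -> \bar R}) (K : R) C :
  0 <= K -> lipschitz_fun K C -> mu.-integrable (sphere : set T) (fun v : T => (C v)%:E).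
Proof.
move=> K0 lC; have mC := @continuous_measurable C sphere (lipschitz_continuous lC).
apply: (@le_integrable _ _ _ mu sphere sphere_measurable _ (fun=> (`|C 0| + K)%:E)) => //.
  move=> v vs; rewrite lee_fin [leRHS]ger0_norm ?addr_ge0//.
  by apply: lipschitz_bounded => //; apply: sphere_norm.
apply: finite_measure_integrable_cst; exact: sphere_measurable.
Qed.

Lemma box_measure (mu nu : {finite_measure set T -> \bar R}) l r :
  (forall C (K : R), 0 <= K -> convex_fun C -> lipschitz_fun K C ->
    (\int[mu]_(v in sphere) (C v)%:E = \int[nu]_(v in sphere) (C v)%:E)%E) ->
  mu (sphere `&` box l r) = nu (sphere `&` box l r).
Proof.
move=> h.
(* [f k] increases to the indicator of the box and is a difference of convex functions. *)
pose C k v : R := Num.max (-1) (k%:R * box_gauge l r v).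
pose P k v : R := Num.max 0 (C k v).
pose f k v : R := P k v - C k v.
have cst_lip a : lipschitz_fun 0 (fun _ : 'cV[R]_n => a : R).
  by move=> x y; rewrite subrr normr0 mul0r.
have lipW (K K' : R) D : K <= K' -> lipschitz_fun K D -> lipschitz_fun K' D.
  by move=> KK hD x y; apply: le_trans (hD x y) _; rewrite ler_wpM2r.
have Clip k : lipschitz_fun k%:R (C k).
  apply: lipschitz_fun_max; first exact: lipW (cst_lip _).
  move=> x y; rewrite -mulrBr normrM ger0_norm// ler_wpM2l//.
  by apply: le_trans (box_gauge_lipschitz l r x y) _; rewrite mul1r.
have Ccvx k : convex_fun (C k).
  apply: convex_fun_max => [x y t _|x y t t01]; first lra.
  apply: le_trans (ler_wpM2l (ler0n _ _) (box_gauge_convex l r x y t01)) _; lra.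
have Plip k : lipschitz_fun k%:R (P k).
  by apply: lipschitz_fun_max => //; exact: lipW (cst_lip _).
have Pcvx k : convex_fun (P k).
  by apply: convex_fun_max => // x y t _; lra.
have flip k : lipschitz_fun (k%:R + k%:R) (f k).
  move=> x y; have := Plip k x y; have := Clip k x y; rewrite /f !ler_norml.
  by move=> /andP[? ?] /andP[? ?]; apply/andP; split; lra.
have f01 k v : 0 <= f k v <= 1.
  rewrite /f /P; have : -1 <= C k v by rewrite le_max lexx.
  by rewrite /Num.max; case: ltP => ? ?; apply/andP; split; lra.
have int_f (m : {finite_measure set T -> \bar R}) k :
    (\int[m]_(v in sphere) (f k v)%:E = \int[m]_(v in sphere) (P k v)%:E - \int[m]_(v in sphere) (C k v)%:E)%E.
  rewrite -integralB_EFin.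
  - by [].
  - exact: sphere_measurable.
  - exact: lipschitz_integrable (Plip k).
  - exact: lipschitz_integrable (Clip k).
have lim_f (m : {finite_measure set T -> \bar R}) :
    (\int[m]_(v in sphere) (f k v)%:E)%E @[k --> \oo] --> m (sphere `&` box l r).
  have mI : measurable (sphere `&` box l r : set T).
    by apply: measurableI; [exact: sphere_measurable|apply: open_measurableRn; exact: open_box].
  have -> : m (sphere `&` box l r) = (\int[m]_(v in sphere) (\1_(box l r) v)%:E)%E.
    rewrite integral_indic; first by rewrite setIC.
      exact: sphere_measurable.
    by apply: open_measurableRn; exact: open_box.
  have [] := @dominated_convergence _ _ _ m sphere sphere_measurable
    (fun k v => (f k v)%:E) (fun v => (\1_(box l r) v)%:E) (cst 1%:E).
  - by move=> k; apply: continuous_measurable; exact: lipschitz_continuous (flip k).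
  - apply/measurable_EFinP; apply: measurable_indic; apply: open_measurableRn; exact: open_box.
  - apply: aeW => v _; apply: cvg_near_cst.
    have [bv|bv] := pselect (box l r v).
      rewrite indicE mem_set//.
      have g0 := (box_gaugeE l r v).1 bv.
      (* As soon as [k] times the gauge is at most [-1], both truncations are at their floors:
         [C k v = -1] and [P k v = 0]. Outside the box [C k v >= 0], so [P k v = C k v]. *)
      near=> k; rewrite /f /P /C; have : 1 <= k%:R * - box_gauge l r v.
        rewrite -ler_pdivrMr ?oppr_gt0//; near: k; exact: nbhs_infty_ger.
      rewrite mulrN lerNr => h1.
      by rewrite (max_l h1) max_l ?lerN10// sub0r opprK.
    rewrite indicE memNset//.
    have g0 : 0 <= box_gauge l r v by rewrite leNgt; apply/negP => /box_gaugeE.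
    apply: nearW => k; rewrite /f /P /C; have : 0 <= k%:R * box_gauge l r v by rewrite mulr_ge0.
    move=> h1; rewrite [Num.max (-1) _]max_r; last by apply: le_trans h1; exact: lerN10.
    by rewrite (max_r h1) subrr.
  - by apply: finite_measure_integrable_cst; exact: sphere_measurable.
  - by apply: aeW => v k _ /=; rewrite lee_fin; have /andP[f0 f1] := f01 k v; rewrite ger0_norm.
  by move=> _ _; apply.
apply: (cvg_unique (@ereal_hausdorff R) (lim_f mu)).
have -> : (fun k => \int[mu]_(v in sphere) (f k v)%:E)%E = (fun k => \int[nu]_(v in sphere) (f k v)%:E)%E.
  by apply/funext => k; rewrite !int_f !(h _ k%:R).
exact: lim_f.
Unshelve. all: by end_near. Qed.

(** Boxes form a generating family stable under intersection and exhaust the space, so it suffices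
    to compare the two measures on boxes. Used for the invariance under reflections and again for
    the uniqueness of the measure. *)
Lemma finite_measure_eq_convex (mu nu : {finite_measure set T -> \bar R}) :
  on_sphere mu -> on_sphere nu ->
  (forall C (K : R), 0 <= K -> convex_fun C -> lipschitz_fun K C ->
    (\int[mu]_(v in sphere) (C v)%:E = \int[nu]_(v in sphere) (C v)%:E)%E) ->
  forall A : set T, measurable A -> mu A = nu A.
Proof.
move=> smu snu h.
have bs (m : {finite_measure set T -> \bar R}) l r : on_sphere m ->
    m (box l r) = m (sphere `&` box l r).
  move=> sm; have mB : measurable (box l r : set T).
    by apply: open_measurableRn; exact: open_box.
  rewrite (measureDI m mB sphere_measurable) [box l r `&` _]setIC.
  rewrite [X in (X + _)%E](_ : _ = 0%E) ?add0e//; apply/eqP.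
  rewrite -measure_le0 -sm; apply: le_measure; rewrite ?inE.
  - by apply: measurableD => //; exact: sphere_measurable.
  - by apply: measurableC; exact: sphere_measurable.
  - by move=> v [].
apply: (@measure_unique _ R T (@boxes R n) (fun k => box (const_mx (- k%:R)) (const_mx k%:R))).
- exact: boxes_generate.
- move=> _ _ [l _ [r _ <-]] [l' _ [r' _ <-]]; rewrite box_setI.
  by eexists => //; eexists.
- by move=> k; eexists => //; eexists.
- apply/seteqP; split=> // v _; exists (Num.trunc `|v|).+1 => // i; rewrite !mxE -ltr_norml.
  by apply: le_lt_trans (norm_coord v i) _; by have /andP[] := Num.Theory.truncn_itv (normr_ge0 v).
- move=> _ [l _ [r _ <-]]; apply: (etrans (bs mu l r smu)).
  by apply: (etrans (box_measure l r h)); apply: (esym (bs nu l r snu)).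
- by move=> k; rewrite ltey_eq fin_num_measure//; apply: open_measurableRn; exact: open_box.
Qed.

End MeasureDetermination.

(** * Trigonometric bounds and equally spaced sums over a period *)

Section Trigonometry.
Context {R : realType}.

Lemma cos_lip (s t : R) : `|cos s - cos t| <= `|s - t|.
Proof.
wlog st : s t / s <= t => [h|].
  by have [/h//|/ltW/h] := leP s t; rewrite distrC [leRHS]distrC.
have [c _ cE] := @MVT_segment R cos (fun x => - sin x) s t st (fun x _ => is_derive_cos x)
  (continuous_subspaceT (@continuous_cos R)).
rewrite distrC cE normrM normrN [leRHS]distrC ler_piMl//.
exact: sin_max.
Qed.

Lemma sin_lip (s t : R) : `|sin s - sin t| <= `|s - t|.
Proof.
wlog st : s t / s <= t => [h|].
  by have [/h//|/ltW/h] := leP s t; rewrite distrC [leRHS]distrC.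
have [c _ cE] := @MVT_segment R sin cos s t st (fun x _ => is_derive_sin x)
  (continuous_subspaceT (@continuous_sin R)).
rewrite distrC cE normrM [leRHS]distrC ler_piMl//.
exact: cos_max.
Qed.

Lemma polar (c s : R) : exists r phi, [/\ 0 <= r, r ^+ 2 = c ^+ 2 + s ^+ 2, c = r * cos phi & s = r * sin phi].
Proof.
pose r := Num.sqrt (c ^+ 2 + s ^+ 2).
have r2 : r ^+ 2 = c ^+ 2 + s ^+ 2 by rewrite sqr_sqrtr// addr_ge0 ?sqr_ge0.
have r0 : 0 <= r by apply: sqrtr_ge0.
have [rz|rz] := eqVneq r 0.
  exists 0, 0; move: r2; rewrite rz expr0n /= => /esym/eqP.
  by rewrite paddr_eq0 ?sqr_ge0// !sqrf_eq0 => /andP[/eqP-> /eqP->]; rewrite !mul0r expr0n addr0.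
have rp : 0 < r by rewrite lt_def rz.
have u1 : (c / r) ^+ 2 + (s / r) ^+ 2 = 1.
  by rewrite !expr_div_n -mulrDl -r2 divff// sqrf_eq0.
have cr : -1 <= c / r <= 1.
  rewrite -ler_norml -(ler_pXn2r (ltn0Sn 1)) ?nnegrE// real_normK ?num_real// expr1n.
  by rewrite -u1 lerDl sqr_ge0.
have E : Num.sqrt (1 - (c / r) ^+ 2) = `|s / r|.
  by rewrite -u1 addrAC subrr add0r sqrtr_sqr.
have [s0|s0] := leP 0 (s / r).
  exists r, (acos (c / r)); split=> //; first by rewrite acosK ?in_itv// mulrC divfK.
  by rewrite sin_acos// E ger0_norm// mulrC divfK.
exists r, (- acos (c / r)); split=> //; first by rewrite cosN acosK ?in_itv// mulrC divfK.
by rewrite sinN sin_acos// E ltr0_norm// opprK mulrC divfK.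
Qed.

(** The sum is periodic with the step [h = 2 pi / N] as its period, because a shift by [h] permutes
    the nodes modulo [2 pi]. So the two starting points may be taken within [h] of each other, and
    then each of the [N] terms changes by at most [L h]. *)
Lemma periodic_riemann_sum (F : R -> R) (L : R) (N : nat) (a b : R) : (0 < N)%N ->
  (forall s, F (s + pi *+ 2) = F s) -> (forall s t, `|F s - F t| <= L * `|s - t|) ->
  `|\sum_(j < N) F (a + pi *+ 2 / N%:R * j%:R) -
    \sum_(j < N) F (b + pi *+ 2 / N%:R * j%:R)| <= L * (pi *+ 2).
Proof.
move=> N0 per lip; wlog ab : a b / a <= b => [h|].
  by have [/h//|/ltW/h] := leP a b; rewrite distrC.
pose h : R := pi *+ 2 / N%:R; rewrite -/h.
have Np : 0 < N%:R :> R by rewrite ltr0n.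
have pp : 0 < pi *+ 2 :> R by rewrite pmulrn_lgt0// pi_gt0.
have h0 : 0 < h by rewrite divr_gt0.
have hN : h * N%:R = pi *+ 2 by rewrite divfK// gt_eqF.
pose G x := \sum_(j < N) F (x + h * j%:R).
have Gh x : G (x + h) = G x.
  rewrite /G; case: N N0 Np @h h0 hN @G => // N _ Np h h0 hN G.
  rewrite big_ord_recr [RHS]big_ord_recl /= mulr0 addr0 addrC; congr (_ + _).
    by rewrite -[RHS]per -hN -natr1; congr F; ring.
  by apply: eq_bigr => j _; rewrite /bump leq0n add1n -natr1; congr F; ring.
have GhM x m : G (x + h * m%:R) = G x.
  elim: m => [|m IH]; first by rewrite mulr0 addr0.
  by rewrite -natr1 mulrDr mulr1 addrA Gh.
(* The number of steps that bring [a] within [h] of [b]. *)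
pose m := Num.trunc ((b - a) / h).
have /andP[m1 m2] : m%:R <= (b - a) / h < m.+1%:R.
  by apply: Num.Theory.truncn_itv; rewrite divr_ge0 ?(ltW h0)// subr_ge0.
move: m1 m2; rewrite ler_pdivlMr// ltr_pdivrMr// -natr1 mulrDl mul1r => m1 m2.
rewrite -/(G a) -/(G b) -(GhM a m) /G -sumrB.
have L0 : 0 <= L.
  by have := lip 1 0; rewrite subr0 normr1 mulr1 => /(le_trans (normr_ge0 _)).
apply: le_trans (ler_norm_sum _ _ _) _.
apply: le_trans (_ : \sum_(j < N) L * h <= _).
  apply: ler_sum => j _; apply: le_trans (lip _ _) _; rewrite ler_wpM2l//.
  by rewrite ler_norml; apply/andP; split; lra.
by rewrite sumr_const card_ord -mulr_natr -mulrA hN.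
Qed.

End Trigonometry.

Section Image.
Context {R : realType} {n : nat}.
Local Notation T := (borelRn R n).
Variables (mu : {finite_measure set T -> \bar R}) (A : 'M[R]_n).

(** The image of [mu] under [A], packaged as a finite measure so that it can be compared with [mu]
    by [finite_measure_eq_convex]. *)
Definition mulmx_image : set T -> \bar R := pushforward mu (mulmx A : T -> T).

HB.instance Definition _ := Measure.copy mulmx_image
   (measure_function_pushforward__canonical__measure_function_Measure mu (@mulmx_measurable R n A)).

Let mulmx_image_fin : fin_num_fun mulmx_image.
Proof.
move=> B mB; apply: fin_num_measure; rewrite -[X in measurable X]setTI.
exact: mulmx_measurable.
Qed.

HB.instance Definition _ := Measure_isFinite.Build _ T R mulmx_image mulmx_image_fin.

End Image.

(** * Invariance under reflections fixing the pole *)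

Section ReflectionInvariance.
Context {R : realType} {n : nat}.
Implicit Types (x y v w u e : 'cV[R]_n) (A B : 'M[R]_n).
Local Notation T := (borelRn R n).
Variable mu : {finite_measure set T -> \bar R}.

Lemma refl_invol u v : u != 0 -> refl u *m (refl u *m v) = v.
Proof.
move=> /dot_gt0 u0; rewrite !reflE dotBr dotZr divfK ?gt_eqF//.
by rewrite (_ : 2 * (dot u v - 2 * dot u v) = - (2 * dot u v)); [rewrite mulNr; colring|ring].
Qed.

Lemma preservesM A B : preserves mu A -> preserves mu B -> preserves mu (A *m B).
Proof.
move=> hA hB D mD.
have -> : mulmx (A *m B) @^-1` D = mulmx B @^-1` (mulmx A @^-1` D).
  by apply/seteqP; split => v /=; rewrite mulmxA.
rewrite hB ?hA//; rewrite -[_ @^-1` _]setTI; exact: mulmx_measurable.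
Qed.

Lemma lipschitz_mulmx (K : R) (C : 'cV[R]_n -> R) A : 0 <= K -> lipschitz_fun K C ->
  lipschitz_fun (K * (n%:R * `|A|)) (fun v => C (A *m v)).
Proof.
move=> K0 lC x y; apply: le_trans (lC _ _) _; rewrite -mulmxBr -mulrA ler_wpM2l//.
exact: mulmx_norm.
Qed.

Section Circle.
Variables (u u' : 'cV[R]_n).
Hypotheses (uu : dot u u = 1) (uu' : dot u' u' = 1) (u0 : dot u u' = 0).

Let q (t : R) := cos t *: u + sin t *: u'.

Lemma circle_dot t : dot (q t) (q t) = 1.
Proof.
rewrite /q !dotDl !dotDr !dotZl !dotZr (dotC u' u) u0 uu uu'.
by have := cos2Dsin2 t; rewrite !expr2; lra.
Qed.

Lemma circle_refl (t : R) v : refl (q t) *m v = v - dot u v *: u - dot u' v *: u' -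
  (dot u v * cos (t *+ 2) + dot u' v * sin (t *+ 2)) *: u
  - (dot u v * sin (t *+ 2) - dot u' v * cos (t *+ 2)) *: u'.
Proof.
rewrite reflE circle_dot divr1 /q dotDl !dotZl sin_mulr2n cos_mulr2n.
have := cos2Dsin2 t; move: (cos t) (sin t) (dot u v) (dot u' v) => c s a b cs.
have E1 : c ^+ 2 = 1 - s ^+ 2 by lra.
have h1 : 2 * (c * a + s * b) * c = a + (a * (c ^+ 2 *+ 2 - 1) + b * (c * s *+ 2)) by ring.
have h2 : 2 * (c * a + s * b) * s = b + (a * (c * s *+ 2) - b * (c ^+ 2 *+ 2 - 1)).
  by rewrite E1; ring.
rewrite scalerDr !scalerA h1 h2; colring.
Qed.

(** Let [phi] be the angle of [v] in the plane; that of [refl u *m v] is [pi - phi]. Both families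
    then evaluate the same periodic function [F] at steps [2 pi / N], starting at [- phi] and at
    [phi - pi]. The two coordinates and [r <= 1] give [F] the Lipschitz constant [2 K]. *)
Lemma circle_reflection_sum (K : R) (C : 'cV[R]_n -> R) (N : nat) v : 0 <= K ->
  lipschitz_fun K C -> (0 < N)%N -> sphere v ->
  `|\sum_(j < N) (C (refl (q (pi / N%:R * j%:R)) *m (refl u *m v)) -
                  C (refl (q (pi / N%:R * j%:R)) *m v))| <= 4 * K * pi.
Proof.
move=> K0 lC N0 vs.
pose z := v - dot u v *: u - dot u' v *: u'.
have [r [phi [r0 r2 ra rb]]] := polar (dot u v) (dot u' v).
have r1 : r <= 1.
  rewrite -(ler_pXn2r (ltn0Sn 1)) ?nnegrE// expr1n r2 -((sphere_dot v).1 vs).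
  have := dot_ge0 z; rewrite /z !dotBl !dotBr !dotZl !dotZr uu uu' (dotC u' u) u0 (dotC v u) (dotC v u').
  lra.
pose F t := C (z - (r * cos t) *: u - (r * sin t) *: u').
have Fper t : F (t + pi *+ 2) = F t by rewrite /F cosD2pi sinD2pi.
have Flip s t : `|F s - F t| <= (2 * K) * `|s - t|.
  apply: le_trans (lC _ _) _; rewrite -mulrA mulrCA ler_wpM2l//.
  have n1 w : dot w w = 1 -> `|w| <= 1 by move=> /sphere_dot /sphere_norm.
  have -> : z - (r * cos s) *: u - (r * sin s) *: u' - (z - (r * cos t) *: u - (r * sin t) *: u') =
    (r * (cos t - cos s)) *: u + (r * (sin t - sin s)) *: u' by colring.
  apply: le_trans (ler_normD _ _) _; rewrite !normrZ ?normrM (ger0_norm r0).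
  have H (d : R) w : dot w w = 1 -> `|d| <= `|s - t| -> r * `|d| * `|w| <= `|s - t|.
    move=> /n1 w1 dst; rewrite -[leRHS]mulr1; apply: ler_pM => //; first by rewrite mulr_ge0.
    by rewrite -[leRHS]mul1r ler_pM.
  have := H (cos t - cos s) u uu; have := H (sin t - sin s) u' uu'.
  rewrite (distrC (cos t)) (distrC (sin t)) => /(_ (sin_lip _ _)) h1 /(_ (cos_lip _ _)) h2.
  lra.
have E1 j : C (refl (q (pi / N%:R * j)) *m v) = F (- phi + pi *+ 2 / N%:R * j).
  rewrite circle_refl /F -/z; congr C.
  have -> : (pi / N%:R * j) *+ 2 = pi *+ 2 / N%:R * j by rewrite -!mulrnAl.
  by congr (_ - _ - _); congr (_ *: _); rewrite ra rb ?cosD ?sinD ?cosN ?sinN; ring.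
have E2 j : C (refl (q (pi / N%:R * j)) *m (refl u *m v)) = F (phi - pi + pi *+ 2 / N%:R * j).
  rewrite circle_refl /F.
  have -> : (pi / N%:R * j) *+ 2 = pi *+ 2 / N%:R * j by rewrite -!mulrnAl.
  have -> : dot u (refl u *m v) = - dot u v by rewrite reflE uu dotBr dotZr uu divr1; ring.
  have -> : dot u' (refl u *m v) = dot u' v by rewrite reflE uu dotBr dotZr (dotC u' u) u0 divr1; ring.
  have -> : refl u *m v - (- dot u v) *: u - dot u' v *: u' = z.
    by rewrite reflE uu divr1 /z; colring.
  congr C.
  have -> : phi - pi + pi *+ 2 / N%:R * j = pi *+ 2 / N%:R * j + phi - pi by ring.
  by congr (_ - _ - _); congr (_ *: _); rewrite ra rb ?cosB ?sinB ?cospi ?sinpi ?cosD ?sinD; ring.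
rewrite sumrB; under eq_bigr do rewrite E2; under [X in _ - X]eq_bigr do rewrite E1.
apply: le_trans (periodic_riemann_sum _ _ N0 Fper Flip) _.
by rewrite -mulr_natr; lra.
Qed.

End Circle.

Hypotheses (n3 : (3 <= n)%N) (smu : on_sphere mu).
Variable e : 'cV[R]_n.
Hypothesis imu : SO_fixing_invariant e mu.

(* [refl u] has determinant -1, so the hypothesis does not apply to it. But for any
   unit [q_j] orthogonal to [e], [refl q_j *m refl u] is a rotation fixing [e]; hence
   [int C - int C o refl u] is the average over N equally spaced [q_j] of
   [int C o refl q_j o refl u - int C o refl q_j]. Both averages are Riemann sums of
   the same function on the circle through [v], so the difference is O(1/N). *)
Lemma preserves_refl u : dot u u = 1 -> dot u e = 0 -> preserves mu (refl u).
Proof.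
move=> uu ue; have [u' [uu' u'e u'u]] := unit_perp2 e u n3.
have u0 : dot u u' = 0 by rewrite dotC.
pose q (t : R) := cos t *: u + sin t *: u'.
have qq t : q t != 0 by rewrite -dot_eq0 (circle_dot uu uu' u0) oner_eq0.
have qe t : dot (q t) e = 0 by rewrite dotDl !dotZl ue u'e !mulr0 addr0.
have un0 : u != 0 by rewrite -dot_eq0 uu oner_eq0.
have pres p p' : p != 0 -> p' != 0 -> dot p e = 0 -> dot p' e = 0 ->
    preserves mu (refl p *m refl p').
  move=> p0 p'0 pe p'e B mB; apply: imu mB; split; last by rewrite -mulmxA !refl_fix.
  split; first by apply: orthmxM; apply: refl_orthmx.
  by rewrite det_mulmx !refl_det// mulrNN mulr1.
have uperp : orthmx (refl u) by apply: refl_orthmx.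
have preU : mulmx (refl u) @^-1` sphere = sphere.
  by apply/seteqP; split => v /= /(sphere_orthmx v uperp).
move=> B mB.
apply: (@finite_measure_eq_convex _ _ (mulmx_image mu (refl u)) mu _ smu _ B mB).
  by change (mu (mulmx (refl u) @^-1` (~` sphere)) = 0%E); rewrite -preimage_setC preU.
move=> C K K0 _ lC.
have msph := @sphere_measurable R n.
have iC A : mu.-integrable (sphere : set T) (fun v : T => (C (A *m v))%:E).
  by apply: lipschitz_integrable (lipschitz_mulmx A K0 lC); rewrite !mulr_ge0.
have mC A : measurable_fun setT (fun v : T => (C (A *m v))%:E).
  by apply: continuous_measurable; apply: lipschitz_continuous (lipschitz_mulmx A K0 lC).
have iC1 : mu.-integrable (sphere : set T) (fun v : T => (C v)%:E).
  exact: lipschitz_integrable lC.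
have -> : (\int[mulmx_image mu (refl u)]_(v in sphere) (C v)%:E = \int[mu]_(v in sphere) (C (refl u *m v))%:E)%E.
  rewrite (integral_pushforward (mulmx_measurable (refl u)) _ _ msph) ?preU//.
    by apply: continuous_measurable; apply: lipschitz_continuous lC.
  exact: (iC (refl u)).
have [c cE] : exists c, (\int[mu]_(v in sphere) (C v)%:E = c%:E)%E.
  by exists (fine (\int[mu]_(v in sphere) (C v)%:E)%E); rewrite fineK// integrable_fin_num.
have [c' cE'] : exists c, (\int[mu]_(v in sphere) (C (refl u *m v))%:E = c%:E)%E.
  exists (fine (\int[mu]_(v in sphere) (C (refl u *m v))%:E)%E); rewrite fineK//.
  exact: (integrable_fin_num msph (iC (refl u))).
have [m mE] : exists m, mu (sphere : set T) = m%:E.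
  by exists (fine (mu (sphere : set T))); rewrite fineK// fin_num_measure.
(* The right-hand side does not depend on [N], which forces [c = c']. *)
have key N : (0 < N)%N -> N%:R * `|c - c'| <= 4 * K * pi * m.
  move=> N0.
  pose p j := q (pi / N%:R * j%:R).
  pose D v := \sum_(j < N) (C (refl (p j) *m (refl u *m v)) - C (refl (p j) *m v)).
  have I1 j : (\int[mu]_(v in sphere) (C (refl (p j) *m (refl u *m v)))%:E = c%:E)%E.
    rewrite -cE -(@integral_mulmx _ _ mu (refl (p j) *m refl u) (fun v => (C v)%:E)).
    - by apply: eq_integral => v _; rewrite mulmxA.
    - by apply: orthmxM => //; apply/refl_orthmx/qq.
    - by apply: pres => //; [apply: qq|apply: qe].
    - by apply: continuous_measurable; apply: lipschitz_continuous lC.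
  (* [refl (p j)] is [refl u] after [refl u *m refl (p j)], and the latter is a rotation fixing the
     pole. *)
  have I2 j : (\int[mu]_(v in sphere) (C (refl (p j) *m v))%:E = c'%:E)%E.
    rewrite -cE' -(@integral_mulmx _ _ mu (refl u *m refl (p j)) (fun v => (C (refl u *m v))%:E)).
    - by apply: eq_integral => v _; rewrite -mulmxA refl_invol.
    - by apply: orthmxM => //; apply/refl_orthmx/qq.
    - by apply: pres => //; [apply: qq|apply: qe].
    - exact: mC.
  have iD1 j : mu.-integrable (sphere : set T) (fun v : T => (C (refl (p j) *m (refl u *m v)))%:E).
    by apply: eq_integrable (iC (refl (p j) *m refl u)) => // v _; rewrite mulmxA.
  have DE : (fun v : T => (D v)%:E) = (fun v : T => \sum_(j < N) ((C (refl (p j) *m (refl u *m v)))%:E - (C (refl (p j) *m v))%:E))%E.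
    by apply/funext => v; rewrite -sumEFin; apply: eq_bigr => j _; rewrite EFinB.
  have ID : (\int[mu]_(v in sphere) (D v)%:E = (N%:R * (c - c'))%:E)%E.
    rewrite DE.
    rewrite integral_sum//; last by move=> j; apply: integrableB.
    rewrite (eq_bigr (fun=> (c - c')%:E)); last first.
      move=> j _; rewrite integralB_EFin//; [|exact: iD1|exact: iC].
      by apply: (etrans (congr2 (fun a b => a - b)%E (I1 j) (I2 j))); rewrite EFinB.
    by rewrite sumEFin sumr_const card_ord mulr_natl.
  have mD : measurable_fun (sphere : set T) (fun v : T => (D v)%:E).
    rewrite DE; apply: emeasurable_sum => j.
    by apply: emeasurable_funB; apply: measurable_int; [exact: iD1|exact: iC].
  have := le_abse_integral mu msph mD; rewrite ID => h1.
  have := integral_le_bound (4 * K * pi)%:E msph mD _ _.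
  move=> h2.
  have B0 : (0 <= (4 * K * pi)%:E)%E by rewrite lee_fin !mulr_ge0// pi_ge0.
  have h3 : (`|(N%:R * (c - c'))%:E| <= (4 * K * pi)%:E * mu (sphere : set T))%E.
    apply: le_trans h1 (h2 mu B0 _); apply: aeW => v vs; rewrite lee_fin.
    exact: (circle_reflection_sum uu uu' u0 K0 lC N0 vs).
  have : (`|(N%:R * (c - c'))%:E| <= (4 * K * pi)%:E * m%:E)%E by rewrite -mE; exact: h3.
  by rewrite /= -EFinM lee_fin normrM ger0_norm.
rewrite cE cE'; congr (_%:E); apply/eqP; rewrite eq_sym -subr_eq0 -normr_le0 leNgt; apply/negP => cc'.
have := key (Num.trunc (4 * K * pi * m / `|c - c'|)).+1 isT.
apply/negP; rewrite -ltNge -ltr_pdivrMr//.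
have m0 : 0 <= m by rewrite -lee_fin -mE.
by have /andP[] := @Num.Theory.truncn_itv R (4 * K * pi * m / `|c - c'|) ltac:(by rewrite !mulr_ge0 ?invr_ge0// pi_ge0).
Qed.

(** For determinant [-1], write [A] as a reflection fixing the pole after a rotation fixing the
    pole. *)
Lemma preserves_orthmx A : dot e e = 1 -> orthmx A -> A *m e = e -> preserves mu A.
Proof.
move=> ee oA Ae; have [detA|detA] := orthmx_det oA.
  by move=> B mB; apply: imu mB.
have [u [uu ue]] := unit_perp e (ltnW n3).
have un0 : u != 0 by rewrite -dot_eq0 uu oner_eq0.
have -> : A = refl u *m (refl u *m A).
  have sym : (refl u)^T = refl u by rewrite /refl linearB /= linearZ /= trmx_mul trmxK trmx1.
  by rewrite mulmxA -{1}sym (refl_orthmx un0) mul1mx.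
apply: preservesM; first exact: preserves_refl.
move=> B mB; apply: imu mB; split; last by rewrite -mulmxA Ae refl_fix.
split; first by apply: orthmxM => //; apply: refl_orthmx.
by rewrite det_mulmx detA refl_det// mulrNN mulr1.
Qed.

End ReflectionInvariance.

(** * Lower limits and sequential lower semicontinuity *)

Section Liminf.
Context {R : realType}.
Implicit Types (v : nat -> \bar R) (l : \bar R) (c : R).
Local Open Scope ereal_scope.

Lemma limn_einf_ge v l : (forall c, c%:E < l -> \forall k \near \oo, c%:E <= v k) ->
  l <= limn_einf v.
Proof.
move=> h.
have H c : c%:E < l -> c%:E <= limn_einf v.
  move=> /h hc; rewrite [limn_einf v](limf_einfE v); apply: le_ereal_sup_tmp.
  exists (ereal_inf (v @` [set k | c%:E <= v k])); first by exists [set k | c%:E <= v k].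
  by apply: le_ereal_inf_tmp => _ [k ck <-].
rewrite leNgt; apply/negP => lt; case: l h H lt => [r| |] h H; last by rewrite ltNge leNye.
- case E : (limn_einf v) => [s| |] lt.
  + have /H : ((s + r) / 2)%:E < r%:E by move: lt; rewrite !lte_fin; lra.
    by rewrite E lee_fin; move: lt; rewrite lte_fin; lra.
  + by move: lt; rewrite ltNge leey.
  + have /H : (r - 1)%:E < r%:E by rewrite lte_fin; lra.
    by rewrite E.
- case E : (limn_einf v) => [s| |] // lt.
  + by have := H (s + 1)%R (ltry _); rewrite E lee_fin; lra.
  + by have := H 0%R (ltry _); rewrite E.
Qed.

Lemma limn_einf_gt v c : c%:E < limn_einf v -> \forall k \near \oo, c%:E < v k.
Proof.
rewrite [limn_einf v](limf_einfE v) => /ereal_sup_gt[_ [V oV <-] cV].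
apply: filterS oV => k Vk; apply: lt_le_trans cV _.
by apply: ereal_inf_lbound; exists k.
Qed.

Lemma limn_einf_le v c : (forall k, v k <= c%:E) -> limn_einf v <= c%:E.
Proof.
move=> h; rewrite leNgt; apply/negP => /limn_einf_gt lt.
by near \oo => k; have := h k; rewrite leNgt (near lt k).
Unshelve. all: by end_near. Qed.

End Liminf.

Section SequentialLsc.
Context {R : realType} {n : nat}.
Implicit Types (x y v : 'cV[R]_n) (phi : 'cV[R]_n -> \bar R) (u : nat -> 'cV[R]_n).

Lemma cvg_cVP u x : u @ \oo --> x <->
  forall d : R, 0 < d -> \forall k \near \oo, `|u k - x| < d.
Proof.
split=> [ux d d0|h].
  have dx : nbhs x [set y | `|y - x| < d] by apply/nbhs_cVP; exists d.
  exact: (ux _ dx).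
by move=> V /nbhs_cVP[d d0 dV]; apply: filterS (h d d0) => k; exact: dV.
Qed.

Lemma lsc_seq phi u x : lower_semicontinuous phi -> u @ \oo --> x ->
  (phi x <= limn_einf (phi \o u))%E.
Proof.
move=> lphi ux; apply: limn_einf_ge => c /lphi[V xV hV].
have uV : \forall k \near \oo, V (u k) := ux V xV.
by apply: filterS uV => k /= /hV/ltW.
Qed.

(** Fatou's lemma concerns sequences, so semicontinuity of the transform is obtained in sequential
    form. *)
Lemma seq_lsc phi : (forall x u, u @ \oo --> x -> (phi x <= limn_einf (phi \o u))%E) ->
  lower_semicontinuous phi.
Proof.
move=> h x c cx; apply: contrapT => hV.
have /choice[u hu] : forall k : nat, exists y, `|y - x| < k.+1%:R^-1 /\ (phi y <= c%:E)%E.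
  move=> k; apply: contrapT => hk; apply: hV.
  exists [set y | `|y - x| < k.+1%:R^-1].
    by apply/nbhs_cVP; exists k.+1%:R^-1 => //; rewrite invr_gt0.
  by move=> y /= yx; rewrite ltNge; apply/negP => yc; apply: hk; exists y.
have ux : u @ \oo --> x.
  apply/cvg_cVP => d d0; near=> k; apply: lt_trans (hu k).1 _.
  by near: k; exact: near_infty_natSinv_lt (PosNum d0).
have := h x u ux; apply/negP; rewrite -ltNge; apply: le_lt_trans cx.
by apply: limn_einf_le => k /=; have [] := hu k.
Unshelve. all: by end_near. Qed.

End SequentialLsc.

(** * Integrals of lower semicontinuous functions over the sphere *)

Section GoodIntegrands.
Context {R : realType} {n : nat}.
Implicit Types (x y v : 'cV[R]_n) (phi psi : 'cV[R]_n -> \bar R).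
Local Notation T := (borelRn R n).
Variable mu : {finite_measure set T -> \bar R}.

(** The class of integrands: semicontinuity gives measurability and, the sphere being bounded, a
    lower bound on it; integrals then avoid [-oo] and are additive. *)
Definition lsc_proper phi := lower_semicontinuous phi /\ forall x, phi x != -oo%E.

Lemma lsc_proper_comp phi (g : 'cV[R]_n -> 'cV[R]_n) : lsc_proper phi -> continuous g ->
  lsc_proper (phi \o g).
Proof.
move=> [l N] cg; split; first exact: continuous_comp_lsc.
by move=> x; apply: N.
Qed.

Lemma lsc_proper_measurable phi (D : set T) : lsc_proper phi -> measurable_fun D (phi : T -> \bar R).
Proof.
by move=> [l _]; apply: measurable_funS (lsc_measurableRn l).
Qed.

Lemma lsc_proper_bounded phi : lsc_proper phi ->
  exists b : R, forall v, sphere v -> (b%:E <= phi v)%E.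
Proof.
move=> [l N]; have [b hb] := lsc_bounded_below N l (@cball_compact R n 0 1).
by exists b => v vs; apply: hb; rewrite /cball /= subr0 sphere_norm.
Qed.

Lemma lsc_integral_convex phi psi (t : R) : lsc_proper phi -> lsc_proper psi -> 0 <= t <= 1 ->
  (\int[mu]_(v in sphere) (t%:E * phi v + (1 - t)%:E * psi v) =
   t%:E * \int[mu]_(v in sphere) phi v + (1 - t)%:E * \int[mu]_(v in sphere) psi v)%E.
Proof.
move=> p q /andP[t0 t1]; have t1' : 0 <= 1 - t by lra.
have [b hb] := lsc_proper_bounded p; have [c hc] := lsc_proper_bounded q.
have mp := @lsc_proper_measurable phi sphere p; have mq := @lsc_proper_measurable psi sphere q.
have ms := @sphere_measurable R n.
have H (a r : R) (f : T -> \bar R) : 0 <= a -> (forall v, sphere v -> (r%:E <= f v)%E) ->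
    forall v, sphere v -> ((a * r)%:E <= a%:E * f v)%E.
  by move=> a0 rf v vs; rewrite EFinM; apply: lee_wpmul2l; [rewrite lee_fin|exact: rf].
rewrite (bb_integralD mu ms _ _ (H _ _ _ t0 hb) (H _ _ _ t1' hc));
  [|exact: measurable_funeM|exact: measurable_funeM].
by rewrite (bb_integralZ mu ms mp t0 hb) (bb_integralZ mu ms mq t1' hc).
Qed.

Lemma lsc_integralD phi psi : lsc_proper phi -> lsc_proper psi ->
  (\int[mu]_(v in sphere) (phi v + psi v) =
   \int[mu]_(v in sphere) phi v + \int[mu]_(v in sphere) psi v)%E.
Proof.
move=> p q.
have [b hb] := lsc_proper_bounded p; have [c hc] := lsc_proper_bounded q.
by apply: (bb_integralD mu (@sphere_measurable R n) _ _ hb hc); exact: lsc_proper_measurable.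
Qed.

Lemma lsc_integral_le phi (psi : T -> \bar R) : lsc_proper phi -> measurable_fun (sphere : set T) psi ->
  (forall v, sphere v -> phi v <= psi v)%E ->
  (\int[mu]_(v in sphere) phi v <= \int[mu]_(v in sphere) psi v)%E.
Proof.
move=> p q; have [b hb] := lsc_proper_bounded p.
by apply: (bb_integral_le mu (@sphere_measurable R n) _ q hb); exact: lsc_proper_measurable.
Qed.

Lemma lsc_integralN phi : lsc_proper phi -> (\int[mu]_(v in sphere) phi v != -oo)%E.
Proof.
move=> p; have [b hb] := lsc_proper_bounded p; rewrite -ltNye.
apply: lt_le_trans (bb_integral_ge mu (@sphere_measurable R n) (@lsc_proper_measurable phi sphere p) hb).
rewrite ltNye_eq fin_numM// fin_num_measure//; exact: sphere_measurable.
Qed.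

End GoodIntegrands.

(** * Plane rotations, flips and convergent choices of orthogonal maps *)

Section Frames.
Context {R : realType} {n : nat}.
Implicit Types (x y v w a b e : 'cV[R]_n) (A : 'M[R]_n).

Lemma orthmxN A : orthmx A -> orthmx (- A).
Proof.
move=> oA; rewrite /orthmx (_ : (- A)^T = - A^T) ?mulmxN ?mulNmx ?opprK//.
by apply/matrixP => i j; rewrite !mxE.
Qed.

Definition plane_rot a b (c s : R) : 'M[R]_n :=
  1%:M + (c - 1) *: (a *m a^T + b *m b^T) + s *: (b *m a^T - a *m b^T).

Lemma outer_mul a b w : (a *m b^T) *m w = dot b w *: a.
Proof.
rewrite -mulmxA (_ : b^T *m w = (dot b w)%:M) ?mul_mx_scalar//.
by apply/matrixP => i j; rewrite !ord1 -dot_trmx !mxE eqxx mulr1n.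
Qed.

Lemma plane_rotE a b c s w : plane_rot a b c s *m w =
  w + ((c - 1) * dot a w - s * dot b w) *: a + ((c - 1) * dot b w + s * dot a w) *: b.
Proof.
rewrite /plane_rot !mulmxDl mul1mx -!scalemxAl mulmxDl mulmxBl !outer_mul.
colring.
Qed.

Lemma plane_rot_orthmx a b c s : dot a a = 1 -> dot b b = 1 -> dot a b = 0 ->
  c ^+ 2 + s ^+ 2 = 1 -> orthmx (plane_rot a b c s).
Proof.
move=> aa bb ab cs; apply: orthmx_dotP => w; rewrite plane_rotE.
rewrite !dotDl !dotDr !dotZl !dotZr (dotC b a) (dotC w a) (dotC w b) aa bb ab.
move: (dot a w) (dot b w) (dot w w) => p q m.
have E : s ^+ 2 = 1 - c ^+ 2 by lra.
rewrite [RHS](_ : m = m + (p ^+ 2 + q ^+ 2) * (2 * (c - 1) + (c - 1) ^+ 2 + s ^+ 2)); first by ring.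
by rewrite E; ring.
Qed.

(** For orthonormal [a] and [b], the identity on their plane and [-1] on its orthogonal
    complement. *)
Definition plane_flip a b : 'M[R]_n := - (refl a *m refl b).

Lemma plane_flipE a b w : dot a a = 1 -> dot b b = 1 -> dot a b = 0 ->
  plane_flip a b *m w = (2 * dot a w) *: a + (2 * dot b w) *: b - w.
Proof.
move=> aa bb ab; rewrite mulNmx -mulmxA !reflE aa bb !divr1 dotBr dotZr ab.
by rewrite mulr0 subr0; colring.
Qed.

Lemma plane_flip_orthmx a b : dot a a = 1 -> dot b b = 1 -> orthmx (plane_flip a b).
Proof.
move=> aa bb; have n0 (w : 'cV[R]_n) : dot w w = 1 -> w != 0.
  by move=> ww; rewrite -dot_eq0 ww oner_eq0.
by apply: orthmxN; apply: orthmxM; apply: refl_orthmx; apply: n0.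
Qed.

(** Stated without division so that [x = 0] is included; there every orthogonal map qualifies. *)
Lemma exists_orthmx e x : (2 <= n)%N -> dot e e = 1 ->
  exists2 A, orthmx A & enorm x *: (A *m e) = x.
Proof.
move=> n2 /sphere_dot se; have [->|x0] := eqVneq x 0.
  by exists 1%:M; [exact: orthmx1|rewrite enorm0 scale0r].
have [[oA _] Ae] := rot_toP n2 se x0.
by exists (Defs.rot_to e x) => //; rewrite Ae scalerA mulfV ?enorm_eq0// scale1r.
Qed.

(* Near [x != 0] the rotations can be chosen continuously, as [- refl (a + b)] maps [a] to [b]. *)
Lemma rotation_sequence e x (u : nat -> 'cV[R]_n) : (2 <= n)%N -> dot e e = 1 ->
  u @ \oo --> x -> exists (A_ : nat -> 'M[R]_n) (A : 'M[R]_n),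
  [/\ forall k, orthmx (A_ k), forall k, enorm (u k) *: (A_ k *m e) = u k,
      orthmx A, enorm x *: (A *m e) = x &
      forall v, (fun k => enorm (u k) *: (A_ k *m v)) @ \oo --> enorm x *: (A *m v)].
Proof.
move=> n2 ee ux; have [B_ oB Be] : exists2 B_ : nat -> 'M[R]_n, forall k, orthmx (B_ k) &
    forall k, enorm (u k) *: (B_ k *m e) = u k.
  have /choice[B_ hB] : forall k, exists A, orthmx A /\ enorm (u k) *: (A *m e) = u k.
    by move=> k; have [A oA Ae] := exists_orthmx (u k) n2 ee; exists A.
  by exists B_ => k; have [] := hB k.
have eu : (enorm \o u) @ \oo --> enorm x.
  by apply: continuous_cvg ux; exact: enorm_continuous.
have [x0|x0] := eqVneq x 0.
  exists B_, 1%:M; split=> //; [exact: orthmx1|by rewrite x0 enorm0 scale0r|].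
  move=> v; rewrite x0 enorm0 scale0r; apply/cvg_cVP => d d0.
  have C0 : 0 < 1 + enorm v by rewrite ltr_pwDl// enorm_ge0.
  near=> k; rewrite subr0; apply: le_lt_trans (norm_enorm _) _.
  rewrite enormZ enorm_orthmx// ger0_norm ?enorm_ge0//.
  have : enorm (u k) < d / (1 + enorm v).
    near: k; apply: cvgr_lt eu _ _; rewrite x0 enorm0 divr_gt0//.
  rewrite ltr_pdivlMr// => /le_lt_trans; apply.
  by rewrite ler_wpM2l ?enorm_ge0// lerDr.
pose a := (enorm x)^-1 *: x.
have aa : dot a a = 1 by apply: normalize_dot.
have [Th oTh The] := exists_orthmx x n2 ee.
have The' : Th *m e = a by rewrite /a -{2}The scalerA mulVf ?enorm_eq0// scale1r.
pose b k := (enorm (u k))^-1 *: u k.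
(* The formula can fail only where [u k = 0] or [b k = - a], hence for finitely many [k]; [B_] fills
   these in. *)
pose good k := (u k != 0) && (a + b k != 0).
pose A_ k := if good k then - refl (a + b k) *m Th else B_ k.
have bu k : u k != 0 -> dot (b k) (b k) = 1 by apply: normalize_dot.
have cb : b @ \oo --> a.
  by apply: cvgZ => //; apply: cvgV => //; rewrite enorm_eq0.
have cab : (fun k => a + b k) @ \oo --> a + a by apply: cvgD => //; exact: cvg_cst.
have a20 : dot (a + a) (a + a) = 4 by rewrite !dotDl !dotDr aa; ring.
have dcv w : (fun k => dot (a + b k) w) @ \oo --> dot (a + a) w.
  exact: (cvg_comp _ (dot^~ w) cab (@dot_continuous R n w (a + a))).
have dd : (fun k => dot (a + b k) (a + b k)) @ \oo --> dot (a + a) (a + a).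
  rewrite -sqr_enorm; under eq_fun do rewrite -sqr_enorm.
  rewrite !expr2; apply: cvgM; apply: continuous_cvg cab; exact: enorm_continuous.
have gk : \forall k \near \oo, good k.
  near=> k; apply/andP; split.
    rewrite -enorm_eq0 gt_eqF//; near: k; apply: cvgr_gt eu _ _.
    by rewrite lt_def enorm_eq0 x0 enorm_ge0.
  rewrite -dot_eq0 gt_eqF//; near: k; apply: cvgr_gt dd _ _.
  by rewrite a20.
have an0 : a != 0 by rewrite -dot_eq0 aa oner_eq0.
(* [Th] takes [e] to [a] and [- refl (a + b k)] takes [a] to [b k]. In the limit [refl (a + a)] is
   [refl a], a reflection being insensitive to scaling. *)
exists A_, (- refl a *m Th); split.
- move=> k; rewrite /A_; case: ifP => // /andP[u0 ab0].
  by apply: orthmxM => //; apply: orthmxN; apply: refl_orthmx.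
- move=> k; rewrite /A_; case: ifP => // /andP[u0 ab0].
  rewrite -mulmxA The' mulNmx reflE.
  have -> : 2 * dot (a + b k) a / dot (a + b k) (a + b k) = 1.
    have E : 2 * dot (a + b k) a = dot (a + b k) (a + b k).
      by rewrite !dotDl !dotDr aa bu// (dotC (b k) a); ring.
    by rewrite E divff// dot_eq0.
  rewrite scale1r opprB addrAC subrr add0r scalerA mulfV ?scale1r// ?enorm_eq0//.
- by apply: orthmxM => //; apply: orthmxN; apply: refl_orthmx.
- rewrite -mulmxA The' mulNmx reflE aa mulr1 divr1 (_ : - (a - 2 *: a) = a); last by colring.
  by rewrite /a scalerA mulfV ?enorm_eq0// scale1r.
- move=> v; pose w := Th *m v.
  have E : (fun k => enorm (u k) *: - (w - (2 * dot (a + b k) w / dot (a + b k) (a + b k)) *: (a + b k))) @ \oo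
      --> enorm x *: - (w - (2 * dot (a + a) w / dot (a + a) (a + a)) *: (a + a)).
    apply: cvgZ => //; apply: cvgN; apply: cvgB; first exact: cvg_cst.
    apply: cvgZ => //; apply: cvgM; last by apply: cvgV => //; rewrite a20.
    by apply: cvgM => //; exact: cvg_cst.
  rewrite (_ : enorm x *: (- refl a *m Th *m v) = enorm x *: - (w - (2 * dot (a + a) w / dot (a + a) (a + a)) *: (a + a))); last first.
    rewrite -mulmxA mulNmx reflE aa a20 divr1; congr (_ *: - (_ - _)).
    rewrite dotDl -/w (_ : 2 * (dot a w + dot a w) / 4 = dot a w); last by lra.
    by colring.
  apply: cvg_trans E; apply: near_eq_cvg; near=> k.
  rewrite /A_ ifT; first by rewrite -mulmxA mulNmx reflE.
  by near: k.
Unshelve. all: by end_near. Qed.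

End Frames.

(** * The transform of a convex function by a measure *)

Section Transform.
Context {R : realType} {n : nat}.
Implicit Types (x y v w a b : 'cV[R]_n) (A : 'M[R]_n) (phi : 'cV[R]_n -> \bar R).
Local Notation T := (borelRn R n).
Variables (e : 'cV[R]_n) (mu : {finite_measure set T -> \bar R}).
Hypotheses (n2 : (2 <= n)%N) (ee : dot e e = 1).
Hypothesis inv : forall A, orthmx A -> A *m e = e -> preserves mu A.

Local Notation H := (sphere_conv_ne0 e mu).

Lemma scale_mulmx_continuous (c : R) A : continuous (fun v : 'cV[R]_n => c *: (A *m v)).
Proof.
apply: (@lip_continuous _ _ _ _ (`|c| * (n%:R * `|A|))) => x y.
by rewrite -scalerBr -mulmxBr normrZ -mulrA ler_wpM2l// mulmx_norm.
Qed.

Lemma lsc_proper_scale phi (c : R) A : lsc_proper phi ->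
  lsc_proper (fun v : 'cV[R]_n => phi (c *: (A *m v))).
Proof. by move=> p; apply: (lsc_proper_comp p (@scale_mulmx_continuous c A)). Qed.

(** If [B] is the chosen rotation, [B^T *m A] fixes [e] and preserves [mu]. At the origin both
    integrands are constant. *)
Lemma transformE phi x A : lsc_proper phi -> orthmx A -> enorm x *: (A *m e) = x ->
  H phi x = (\int[mu]_(v in sphere) phi (enorm x *: (A *m v)))%E.
Proof.
move=> p oA Ae; rewrite /H; have [->|x0] := eqVneq x 0.
  by apply: eq_integral => v _; rewrite enorm0 !scale0r.
have [[oB _] Be] := rot_toP n2 ((sphere_dot e).2 ee) x0.
set B := Defs.rot_to e x in oB Be *.
have Ae' : A *m e = (enorm x)^-1 *: x.
  by rewrite -{2}Ae scalerA mulVf ?enorm_eq0// scale1r.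
rewrite -(@integral_mulmx _ _ mu (B^T *m A) (fun v => phi (enorm x *: (B *m v)))).
- by apply: eq_integral => v _; rewrite !mulmxA orthmxV// mul1mx.
- by apply: orthmxM => //; apply: orthmx_tr.
- apply: inv; first by apply: orthmxM => //; apply: orthmx_tr.
  by rewrite -mulmxA Ae' -Be mulmxA oB mul1mx.
- exact: lsc_proper_measurable (lsc_proper_scale _ _ p).
Qed.

Lemma transform_neNy phi x : lsc_proper phi -> H phi x != -oo%E.
Proof. by move=> p; apply: lsc_integralN; apply: lsc_proper_scale. Qed.

(* In the plane of [x] and [y], [x] acts on [w = A v] through
   [L x w + |x| w_perp], where [L] is linear in [x]; averaging with the flip
   [w_perp -> - w_perp] makes the integral a nondecreasing function of [|x|]. *)
Lemma transform_convex phi : Cvx phi -> convexe (H phi).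
Proof.
move=> [phiN c l _] x y t t01; have p : lsc_proper phi by [].
have [a [b [aa bb ab [[al [be xE]] [ga [de yE]]]]]] := plane_frame x y n2.
have [Th oTh The] := exists_orthmx a n2 ee.
have ea : enorm a = 1 by apply/sphere_dot.
rewrite ea scale1r in The.
(* [La w] is the component of [w] in the plane and [Lb w] its quarter turn. [pt al be r] acts on the
   plane as the scaled rotation taking [a] to [al a + be b] and multiplies the orthogonal component
   by [r]; what matters is that it is linear in [(al, be, r)]. *)
pose La w := dot a w *: a + dot b w *: b.
pose Lb w := dot a w *: b - dot b w *: a.
pose pt (al be r : R) w := al *: La w + be *: Lb w + r *: (w - La w).
have flipE w : plane_flip a b *m w = La w + La w - w.
  by rewrite plane_flipE// /La; colring.
have dflip w : dot a (plane_flip a b *m w) = dot a w /\ dot b (plane_flip a b *m w) = dot b w.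
  rewrite plane_flipE// !dotBr !dotDr !dotZr aa bb (dotC b a) ab; split; ring.
have fa : plane_flip a b *m a = a by rewrite plane_flipE// aa (dotC b a) ab; colring.
have rep (p0 q0 : R) : exists A, [/\ orthmx A, enorm (p0 *: a + q0 *: b) *: (A *m a) = p0 *: a + q0 *: b &
    forall w, enorm (p0 *: a + q0 *: b) *: (A *m w) = pt p0 q0 (enorm (p0 *: a + q0 *: b)) w].
  pose z := p0 *: a + q0 *: b.
  have ez : enorm z ^+ 2 = p0 ^+ 2 + q0 ^+ 2.
    by rewrite sqr_enorm /z !dotDl !dotDr !dotZl !dotZr (dotC b a) aa bb ab; ring.
  have [r0|r0] := eqVneq (enorm z) 0.
    exists 1%:M; rewrite -/z r0; split; first exact: orthmx1.
      by rewrite scale0r; apply/esym/eqP; rewrite -enorm_eq0 r0.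
    move=> w; move/eqP: ez; rewrite r0 expr0n /= eq_sym paddr_eq0 ?sqr_ge0// !sqrf_eq0.
    by move=> /andP[/eqP -> /eqP ->]; rewrite /pt !scale0r !addr0.
  exists (plane_rot a b (p0 / enorm z) (q0 / enorm z)); rewrite -/z; split.
  - apply: plane_rot_orthmx => //.
    by rewrite !expr_div_n -mulrDl -ez divff// sqrf_eq0.
  - rewrite plane_rotE aa (dotC b a) ab /z -/z; apply/colP => i; rewrite !mxE; field.
    by [].
  - move=> w; rewrite plane_rotE /pt /La /Lb; apply/colP => i; rewrite !mxE; field.
    by [].
(* Composing with the flip changes the sign of the orthogonal component without changing the
   integral. *)
have HE al' be' z : z = al' *: a + be' *: b -> 
    H phi z = (\int[mu]_(v in sphere) phi (pt al' be' (enorm z) (Th *m v)))%E /\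
    H phi z = (\int[mu]_(v in sphere) phi (pt al' be' (- enorm z)%R (Th *m v)))%E.
  move=> zE; have [A [oA Aa Aw]] := rep al' be'; rewrite -zE in Aa Aw; split.
    rewrite (@transformE phi z (A *m Th)) //; [|exact: orthmxM|by rewrite -mulmxA The].
    by apply: eq_integral => v _; rewrite -mulmxA Aw.
  rewrite (@transformE phi z (A *m (plane_flip a b *m Th))) //.
  - apply: eq_integral => v _; rewrite -!mulmxA Aw; congr phi.
    have [d1 d2] := dflip (Th *m v); rewrite /pt /La /Lb d1 d2 plane_flipE// ; colring.
  - by apply: orthmxM => //; apply: orthmxM => //; apply: plane_flip_orthmx.
  - by rewrite -!mulmxA The fa.
have ptgood al' be' r : lsc_proper (fun v => phi (pt al' be' r (Th *m v))).
  apply: (lsc_proper_comp p).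
  pose M : 'M[R]_n := (al' *: (a *m a^T + b *m b^T) + be' *: (b *m a^T - a *m b^T) +
       r *: (1%:M - (a *m a^T + b *m b^T))) *m Th.
  have -> : (fun v => pt al' be' r (Th *m v)) = mulmx M.
    apply/funext => v; rewrite /M /pt /La /Lb -mulmxA.
    by rewrite !mulmxDl -!scalemxAl mulmxBl mulmxDl !mulmxBl mul1mx mulmxDl !outer_mul.
  exact: mulmx_continuous.
pose z := t *: x + (1 - t) *: y.
pose al' := t * al + (1 - t) * ga; pose be' := t * be + (1 - t) * de.
have zE : z = al' *: a + be' *: b by rewrite /z xE yE /al' /be'; colring.
have [Hz _] := HE _ _ _ zE; have [Hx1 Hx2] := HE _ _ _ xE; have [Hy1 Hy2] := HE _ _ _ yE.
case/andP: (t01) => t0 t1; have t1' : 0 <= 1 - t by lra.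
pose r := t * enorm x + (1 - t) * enorm y.
have zr : enorm z <= r.
  apply: le_trans (enormD _ _) _; rewrite !enormZ !ger0_norm//.
(* By the triangle inequality [enorm z] lies between [- r] and [r]. Convexity bounds the integrand
   at [enorm z] by those at [r] and [- r], and both of these have the desired bound. *)
have [s s01 sE] : exists2 s : R, 0 <= s <= 1 & enorm z = s * r + (1 - s) * - r.
  have z0 := enorm_ge0 z; have r0 := le_trans z0 zr.
  have [rz|rz] := eqVneq r 0.
    by exists 0; [rewrite lexx ler01|move: zr; rewrite rz => zr; apply/eqP; rewrite !mulr0 oppr0 mulr0 addr0 eq_le zr z0].
  have rp : 0 < r by rewrite lt_def rz.
  exists ((1 + enorm z / r) / 2); last by field.
  have : 0 <= enorm z / r <= 1 by rewrite divr_ge0//= ler_pdivrMr// mul1r.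
  by move=> /andP[? ?]; apply/andP; split; lra.
pose G (sg : R) v := (t%:E * phi (pt al be (sg * enorm x)%R (Th *m v)) +
   (1 - t)%:E * phi (pt ga de (sg * enorm y)%R (Th *m v)))%E.
have IG (sg : R) : sg = 1 \/ sg = -1 ->
    (\int[mu]_(v in sphere) G sg v = t%:E * H phi x + (1 - t)%:E * H phi y)%E.
  rewrite /G lsc_integral_convex// => -[->|->].
    by rewrite !mul1r -Hx1 -Hy1.
  by rewrite !mulN1r -Hx2 -Hy2.
have mG sg : measurable_fun (sphere : set T) (G sg).
  by apply: emeasurable_funD; apply: measurable_funeM; exact: lsc_proper_measurable.
rewrite -/z Hz.
have Ph sg : lsc_proper (fun v => phi (pt al' be' (sg * r)%R (Th *m v))) by apply: ptgood.
have leP (sg : R) : sg = 1 \/ sg = -1 ->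
   (\int[mu]_(v in sphere) phi (pt al' be' (sg * r)%R (Th *m v)) <= t%:E * H phi x + (1 - t)%:E * H phi y)%E.
  move=> sg1; rewrite -(IG sg sg1); apply: lsc_integral_le => // v _.
  have -> : pt al' be' (sg * r)%R (Th *m v) = t *: pt al be (sg * enorm x)%R (Th *m v) +
     (1 - t) *: pt ga de (sg * enorm y)%R (Th *m v).
    by rewrite /pt /r /al' /be'; colring.
  exact: c.
apply: (@le_trans _ _ (\int[mu]_(v in sphere) (s%:E * phi (pt al' be' (1 * r)%R (Th *m v)) +
   (1 - s)%:E * phi (pt al' be' (-1 * r)%R (Th *m v))))%E).
  apply: lsc_integral_le => //.
    by apply: emeasurable_funD; apply: measurable_funeM; exact: lsc_proper_measurable.
  move=> v _.
  have -> : pt al' be' (enorm z) (Th *m v) = s *: pt al' be' (1 * r)%R (Th *m v) +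
     (1 - s) *: pt al' be' (-1 * r)%R (Th *m v).
    by rewrite sE /pt; colring.
  exact: c.
rewrite lsc_integral_convex//; case/andP: s01 => s0 s1.
have s1' : 0 <= 1 - s by lra.
set h := (t%:E * _ + _)%E in leP *.
apply: (@le_trans _ _ (s%:E * h + (1 - s)%:E * h)%E).
  by apply: leeD; apply: lee_wpmul2l => //; apply: leP; [left|right].
by rewrite -ge0_muleDl ?lee_fin// -EFinD addrC subrK mul1e.
Qed.

End Transform.

Lemma limn_einf_near_le {R : realType} (u v : nat -> \bar R) :
  (\forall k \near \oo, u k <= v k)%E -> (limn_einf u <= limn_einf v)%E.
Proof.
move=> uv; apply: limn_einf_ge => c /limn_einf_gt cu; near=> k.
apply: (@le_trans _ _ (u k)); first by apply: ltW; near: k.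
by near: k.
Unshelve. all: by end_near. Qed.

(** * Semicontinuity, finiteness and the value at the origin of the transform *)

Section Transform2.
Context {R : realType} {n : nat}.
Implicit Types (x y z v w : 'cV[R]_n) (A : 'M[R]_n) (phi : 'cV[R]_n -> \bar R).
Local Notation T := (borelRn R n).
Variables (e : 'cV[R]_n) (mu : {finite_measure set T -> \bar R}).
Hypotheses (n2 : (2 <= n)%N) (ee : dot e e = 1).
Hypothesis inv : forall A, orthmx A -> A *m e = e -> preserves mu A.

Local Notation H := (sphere_conv_ne0 e mu).

Lemma norm_scale_orthmx (c : R) A v : 0 <= c -> orthmx A -> sphere v ->
  `|c *: (A *m v)| <= c.
Proof.
move=> c0 oA vs; apply: le_trans (norm_enorm _) _.
by rewrite enormZ enorm_orthmx// vs mulr1 ger0_norm.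
Qed.

(** With the convergent maps of [rotation_sequence], the arguments of the integrands converge for
    each fixed [v], so Fatou's lemma applies; the locally uniform lower bound supplies its common
    minorant. *)
Lemma transform_liminf (phi_ : nat -> 'cV[R]_n -> \bar R) phi x (u : nat -> 'cV[R]_n) :
  (forall k, lsc_proper (phi_ k)) -> lsc_proper phi ->
  (forall r : R, exists b : R, \forall k \near \oo, forall z, `|z| <= r -> (b%:E <= phi_ k z)%E) ->
  (forall z (w : nat -> 'cV[R]_n), w @ \oo --> z -> (phi z <= limn_einf (fun k => phi_ k (w k)))%E) ->
  u @ \oo --> x ->
  (H phi x <= limn_einf (fun k => H (phi_ k) (u k)))%E.
Proof.
move=> p_ p bd ll ux.
have [A_ [A [oA_ Ae_ oA Ae cA]]] := rotation_sequence n2 ee ux.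
have eu : (enorm \o u) @ \oo --> enorm x.
  by apply: continuous_cvg ux; exact: enorm_continuous.
have [b hb] := bd (enorm x + 1).
have [c hc] := lsc_proper_bounded (lsc_proper_scale (enorm x) A p).
have [N _ hN] : \forall k \near \oo, forall v, sphere v -> (b%:E <= phi_ k (enorm (u k) *: (A_ k *m v)))%E.
  near=> k => v vs.
  have uk : enorm (u k) < enorm x + 1 by near: k; apply: cvgr_lt eu _ _; rewrite ltrDl.
  move: (enorm (u k) *: (A_ k *m v)) (norm_scale_orthmx (enorm_ge0 (u k)) (oA_ k) vs) => z zk.
  have {}zk : `|z| <= enorm x + 1 by apply: le_trans zk (ltW uk).
  move: z zk; near: k; exact: hb.
(* The first [N] integrands are replaced by the limit one, so that the lower bound holds for every
   [k]. *)
pose g k v := if (N <= k)%N then phi_ k (enorm (u k) *: (A_ k *m v)) else phi (enorm x *: (A *m v)).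
have gp k : lsc_proper (g k).
  by rewrite /g; case: (N <= k)%N; apply: lsc_proper_scale.
rewrite (@transformE _ _ e mu n2 ee inv phi x A)//.
apply: le_trans (@limn_einf_near_le _ (fun k => \int[mu]_(v in sphere) g k v)%E _ _); last first.
  near=> k; rewrite (@transformE _ _ e mu n2 ee inv (phi_ k) (u k) (A_ k))//.
  have Nk : (N <= k)%N by near: k; exists N.
  by rewrite /g Nk.
apply: (@bb_fatou _ _ _ mu sphere (@sphere_measurable R n) g _ (Num.min b c)).
- by move=> k; apply: lsc_proper_measurable.
- by apply: lsc_proper_measurable; apply: lsc_proper_scale.
- move=> k v vs; rewrite /g; case: ifP => [Nk|_].
    by apply: le_trans (hN k Nk v vs); rewrite lee_fin ge_min lexx.
  by apply: le_trans (hc v vs); rewrite lee_fin ge_min lexx orbT.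
- by move=> v vs; apply: le_trans (hc v vs); rewrite lee_fin ge_min lexx orbT.
- move=> v vs; apply: le_trans (ll _ _ (cA v)) _; apply: limn_einf_near_le.
  by near=> k; rewrite /g ifT//; near: k; exists N.
Unshelve. all: by end_near. Qed.

Lemma transform_lsc phi : lsc_proper phi -> lower_semicontinuous (H phi).
Proof.
move=> p; apply: seq_lsc => x u ux; apply: (transform_liminf (phi_ := fun=> phi)) => //.
  move=> r; have [b hb] := lsc_bounded_below p.2 p.1 (@cball_compact R n 0 r).
  by exists b; near=> k => z zr; apply: hb; rewrite /cball /= subr0.
by move=> z w wz; apply: lsc_seq wz; case: p.
Unshelve. all: by end_near. Qed.

Lemma Cvx_lsc_proper phi : Cvx phi -> lsc_proper phi.
Proof. by move=> [N _ l _]. Qed.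

Lemma transform_bounded0 phi : lsc_proper phi -> bounded0 phi -> bounded0 (H phi).
Proof.
move=> p [rho rho0 [M hM]].
have n0 : 0 < 1 + n%:R :> R by rewrite ltr_pwDl.
have msph := @sphere_measurable R n.
exists (rho / (1 + n%:R)); first by rewrite divr_gt0.
exists (fine (M%:E * mu (sphere : set T))%E) => x xr.
rewrite fineK; last by rewrite fin_numM// fin_num_measure.
have [A oA Ae] := exists_orthmx x n2 ee.
rewrite (@transformE _ _ e mu n2 ee inv phi x A)// -integral_cst//.
apply: lsc_integral_le => //; first exact: lsc_proper_scale.
move=> v vs; apply: hM; apply: le_trans (norm_scale_orthmx (enorm_ge0 x) oA vs) _.
apply: le_trans (enorm_norm x) _.
move: xr; rewrite ler_pdivlMr// mulrDr mulr1; have := normr_ge0 x; lra.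
Qed.

Lemma bounded0_at0 phi : (forall x, phi x != -oo%E) -> bounded0 phi -> exists a, phi (0 : 'cV[R]_n) = a%:E.
Proof.
move=> N [rho rho0 [M hM]]; have := hM 0; rewrite normr0 (ltW rho0) => /(_ isT).
by have := N 0; case: (phi 0) => [a| |] // _ _; exists a.
Qed.

Lemma transform_Cvx phi : Cvx phi -> bounded0 phi -> Cvx (H phi).
Proof.
move=> c b; have p := Cvx_lsc_proper c; split.
- by move=> x; apply: transform_neNy.
- exact: transform_convex.
- exact: transform_lsc.
- have [|a Ha] := @bounded0_at0 (H phi) _ (transform_bounded0 p b).
    by move=> x; apply: transform_neNy.
  by exists 0; rewrite Ha.
Qed.

(** [H phi] is convex, lower semicontinuous and finite at the origin. Convexity on a segment issuing
    from the origin bounds the punctured lower limit above by the value there, semicontinuity bounds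
    it below. *)
Lemma sphere_convE phi : Cvx phi -> bounded0 phi -> sphere_conv e mu phi = H phi.
Proof.
move=> c b; apply/funext => x; rewrite /sphere_conv; case: eqP => // ->.
have p := Cvx_lsc_proper c.
have HN y : H phi y != -oo%E by apply: transform_neNy.
have [a Ha] := bounded0_at0 HN (transform_bounded0 p b).
rewrite limf_einfE Ha; apply/eqP; rewrite eq_le; apply/andP; split.
  apply: ge_ereal_sup => _ [V V0 <-]; apply/lee_addgt0Pr => d d0.
  have [rho rho0 [M hM]] := transform_bounded0 p b.
  have {V0} : nbhs (0 : 'cV[R]_n) [set z | z != 0 -> V z] by exact: V0.
  move=> /nbhs_cVP[r r0 rV].
  have e0 : e != 0 by rewrite -dot_eq0 ee oner_eq0.
  have ne : `|e| <= 1 by apply: sphere_norm; apply/sphere_dot.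
  (* The three bounds give [s <= 1], an increase [s (M - a) <= d] along the segment, and a point
     within [r] of the origin. *)
  pose s : R := Num.min (1 / 2) (Num.min (d / (1 + `|M - a|)) (r / (1 + rho))).
  have M1 : 0 < 1 + `|M - a| by rewrite ltr_pwDl.
  have R1 : 0 < 1 + rho by rewrite ltr_pwDl// ltW.
  have s0 : 0 < s by rewrite !lt_min !divr_gt0.
  have s1 : s <= 1 / 2 by rewrite ge_min lexx.
  have s2 : s <= d / (1 + `|M - a|) by rewrite !ge_min lexx !orbT.
  have s3 : s <= r / (1 + rho) by rewrite !ge_min lexx !orbT.
  have rhoe : `|rho *: e| <= rho by rewrite normrZ gtr0_norm// ler_piMr// ltW.
  have Vz : V (s *: (rho *: e)).
    apply: rV; last by rewrite !scaler_eq0 !negb_or !gt_eqF.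
    rewrite subr0 normrZ gtr0_norm//; move: s3; rewrite ler_pdivlMr//.
    have : s * `|rho *: e| <= s * rho by rewrite ler_wpM2l// ltW.
    lra.
  apply: (@le_trans _ _ (H phi (s *: (rho *: e)))).
    by apply: ereal_inf_lbound; exists (s *: (rho *: e)).
  have := (convexeP HN).1 (transform_convex n2 ee inv c) (rho *: e) 0 s M a.
  rewrite scaler0 addr0 Ha lexx => /(_ _ (hM _ rhoe) isT) h.
  apply: le_trans (h _) _; first by rewrite (ltW s0) (le_trans s1)//; lra.
  rewrite -EFinD lee_fin.
  move: s2; rewrite ler_pdivlMr// => s2.
  have : s * (M - a) <= s * `|M - a| by rewrite ler_wpM2l ?(ltW s0)// ler_norm.
  lra.
apply/lee_subgt0Pr => d d0.
have [V V0 hV] := @transform_lsc phi p 0 (a - d) ltac:(by rewrite Ha lte_fin ltrBlDr ltrDl).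
apply: le_ereal_sup_tmp; exists (ereal_inf (H phi @` V)).
  exists V => //; by apply: filterS V0.
by apply: le_ereal_inf_tmp => _ [y Vy <-]; rewrite -EFinB; apply/ltW/hV.
Qed.

End Transform2.

Lemma cvge_near_lt {R : realType} (v : nat -> \bar R) (l : \bar R) (c : R) :
  v @ \oo --> l -> (l < c%:E)%E -> \forall k \near \oo, (v k < c%:E)%E.
Proof.
move=> /cvgeN vl lc; have [h _] := cvg_limn_einf_sup vl.
have : ((- c)%:E < limn_einf (\- v))%E by rewrite h EFinN lteN2.
by move=> /limn_einf_gt; apply: filterS => k; rewrite EFinN lteN2.
Qed.

(** * Epi-convergence and the Legendre transform *)

Section Epi.
Context {R : realType} {n : nat}.
Implicit Types (x y z w : 'cV[R]_n) (phi psi : 'cV[R]_n -> \bar R) (u : nat -> 'cV[R]_n)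
  (phis psis : nat -> 'cV[R]_n -> \bar R).

Definition epi_liminf phis phi := forall x u, u @ \oo --> x ->
  (phi x <= limn_einf (fun k => phis k (u k)))%E.

(** Otherwise points violating the bound ever closer to [y], at arbitrarily large indices, could be
    assembled into one sequence converging to [y], against the lower limit inequality. *)
Lemma epi_local phis phi y (c : R) : epi_liminf phis phi -> (c%:E < phi y)%E ->
  exists (N : nat) (d : R), 0 < d /\
    forall k z, (N <= k)%N -> `|z - y| < d -> (c%:E <= phis k z)%E.
Proof.
move=> epi cy; apply: contrapT => h.
have /choice[ka hka] : forall m : nat, exists k, (m <= k)%N /\
    exists z, `|z - y| < m.+1%:R^-1 /\ (phis k z <= c%:E)%E.
  move=> m; apply: contrapT => hm; apply: h; exists m, m.+1%:R^-1; split => //.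
  move=> k z mk zy; rewrite leNgt; apply/negP => /ltW zc.
  by apply: hm; exists k; split=> //; exists z.
(* The sequence must be indexed by [k], not by the precision [m]; at indices not of the form [ka j]
   it is constantly [y]. *)
have /choice[u hu] : forall k, exists z,
    (exists j, [/\ ka j = k, `|z - y| < j.+1%:R^-1 & (phis k z <= c%:E)%E]) \/
    (z = y /\ ~ exists j, ka j = k).
  move=> k; have [[j jk]|nj] := pselect (exists j, ka j = k); last by exists y; right.
  by have [_ [z [zy zc]]] := hka j; exists z; left; exists j; rewrite -jk.
have ux : u @ \oo --> y.
  apply/cvg_cVP => d d0.
  have [M _ hM] := near_infty_natSinv_lt (PosNum d0).
  near=> k; have [[j [jk uy _]]|[-> _]] := hu k; last by rewrite subrr normr0.
  have [jM|Mj] := ltnP j M; last first.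
    apply: lt_trans uy _; exact: hM.
  (* Beyond all [ka j] with [j < M], an index [k = ka j] has [j >= M]. *)
  exfalso; have : (\max_(j < M) ka j < k)%N by near: k; exists (\max_(j < M) ka j).+1.
  by rewrite ltnNge -jk (leq_bigmax (Ordinal jM)).
have /limn_einf_gt [N _ hN] := lt_le_trans cy (epi y u ux).
have [Nk _] := hka N; have := hN _ Nk; apply/negP; rewrite -leNgt.
have [[j [_ _ //]]|[_ []]] := hu (ka N); by exists N.
Unshelve. all: by end_near. Qed.

Lemma epi_compact phis phi (C : set 'cV[R]_n) (c : R) : epi_liminf phis phi ->
  compact C -> (forall y, C y -> (c%:E < phi y)%E) ->
  \forall k \near \oo, forall y, C y -> (c%:E <= phis k y)%E.
Proof.
move=> epi cC hC.
apply: ((@compact_near_coveringP _ _).1 cC _ \oo (fun k y => (c%:E <= phis k y)%E) _) => y Cy.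
have [N [d [d0 hd]]] := epi_local epi (hC y Cy).
exists ([set z | `|z - y| < d], [set k | (N <= k)%N]).
  by split; [apply/nbhs_cVP; exists d|exists N].
by move=> [z k] /= [zy Nk]; apply: hd.
Qed.

(** On a compact shell the limit [phi] exceeds [a + 1], so eventually each [phis k] is at least
    [a + 1] there, and [linear_growth] applies to it. A shell replaces the sphere because the base
    points [u k] are only within 1 of [x0]. *)
Lemma uniform_growth phis phi x0 u (a r0 M0 : R) :
  (forall k x, phis k x != -oo%E) -> (forall k, convexe (phis k)) ->
  epi_liminf phis phi -> u @ \oo --> x0 ->
  (\forall k \near \oo, phis k (u k) <= a%:E)%E -> 0 < r0 ->
  (forall y, ((r0 * `|y| - M0)%:E <= phi y)%E) ->
  exists2 r : R, 0 < r & exists M : R,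
    \forall k \near \oo, forall y, ((r * `|y| - M)%:E <= phis k y)%E.
Proof.
move=> N_ c_ epi ux ua r00 hM0.
(* On the shell [|y| >= (|a + 2| + |M0|) / r0 + 1], whence [r0 |y| - M0 > a + 1]. *)
pose K := (`|a + 2| + `|M0|) / r0 + `|x0| + 2.
have K1 : 1 < K.
  by rewrite /K ltr_wpDl// ?ltr1n// addr_ge0// divr_ge0 ?addr_ge0// ltW.
have K0 : 0 < K by apply: lt_trans K1.
pose C2 := cball x0 (K + 1).
pose C1 := C2 `&` [set y | K - 1 <= `|y - x0|].
have cC2 : compact C2 by apply: cball_compact.
have cC1 : compact C1.
  apply: compact_closedI => //.
  apply: (@preimage_closed _ _ (fun y => `|y - x0|) [set t | K - 1 <= t]); last exact: closed_ge.
  move=> y _; apply: (@lip_continuous _ _ _ _ 1) => z w; rewrite mul1r.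
  apply: le_trans (ler_dist_dist _ _) _.
  by rewrite opprB addrA subrK.
have h1 : \forall k \near \oo, forall y, C1 y -> ((a + 1)%:E <= phis k y)%E.
  apply: epi_compact epi cC1 _ => y [_ /= yK]; apply: lt_le_trans (hM0 y).
  rewrite lte_fin; have : `|y - x0| <= `|y| + `|x0| by apply: ler_normB.
  move=> h; have : (`|a + 2| + `|M0|) / r0 + 1 <= `|y| by move: yK; rewrite /K; lra.
  have r0n : r0 != 0 by rewrite gt_eqF.
  rewrite -(ler_pM2l r00) mulrDr mulr1 mulrCA mulfV// mulr1.
  have := ler_norm (a + 2); have := ler_norm M0; lra.
have h2 : \forall k \near \oo, forall y, C2 y -> ((- M0 - 1)%:E <= phis k y)%E.
  apply: epi_compact epi cC2 _ => y _; apply: lt_le_trans (hM0 y).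
  have := mulr_ge0 (ltW r00) (normr_ge0 y); rewrite lte_fin; lra.
exists K^-1; first by rewrite invr_gt0.
exists (K^-1 * (`|x0| + 1) + 1 + `|a| + `|- M0 - 1|).
near=> k => y.
have k1 : forall y, C1 y -> ((a + 1)%:E <= phis k y)%E by near: k.
have k2 : forall y, C2 y -> ((- M0 - 1)%:E <= phis k y)%E by near: k.
have ka : (phis k (u k) <= a%:E)%E by near: k.
have kx : `|u k - x0| < 1 by near: k; apply: (cvg_cVP u x0).1.
have tri z : z - x0 = (z - u k) + (u k - x0) by rewrite addrA subrK.
have tri2 z : z - u k = (z - x0) - (u k - x0) by rewrite opprB addrA subrK.
have B1 z : `|z - u k| <= K -> C2 z.
  by move=> zK; rewrite /C2 /cball /= tri; apply: le_trans (ler_normD _ _) _; lra.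
apply: le_trans (@linear_growth _ _ (phis k) (u k) a K (- M0 - 1) (N_ k) (c_ k) ka K0 _ _ y).
- rewrite lee_fin.
  have : K^-1 * `|u k| <= K^-1 * (`|x0| + 1).
    rewrite ler_wpM2l ?invr_ge0 ?(ltW K0)//.
    have : `|u k| <= `|u k - x0| + `|x0| by rewrite -{1}(subrK x0 (u k)) ler_normD.
    lra.
  lra.
- move=> z zK; apply: k1; split; first by apply: B1; rewrite zK.
  have := ler_normB (z - x0) (u k - x0); rewrite -tri2 zK /=; lra.
- by move=> z /B1; apply: k2.
Unshelve. all: by end_near. Qed.

(** The conjugate at [z] is minus the infimum of this function, so bounds of the conjugate around
    [z] become growth of the tilt. *)
Definition tilt phi z y : \bar R := (phi y - (dot z y)%:E)%E.

Lemma tilt_neNy phi z y : phi y != -oo%E -> tilt phi z y != -oo%E.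
Proof. by rewrite /tilt; case: (phi y). Qed.

Lemma tilt_le phi z y (a : R) : (tilt phi z y <= a%:E)%E = (phi y <= (a + dot z y)%:E)%E.
Proof. by rewrite /tilt leeBlDr// EFinD. Qed.

Lemma tilt_ge phi z y (a : R) : (a%:E <= tilt phi z y)%E = ((a + dot z y)%:E <= phi y)%E.
Proof. by rewrite /tilt leeBrDr// EFinD. Qed.

Lemma tilt_gt phi z y (a : R) : (a%:E < tilt phi z y)%E = ((a + dot z y)%:E < phi y)%E.
Proof. by rewrite /tilt lteBrDr// EFinD. Qed.

Lemma tilt_convex phi z : (forall y, phi y != -oo%E) -> convexe phi -> convexe (tilt phi z).
Proof.
move=> N /(convexeP N) c; apply/convexeP => [y|x y t a b t01]; first exact: tilt_neNy.
rewrite !tilt_le => h1 h2; apply: le_trans (c _ _ _ _ _ t01 h1 h2) _.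
by rewrite lee_fin dotDr !dotZr; lra.
Qed.

Lemma cvg_dot_seq u (v : nat -> 'cV[R]_n) x y : u @ \oo --> x -> v @ \oo --> y ->
  (fun k => dot (u k) (v k)) @ \oo --> dot x y.
Proof.
move=> ux vy.
have coord (w : nat -> 'cV[R]_n) z i : w @ \oo --> z -> (fun k => w k i 0) @ \oo --> z i 0.
  move=> wz; exact: (cvg_comp _ (fun M : 'cV[R]_n => M i 0) wz (@coord_continuous R n 1 i 0 z)).
by apply: cvg_big => [|i _]; [exact: add_continuous|apply: cvgM; apply: coord].
Qed.

Lemma tilt_epi_liminf phis phi z : epi_liminf phis phi ->
  epi_liminf (fun k => tilt (phis k) z) (tilt phi z).
Proof.
move=> epi x u ux; apply: limn_einf_ge => c; rewrite tilt_gt => cx.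
have [d d0 cdx] : exists2 d, 0 < d & ((c + dot z x + d)%:E < phi x)%E.
  move: cx; case: (phi x) => [r| |] //; last by exists 1; rewrite ?ltry.
  by rewrite lte_fin => h; exists ((r - (c + dot z x)) / 2); rewrite ?lte_fin; lra.
have /limn_einf_gt h := lt_le_trans cdx (epi x u ux).
have zu : (fun k => dot z (u k)) @ \oo --> dot z x by apply: cvg_dot_seq ux; exact: cvg_cst.
near=> k; rewrite tilt_ge; apply: le_trans (_ : ((c + dot z x + d)%:E <= _)%E).
  rewrite lee_fin; suff : dot z (u k) < dot z x + d by lra.
  by near: k; apply: cvgr_lt zu _ _; rewrite ltrDl.
by apply: ltW; near: k.
Unshelve. all: by end_near. Qed.

(** The recovery sequence of a nearly optimal [y] provides test points for the conjugates of
    [psis k]. *)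
Lemma legendre_liminf psis psi : (forall y, psi y != -oo%E) -> epi_cvg psis psi ->
  epi_liminf (fun k => legendre (psis k)) (legendre psi).
Proof.
move=> N epi z w wz; apply: limn_einf_ge => c /ereal_sup_gt[_ [y _ <-]].
have := N y; case E : (psi y) => [r| |] // _; rewrite -EFinB lte_fin => h.
have [_ [u uy pu]] := epi y; rewrite E in pu.
pose d := (dot z y - r - c) / 2; have d0 : 0 < d by rewrite /d; lra.
have wu := cvg_dot_seq wz uy.
near=> k.
have h1 : dot z y - d < dot (w k) (u k) by near: k; apply: cvgr_gt wu _ _; rewrite ltrBlDr ltrDl.
have h2 : (psis k (u k) <= (r + d)%:E)%E.
  by apply: ltW; near: k; apply: (cvge_near_lt pu); rewrite lte_fin ltrDl.
apply: le_trans (legendre_ge (w k) h2); rewrite lee_fin.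
by move: h1; rewrite /d; lra.
Unshelve. all: by end_near. Qed.

Lemma legendre_lower_bound psis psi (r : R) : Cvx psi -> epi_cvg psis psi ->
  exists b : R, \forall k \near \oo, forall z, `|z| <= r -> (b%:E <= legendre (psis k) z)%E.
Proof.
move=> c epi; have [y [a E]] := Cvx_fin c.
have [_ [u uy pu]] := epi y; rewrite E in pu.
exists (- (n%:R * r * (`|y| + 1)) - (a + 1)); near=> k => z zr.
have h2 : (psis k (u k) <= (a + 1)%:E)%E.
  by apply: ltW; near: k; apply: (cvge_near_lt pu); rewrite lte_fin ltrDl.
have h1 : `|u k| <= `|y| + 1.
  have : `|u k - y| < 1 by near: k; apply: (cvg_cVP u y).1.
  have : `|u k| <= `|u k - y| + `|y| by rewrite -{1}(subrK y (u k)) ler_normD.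
  lra.
apply: le_trans (legendre_ge z h2); rewrite lee_fin lerD2r.
have := dot_norm z (u k); rewrite ler_norml => /andP[h3 _]; apply: le_trans h3.
rewrite lerN2 ler_pM// ?mulr_ge0// ler_wpM2l//.
Unshelve. all: by end_near. Qed.

Definition bounded_around (h : 'cV[R]_n -> \bar R) z := exists2 rho : R, 0 < rho &
  exists M : R, forall w, `|w - z| <= rho -> (h w <= M%:E)%E.

(** An upper bound of the conjugate around [z] is linear growth of the tilt of [psi];
    [uniform_growth] carries it over to all late [psis k]. *)
Lemma legendre_tilt_growth psis psi z : (forall k, Cvx (psis k)) -> Cvx psi ->
  epi_cvg psis psi -> bounded_around (legendre psi) z ->
  exists2 r : R, 0 < r & exists M : R,
    \forall k \near \oo, forall y, ((r * `|y| - M)%:E <= tilt (psis k) z y)%E.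
Proof.
move=> c_ c epi [rho rho0 [M hM]].
have [y0 [a E]] := Cvx_fin c; have [_ [u uy pu]] := epi y0; rewrite E in pu.
apply: (@uniform_growth _ (tilt psi z) y0 u (a - dot z y0 + 2) rho M) => //.
- by move=> k x; apply: tilt_neNy; case: (c_ k).
- by move=> k; apply: tilt_convex; case: (c_ k).
- by apply: tilt_epi_liminf => x v vx; case: (epi x) => /(_ _ vx).
- have zu : (fun k => dot z (u k)) @ \oo --> dot z y0 by apply: cvg_dot_seq uy; exact: cvg_cst.
  near=> k; rewrite tilt_le.
  have h2 : (psis k (u k) <= (a + 1)%:E)%E.
    by apply: ltW; near: k; apply: (cvge_near_lt pu); rewrite lte_fin ltrDl.
  apply: le_trans h2 _; rewrite lee_fin.
  have : dot z y0 - 1 < dot z (u k) by near: k; apply: cvgr_gt zu _ _; rewrite ltrBlDr ltrDl.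
  lra.
- move=> y; rewrite tilt_ge; have [->|yn0] := eqVneq y 0.
    have /legendre_leP/(_ 0) : (legendre psi z <= M%:E)%E by apply: hM; rewrite subrr normr0 ltW.
    by apply: le_trans; rewrite lee_fin normr0 mulr0 !dot0r; lra.
  have ey : 0 < enorm y by rewrite enorm_gt0.
  have /hM/legendre_leP/(_ y) : `|(z + (rho / enorm y) *: y) - z| <= rho.
    rewrite addrAC subrr add0r normrZ ger0_norm ?divr_ge0 ?(ltW rho0) ?(ltW ey)//.
    by rewrite mulrAC ler_pdivrMr// ler_wpM2l ?(ltW rho0)// norm_enorm.
  apply: le_trans; rewrite lee_fin dotDl dotZl -sqr_enorm expr2 mulrA divfK ?gt_eqF//.
  have : rho * `|y| <= rho * enorm y by rewrite ler_wpM2l ?(ltW rho0)// norm_enorm.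
  lra.
Unshelve. all: by end_near. Qed.

Lemma legendre_local_bound psis psi z : (forall k, Cvx (psis k)) -> Cvx psi ->
  epi_cvg psis psi -> bounded_around (legendre psi) z ->
  exists2 rho : R, 0 < rho & exists M : R, \forall k \near \oo,
    forall w, `|w - z| <= rho -> (legendre (psis k) w <= M%:E)%E.
Proof.
move=> c_ c epi bz; have [r r0 [M hM]] := legendre_tilt_growth c_ c epi bz.
have n0 : 0 < 1 + n%:R :> R by rewrite ltr_pwDl.
exists (r / (1 + n%:R)); first by rewrite divr_gt0.
exists M; near=> k => w wz; apply/legendre_leP => y.
have : ((r * `|y| - M)%:E <= tilt (psis k) z y)%E by move: y; near: k.
rewrite tilt_ge; apply: le_trans; rewrite lee_fin.
have -> : dot w y = dot (w - z) y + dot z y by rewrite dotBl subrK.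
have h1 := le_trans (ler_norm _) (dot_norm (w - z) y).
have : n%:R * `|w - z| <= r.
  by move: wz; rewrite ler_pdivlMr// mulrDr mulr1; have := normr_ge0 (w - z); lra.
move=> /(ler_wpM2r (normr_ge0 y)); lra.
Unshelve. all: by end_near. Qed.

(** The claim is a lower bound [- c0] for the tilts: far out it follows from their common growth, on
    the remaining ball from [epi_compact]. *)
Lemma legendre_limsup psis psi z (c0 : R) : (forall k, Cvx (psis k)) -> Cvx psi ->
  epi_cvg psis psi -> bounded_around (legendre psi) z -> (legendre psi z < c0%:E)%E ->
  \forall k \near \oo, (legendre (psis k) z <= c0%:E)%E.
Proof.
move=> c_ c epi bz zc; have [r r0 [M hM]] := legendre_tilt_growth c_ c epi bz.
have te : epi_liminf (fun k => tilt (psis k) z) (tilt psi z).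
  by apply: tilt_epi_liminf => x v vx; case: (epi x) => /(_ _ vx).
have h := epi_compact (c := - c0) te (@cball_compact R n 0 ((M - c0) / r)).
have {h} h : \forall k \near \oo, forall y, cball 0 ((M - c0) / r) y -> ((- c0)%:E <= tilt (psis k) z y)%E.
  apply: h => y _; rewrite tilt_gt.
  have [LN _ _ _] := legendre_Cvx c.
  have := LN z; move: zc; case E : (legendre psi z) => [s| |] // + _; rewrite lte_fin => sc.
  have /legendre_leP/(_ y) : (legendre psi z <= s%:E)%E by rewrite E.
  by apply: lt_le_trans; rewrite lte_fin; lra.
near=> k; apply/legendre_leP => y.
have [yK|yK] := leP `|y - 0| ((M - c0) / r).
  have : ((- c0)%:E <= tilt (psis k) z y)%E.
    by move: y yK; near: k.
  by rewrite tilt_ge addrC.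
have : ((r * `|y| - M)%:E <= tilt (psis k) z y)%E by move: y yK; near: k; apply: filterS hM => k hk y _.
rewrite tilt_ge; apply: le_trans; rewrite lee_fin.
by move: yK; rewrite subr0 ltr_pdivrMr//; lra.
Unshelve. all: by end_near. Qed.

End Epi.

Lemma ereal_cvg_bounds {R : realType} (v : nat -> \bar R) (l : \bar R) :
  (l <= limn_einf v)%E -> (forall c : R, (l < c%:E)%E -> \forall k \near \oo, (v k <= c%:E)%E) ->
  v @ \oo --> l.
Proof.
move=> hl hu.
have hs : (limn_esup v <= l)%E.
  rewrite -[X in (X <= _)%E]oppeK -limn_einfN leeNl; apply: limn_einf_ge => c.
  rewrite lteNr -EFinN => /hu; apply: filterS => k /=.
  by rewrite leeNr EFinN.
have El : limn_einf v = l.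
  by apply/eqP; rewrite eq_le hl (le_trans (limn_einf_sup v) hs).
have Es : limn_esup v = l.
  by apply/eqP; rewrite eq_le hs -{1}El limn_einf_sup.
apply: (@squeeze_cvge _ _ _ _ (einfs v) v (esups v)).
- apply: nearW => k; apply/andP; split.
    by apply: ereal_inf_lbound; exists k => /=.
  by apply: ereal_sup_ubound; exists k => /=.
- by rewrite -El limn_einf_lim; exact: is_cvg_einfs.
- by rewrite -Es limn_esup_lim; exact: is_cvg_esups.
Qed.

(** * Epi-convergence of conjugates from bounds on shrunk points *)

Section EpiLegendre.
Context {R : realType} {n : nat}.
Implicit Types (x y z w : 'cV[R]_n) (phi psi : 'cV[R]_n -> \bar R) (u : nat -> 'cV[R]_n)
  (phis psis : nat -> 'cV[R]_n -> \bar R).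

(** Weights [t] on a finite point [z'] near [z] and [1 - t] on the ball of radius [rho] at the
    origin cover a ball around [t z]. Half of the radius [(1 - t) rho] is spent on [w], half on the
    displacement of [z'], so [z] need only be in the closure of the domain. *)
Lemma scaled_bounded_around (h : 'cV[R]_n -> \bar R) z (t : R) : (forall x : 'cV[R]_n, h x != -oo%E) -> convexe h -> bounded0 h ->
  (forall d : R, 0 < d -> exists z', `|z' - z| < d /\ (h z' < +oo)%E) -> 0 <= t < 1 ->
  bounded_around h (t *: z).
Proof.
move=> N /(convexeP N) c [rho rho0 [M hM]] hz /andP[t0 t1].
have t'0 : 0 < 1 - t by lra.
have d0 : 0 < (1 - t) * rho / 2 by rewrite divr_gt0// mulr_gt0.
have [z' [zz' fz]] := hz _ d0.
have [m hm] : exists m, h z' = m%:E.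
  by move: fz; have := N z'; case: (h z') => [m| |] // _ _; exists m.
exists ((1 - t) * rho / 2) => //; exists (t * m + (1 - t) * M) => w wz.
pose q := (1 - t)^-1 *: (w - t *: z').
have wE : w = t *: z' + (1 - t) *: q.
  by rewrite /q scalerA mulfV ?gt_eqF// scale1r addrC subrK.
rewrite wE; apply: c; [by rewrite t0 ltW|by rewrite hm|].
apply: hM; rewrite /q normrZ gtr0_norm ?invr_gt0// mulrC ler_pdivrMr// mulrC.
have -> : w - t *: z' = (w - t *: z) - t *: (z' - z) by colring.
apply: le_trans (ler_normB _ _) _; rewrite normrZ ger0_norm//.
have : t * `|z' - z| <= 1 * `|z' - z| by rewrite ler_wpM2r// ltW.
lra.
Qed.

(* The recovery sequence comes from Hahn-Banach: [sandwich] finds a linear function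
   of slope at most [d] below [tilt (Gs k) y + d |x|], hence a point [y'] within [d]
   of [y] where [legendre (Gs k)] is at most [legendre G y + d]. *)
Lemma epi_legendre (Gs : nat -> 'cV[R]_n -> \bar R) (G : 'cV[R]_n -> \bar R) (h0 : R) :
  (forall k x, Gs k x != -oo%E) -> (forall k, convexe (Gs k)) ->
  (forall x, G x != -oo%E) -> (G 0%R <= h0%:E)%E -> epi_liminf Gs G ->
  (forall x (r c t : R), (G x <= r%:E)%E -> 0 < t < 1 -> t * r + (1 - t) * h0 < c ->
    \forall k \near \oo, (Gs k (t *: x) <= c%:E)%E) ->
  epi_cvg (fun k => legendre (Gs k)) (legendre G).
Proof.
move=> Ns cs N G0 epi up.
have lo : epi_liminf (fun k => legendre (Gs k)) (legendre G).
  move=> y u uy; apply: limn_einf_ge => c /ereal_sup_gt[_ [x _ <-]].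
  have := N x; case E : (G x) => [r| |] // _; rewrite -EFinB lte_fin => h.
  pose d := dot y x - r - c; have d0 : 0 < d by rewrite /d; lra.
  pose S : R := `|dot y x - r + h0|.
  have S1 : 0 <= S := normr_ge0 _.
  (* [up] controls [Gs k] only at shrunk points [(1 - s) x]; this [s] keeps the loss
     [s (dot y x - r + h0)] below [d / 4]. *)
  pose s := Num.min (1 / 2) (d / (4 * (1 + S))).
  have S0 : 0 < 4 * (1 + S) by lra.
  have s0 : 0 < s by rewrite lt_min divr_gt0//= divr_gt0.
  have s1 : s <= 1 / 2 by rewrite ge_min lexx.
  have s2 : s * (4 * (1 + S)) <= d by rewrite -ler_pdivlMr// ge_min lexx orbT.
  have sS : s * (dot y x - r + h0) <= s * S by rewrite ler_wpM2l ?(ltW s0)// ler_norm.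
  have hk : \forall k \near \oo, (Gs k ((1 - s) *: x) <= ((1 - s) * r + s * h0 + d / 4)%:E)%E.
    apply: (up x r _ (1 - s)); [by rewrite E|by apply/andP; split; lra|].
    rewrite (_ : 1 - (1 - s) = s); [lra|by ring].
  have yu : (fun k => dot (u k) x) @ \oo --> dot y x by apply: cvg_dot_seq uy _; exact: cvg_cst.
  near=> k.
  have k1 : (Gs k ((1 - s) *: x) <= ((1 - s) * r + s * h0 + d / 4)%:E)%E by near: k.
  have k2 : dot y x - d / 4 < dot (u k) x by near: k; apply: cvgr_gt yu _ _; rewrite ltrBlDr ltrDl divr_gt0.
  apply: le_trans (legendre_ge (u k) k1); rewrite lee_fin dotZr.
  have : (1 - s) * (dot y x - d / 4) <= (1 - s) * dot (u k) x.
    by rewrite ler_wpM2l ?(ltW k2)//; lra.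
  have : 0 <= s * d by rewrite mulr_ge0 ?(ltW s0) ?(ltW d0).
  move: s2 sS; rewrite /d; lra.
move=> y; split; first exact: lo.
have LN : legendre G y != -oo%E.
  by apply/eqP => E; have := legendre_ge y G0; rewrite E.
case E : (legendre G y) LN => [a| |] // _; last first.
  exists (fun=> y); first exact: cvg_cst.
  apply: ereal_cvg_bounds; last by move=> c.
  by rewrite -E; apply: lo; exact: cvg_cst.
have Ga x : ((- a)%:E <= tilt G y x)%E.
  have /legendre_leP/(_ x) : (legendre G y <= a%:E)%E by rewrite E.
  by rewrite tilt_ge addrC.
have key (d : R) : 0 < d -> \forall k \near \oo, exists y', `|y' - y| <= d /\
    (legendre (Gs k) y' <= (a + d)%:E)%E.
  move=> d0; pose C := h0 + 1; pose m := - a - d.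
  have Cm : m <= C.
    have := Ga 0; rewrite tilt_ge dot0r addr0 => /le_trans /(_ G0); rewrite lee_fin.
    by rewrite /m /C; lra.
  (* Beyond radius [K] the tilt decreases at slope at most [(C - m) / K <= d], which the cone of
     slope [d] allows. *)
  pose K := (C - m) / d + 1.
  have K0 : 0 < K by rewrite ltr_wpDl// divr_ge0 ?(ltW d0)// subr_ge0.
  have h1 : \forall k \near \oo, forall x, cball 0 K x -> (m%:E <= tilt (Gs k) y x)%E.
    apply: epi_compact (tilt_epi_liminf y epi) (@cball_compact R n 0 K) _ => x _.
    by apply: lt_le_trans (Ga x); rewrite lte_fin /m; lra.
  have h2 : \forall k \near \oo, (Gs k ((1 / 2) *: 0) <= C%:E)%E.
    by apply: (up 0 h0 C (1 / 2)) => //; rewrite /C; [apply/andP; split; lra|lra].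
  near=> k.
  have k1 : forall x, cball 0 K x -> (m%:E <= tilt (Gs k) y x)%E by near: k.
  have k2 : (Gs k 0%R <= C%:E)%E.
    by have : (Gs k ((1 / 2) *: 0)%R <= C%:E)%E; [near: k|rewrite scaler0].
  have tN x : tilt (Gs k) y x != -oo%E by apply: tilt_neNy.
  have tc : convexe (tilt (Gs k) y) by apply: tilt_convex.
  have [x|y' y'd hy'] := @sandwich _ _ (tilt (Gs k) y) 0 m d tN tc (ltW d0).
    rewrite subr0.
    have l1 : `|x| <= \sum_i `|x i 0|.
      apply: norm_le_coord => [|i]; first exact: sumr_ge0.
      by rewrite (bigD1 i)//= lerDl sumr_ge0.
    have [xK|xK] := leP `|x - 0| K.
      apply: le_trans (k1 x xK); rewrite lee_fin.
      by rewrite gerBl mulr_ge0 ?(ltW d0)// sumr_ge0.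
    have k3 : (tilt (Gs k) y 0%R <= C%:E)%E by rewrite tilt_le dot0r addr0.
    have := convex_growth tN tc k3 K0.
    have k1' z : `|z - 0| = K -> (m%:E <= tilt (Gs k) y z)%E by move=> zK; apply: k1; rewrite /cball /= zK.
    move=> /(_ m k1' x (ltW xK)).
    apply: le_trans; rewrite lee_fin subr0.
    have : (C - m) / K <= d.
      rewrite ler_pdivrMr// /K mulrDr mulrCA mulfV ?gt_eqF// mulr1; lra.
    move=> /(ler_wpM2r (normr_ge0 x)) hC.
    have : d * `|x| <= d * \sum_i `|x i 0| by rewrite ler_wpM2l ?(ltW d0).
    have -> : (m - C) / K * `|x| = - ((C - m) / K * `|x|) by rewrite -!mulNr opprB.
    lra.
  exists (y + y'); split; first by rewrite addrAC subrr add0r.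
  apply/legendre_leP => x; have := hy' x; rewrite subr0 tilt_ge.
  by apply: le_trans; rewrite lee_fin dotDl /m; lra.
(* For each [k] a single point serves every precision [1 / (j + 1)], [j <= k], that is attainable:
   take one for the finest of these. *)
have /choice[u hu] : forall k : nat, exists y', forall j, (j <= k)%N ->
    (exists y', `|y' - y| <= j.+1%:R^-1 /\ (legendre (Gs k) y' <= (a + j.+1%:R^-1)%:E)%E) ->
    `|y' - y| <= j.+1%:R^-1 /\ (legendre (Gs k) y' <= (a + j.+1%:R^-1)%:E)%E.
  move=> k; suff : forall m, exists y', forall j, (j <= m)%N ->
    (exists y', `|y' - y| <= j.+1%:R^-1 /\ (legendre (Gs k) y' <= (a + j.+1%:R^-1)%:E)%E) ->
    `|y' - y| <= j.+1%:R^-1 /\ (legendre (Gs k) y' <= (a + j.+1%:R^-1)%:E)%E by move=> /(_ k).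
  elim=> [|m [y' IH]].
    have [[y' h]|h] := pselect (exists y', `|y' - y| <= 0.+1%:R^-1 /\ (legendre (Gs k) y' <= (a + 0.+1%:R^-1)%:E)%E).
      by exists y' => j; rewrite leqn0 => /eqP ->.
    by exists y => j; rewrite leqn0 => /eqP -> /h.
  have [[z [z1 z2]]|h] := pselect (exists z, `|z - y| <= m.+2%:R^-1 /\ (legendre (Gs k) z <= (a + m.+2%:R^-1)%:E)%E).
    exists z => j jm _; have le : m.+2%:R^-1 <= j.+1%:R^-1 :> R.
      by rewrite lef_pV2 ?posrE// ler_nat ltnS.
    split; first exact: le_trans z1 le.
    by apply: le_trans z2 _; rewrite lee_fin lerD2l.
  exists y' => j; rewrite leq_eqVlt => /orP[/eqP -> /h //|]; exact: IH.
have small (d : R) : 0 < d -> \forall k \near \oo, `|u k - y| < d /\ (legendre (Gs k) (u k) <= (a + d)%:E)%E.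
  move=> d0; have [j _ hj] := near_infty_natSinv_lt (PosNum d0).
  have jd : j.+1%:R^-1 < d := hj j (leqnn j).
  have j0 : 0 < j.+1%:R^-1 :> R by rewrite invr_gt0.
  near=> k; have jk : (j <= k)%N by near: k; exists j.
  have hk : exists y', `|y' - y| <= j.+1%:R^-1 /\ (legendre (Gs k) y' <= (a + j.+1%:R^-1)%:E)%E.
    by near: k; exact: key.
  have [h1 h2] := hu k j jk hk.
  split; first exact: le_lt_trans h1 jd.
  by apply: le_trans h2 _; rewrite lee_fin lerD2l ltW.
have uy : u @ \oo --> y.
  by apply/cvg_cVP => d /small; apply: filterS => k [].
exists u => //; apply: ereal_cvg_bounds; first by rewrite -E; exact: lo.
move=> c; rewrite lte_fin => ac.
have d0 : 0 < c - a by rewrite subr_gt0.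
have := small _ d0; apply: filterS => k [_]; by rewrite addrC subrK.
Unshelve. all: by end_near. Qed.

End EpiLegendre.

(** * Upper bounds for the transform and its epi-continuity *)

Section TransformLimsup.
Context {R : realType} {n : nat}.
Implicit Types (x y z v w : 'cV[R]_n) (A : 'M[R]_n) (phi psi : 'cV[R]_n -> \bar R)
  (psis : nat -> 'cV[R]_n -> \bar R).
Local Notation T := (borelRn R n).
Variables (e : 'cV[R]_n) (mu : {finite_measure set T -> \bar R}).
Hypotheses (n2 : (2 <= n)%N) (ee : dot e e = 1).
Hypothesis inv : forall A, orthmx A -> A *m e = e -> preserves mu A.

Local Notation H := (sphere_conv_ne0 e mu).

Lemma lsc_integrable phi : lsc_proper phi -> (\int[mu]_(v in sphere) phi v < +oo)%E ->
  mu.-integrable (sphere : set T) (phi : T -> \bar R).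
Proof.
move=> p fin; have [b hb] := lsc_proper_bounded p.
have ms := @sphere_measurable R n.
have mp := @lsc_proper_measurable _ _ phi (sphere : set T) p.
apply/integrableP; split => //.
(* [phi >= b] gives [|phi| <= phi + 2 |b|], whose integral is finite. *)
have m2 : measurable_fun (sphere : set T) (fun v : T => (phi v + (2 * `|b|)%:E)%E).
  by apply: emeasurable_funD.
apply: (@le_lt_trans _ _ (\int[mu]_(v in sphere) (phi v + (2 * `|b|)%:E))%E).
  apply: ge0_le_integral => //.
  - by apply: measurableT_comp.
  - move=> v vs; have := hb v vs; have := ler_norm (- b); rewrite normrN.
    case: (phi v) => [r| |] //= h; rewrite !lee_fin => h1.
    have := normr_ge0 b; move: (`|b|) h => b' h b0.
    by case: (leP 0 r) => r0; [rewrite (ger0_norm r0)|rewrite (ltr0_norm r0)]; lra.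
rewrite (integral_shift mu ms (2 * `|b|) mp hb).
by rewrite lte_add_pinfty// ltey_eq fin_numM// fin_num_measure.
Qed.

(* Where [h = legendre psi] is finite, [h (t z)] is an interior value, so there
   [legendre (psis k)] converges pointwise; compactness of the closure of the
   domain within a ball makes the convergence dominated. *)
Lemma scaled_uniform_bound psis psi (t r : R) : (forall k, Cvx (psis k)) -> Cvx psi ->
  epi_cvg psis psi -> bounded0 (legendre psi) -> 0 <= t < 1 ->
  exists M : R, \forall k \near \oo, forall z, `|z| <= r -> (legendre psi z < +oo)%E ->
    (legendre (psis k) (t *: z) <= M%:E)%E.
Proof.
move=> c_ c epi b0 t01; have [LN Lc _ _] := legendre_Cvx c.
pose dm := [set z | (legendre psi z < +oo)%E].
pose K := cball (0 : 'cV[R]_n) r `&` closure dm.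
have cK : compact K.
  by apply: compact_closedI; [exact: cball_compact|exact: closed_closure].
have hK z : K z -> bounded_around (legendre psi) (t *: z).
  move=> [_ zc]; apply: scaled_bounded_around => // d d0.
  have /zc[z' [fz zz']] : nbhs z [set z' | `|z' - z| < d] by apply/nbhs_cVP; exists d.
  by exists z'.
(* The bound is a second near-covering parameter, tending to [+oo] along with the index. *)
pose P (i : nat * R) z := (legendre (psis i.1) (t *: z) <= i.2%:E)%E.
have [|[U V] [[N _ hN] [m [_ hm]]] UV] :=
    (@compact_near_coveringP _ K).1 cK _ (filter_prod \oo (+oo : set_system R)) P _.
  move=> z Kz; have [rho rho0 [M [N _ hM]]] := legendre_local_bound c_ c epi (hK z Kz).
  exists ([set z' | `|z' - z| < rho], [set i : nat * R | (N <= i.1)%N /\ M < i.2]).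
    split; first by apply/nbhs_cVP; exists rho.
    exists ([set k | (N <= k)%N], [set s | M < s]).
      by split; [exists N|exists M; split => //; exact: num_real].
    by move=> [k s] /= [].
  move=> [z' [k s]] /= [zz' [Nk Ms]]; apply: (@le_trans _ _ M%:E); last by rewrite lee_fin ltW.
  apply: (hM k Nk); rewrite -scalerBr normrZ.
  case/andP: t01 => t0 t1; rewrite ger0_norm//.
  have : t * `|z' - z| <= 1 * `|z' - z| by rewrite ler_wpM2r// ltW.
  lra.
exists (m + 1); exists N => // k Nk z zr fz.
apply: (UV (k, m + 1)); first by split; [exact: hN|apply: hm; rewrite ltrDl].
split; first by rewrite /cball /= subr0.
by apply: subset_closure.
Qed.

(** Finiteness of the transform at [x] itself makes [legendre psi] finite almost everywhere on the
    rotated sphere of radius [enorm x]. Shrinking by [t] brings almost all integration points into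
    the interior of the domain, which gives pointwise convergence and, with the bounds [b] and [M],
    domination by a constant. *)
Lemma transform_limsup psis psi x (t c : R) : (forall k, Cvx (psis k)) -> Cvx psi ->
  epi_cvg psis psi -> bounded0 (legendre psi) -> (H (legendre psi) x < +oo)%E -> 0 <= t < 1 ->
  (H (legendre psi) (t *: x) < c%:E)%E ->
  \forall k \near \oo, (H (legendre (psis k)) (t *: x) <= c%:E)%E.
Proof.
move=> c_ cc epi b0 fin t01 hc.
have p : lsc_proper (legendre psi) by apply: Cvx_lsc_proper; apply: legendre_Cvx.
have p_ k : lsc_proper (legendre (psis k)) by apply: Cvx_lsc_proper; apply: legendre_Cvx.
have ms := @sphere_measurable R n.
have [LN Lc _ _] := legendre_Cvx cc.
have [A oA Ae] := exists_orthmx x n2 ee.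
have etx : enorm (t *: x) = t * enorm x by rewrite enormZ ger0_norm//; case/andP: t01.
have Ae' : enorm (t *: x) *: (A *m e) = t *: x by rewrite etx -scalerA Ae.
have HE phi : lsc_proper phi -> H phi (t *: x) = (\int[mu]_(v in sphere) phi (t *: (enorm x *: (A *m v))))%E.
  move=> q; rewrite (@transformE _ _ e mu n2 ee inv phi (t *: x) A)//.
  by apply: eq_integral => v _; rewrite etx -scalerA.
have Hx := @transformE _ _ e mu n2 ee inv (legendre psi) x A p oA Ae.
rewrite Hx in fin.
have sc phi : lsc_proper phi -> lsc_proper (fun v => phi (t *: (enorm x *: (A *m v)))).
  move=> q; have := lsc_proper_scale (t * enorm x) A q.
  by under eq_fun do rewrite -scalerA.
have ae := integrable_ae ms (lsc_integrable (lsc_proper_scale (enorm x) A p) fin).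
have [M hM] := scaled_uniform_bound (enorm x) c_ cc epi b0 t01.
have [b hb] := legendre_lower_bound (enorm x) cc epi.
have [N _ hN] : \forall k \near \oo,
    (forall z, `|z| <= enorm x -> (legendre psi z < +oo)%E -> (legendre (psis k) (t *: z) <= M%:E)%E) /\
    (forall z, `|z| <= enorm x -> (b%:E <= legendre (psis k) z)%E).
  by near=> k; split; near: k.
pose S := Num.max `|M| `|b|.
(* Zero for the first [N] indices, so that the dominating constant works for every [k]. *)
pose g k v := if (N <= k)%N then legendre (psis k) (t *: (enorm x *: (A *m v))) else 0%E.
have ball v : sphere v -> `|enorm x *: (A *m v)| <= enorm x.
  by move=> vs; apply: norm_scale_orthmx => //; exact: enorm_ge0.
have tball z : `|z| <= enorm x -> `|t *: z| <= enorm x.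
  case/andP: t01 => t0 t1 h; rewrite normrZ ger0_norm//; apply: le_trans h.
  by rewrite ler_piMl// ltW.
have mg k : measurable_fun (sphere : set T) (g k : T -> \bar R).
  rewrite /g; case: (N <= k)%N; last exact: measurable_cst.
  exact: lsc_proper_measurable (sc _ (p_ k)).
have cg : {ae mu, forall v : T, sphere v -> (g ^~ v) @ \oo --> legendre psi (t *: (enorm x *: (A *m v)))}.
  apply: filterS ae => v hv vs; have fv := hv vs.
  set z := enorm x *: (A *m v) in fv *.
  have bz : bounded_around (legendre psi) (t *: z).
    apply: scaled_bounded_around => // d d0; exists z; rewrite subrr normr0; split => //.
    by rewrite ltey_eq fv.
  apply: ereal_cvg_bounds.
    apply: le_trans (legendre_liminf _ epi (u := fun=> t *: z) _) _; [by case: cc|exact: cvg_cst|].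
    by apply: limn_einf_near_le; near=> k; rewrite /g ifT//; near: k; exists N.
  move=> c1 hc1; have := legendre_limsup c_ cc epi bz hc1.
  move=> hk; near=> k; rewrite /g ifT; first by near: k.
  by near: k; exists N.
have bg : {ae mu, forall (v : T) k, sphere v -> (`|g k v| <= S%:E)%E}.
  apply: filterS ae => v hv k vs; have fv := hv vs; rewrite /g; case: ifP => Nk; last first.
    by rewrite abse0 lee_fin le_max normr_ge0.
  have [h1 h2] := hN k Nk; have bv := ball v vs.
  have {}h1 : (legendre (psis k) (t *: (enorm x *: (A *m v))) <= M%:E)%E.
    by apply: h1 => //; rewrite ltey_eq fv.
  have {}h2 := h2 _ (tball _ bv).
  have := ler_norm M; have := ler_norm (- b); rewrite normrN.
  case: (legendre (psis k) _) h1 h2 => [q| |] // h1 h2 hb1 hM1.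
  rewrite abse_EFin lee_fin /S ler_norml lerNl.
  rewrite lee_fin in h1; rewrite lee_fin in h2.
  by apply/andP; split; rewrite le_max; apply/orP; [right|left]; lra.
have ig : mu.-integrable (sphere : set T) (fun=> S%:E).
  exact: finite_measure_integrable_cst.
have mh : measurable_fun (sphere : set T) (fun v : T => legendre psi (t *: (enorm x *: (A *m v)))).
  exact: lsc_proper_measurable (sc _ p).
have [_ _ cv] := dominated_convergence ms mg mh cg ig bg.
rewrite HE// in hc; have {}hc := cvge_near_lt cv hc.
near=> k; rewrite HE//.
have Nk : (N <= k)%N by near: k; exists N.
have : (\int[mu]_(v in sphere) g k v < c%:E)%E by near: k.
by rewrite /g Nk => /ltW.
Unshelve. all: by end_near. Qed.


Lemma transform_epi psis psi : (forall k, Cvx (psis k)) -> Cvx psi ->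
  epi_cvg psis psi -> bounded0 (legendre psi) ->
  epi_cvg (fun k => legendre (H (legendre (psis k)))) (legendre (H (legendre psi))).
Proof.
move=> c_ c epi b0.
have LC := legendre_Cvx c; have p := Cvx_lsc_proper LC.
have LC_ k := legendre_Cvx (c_ k); have p_ k := Cvx_lsc_proper (LC_ k).
have HN x : H (legendre psi) x != -oo%E by exact: transform_neNy.
have [h0 Hh0] := bounded0_at0 HN (transform_bounded0 n2 ee inv p b0).
apply: (@epi_legendre _ _ _ _ h0) => //.
- by move=> k x; apply: transform_neNy.
- by move=> k; apply: transform_convex.
- by rewrite Hh0.
- move=> x u ux; apply: (transform_liminf n2 ee inv) => //.
    by move=> r; apply: (legendre_lower_bound r c epi).
  by move=> z w; apply: (legendre_liminf _ epi); case: c.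
- move=> x r c0 t Hr /andP[t0 t1] hc; apply: (transform_limsup c_ c epi b0 (x := x)).
  + exact: le_lt_trans Hr (ltry _).
  + by rewrite ltW.
  (* Convexity on the segment from the origin to [x] turns the bound on the weighted average into
     one on the value at [t x]. *)
  + have := (convexeP HN).1 (transform_convex n2 ee inv LC) x 0 t r h0.
    rewrite scaler0 addr0 Hh0 lexx => h; apply: le_lt_trans (h _ Hr isT) _.
      by rewrite !ltW.
    by rewrite lte_fin.
Qed.

End TransformLimsup.

(** * The endomorphism *)

Section LegendreSymmetries.
Context {R : realType} {n : nat}.
Implicit Types (x y z v w : 'cV[R]_n) (A : 'M[R]_n) (phi psi : 'cV[R]_n -> \bar R)
  (f g : 'cV[R]_n -> R).

Lemma eq_fin_ubound (a b : \bar R) :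
  (forall c : R, (a <= c%:E)%E <-> (b <= c%:E)%E) -> a = b.
Proof.
have le (u v : \bar R) : (forall c : R, (v <= c%:E)%E -> (u <= c%:E)%E) -> (u <= v)%E.
  case: v => [r h| |h]; [exact: h|by rewrite leey|].
  case: u h => [r| |] h //; first by have := h (r - 1)%R (leNye _); rewrite lee_fin lerDl oppr_ge0 ler10.
  by have := h 0%R (leNye _).
by move=> h; apply/eqP; rewrite eq_le !le// => c; apply h.
Qed.

Lemma legendre_anti phi psi x : (forall y, phi y <= psi y)%E ->
  (legendre psi x <= legendre phi x)%E.
Proof.
move=> h; apply: ge_ereal_sup => _ [y _ <-].
by apply: le_trans (leeB (lexx _) (h y)) _; apply: ereal_sup_ubound; exists y.
Qed.

Lemma legendre_shift phi y x : legendre (fun z => phi (z - y)) x = (legendre phi x + (dot x y)%:E)%E.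
Proof.
apply: eq_fin_ubound => c; rewrite -leeBrDr// -EFinB; split=> /legendre_leP h; apply/legendre_leP => z.
  have := h (z + y); rewrite addrK; apply: le_trans; rewrite lee_fin dotDr; lra.
by apply: le_trans (h (z - y)); rewrite lee_fin dotBr; lra.
Qed.

Lemma legendre_orthmx phi A x : orthmx A ->
  legendre (fun z => phi (A^T *m z)) x = legendre phi (A^T *m x).
Proof.
move=> oA; apply: eq_fin_ubound => c; split=> /legendre_leP h; apply/legendre_leP => z.
  have := h (A *m z); rewrite mulmxA oA mul1mx; apply: le_trans.
  by rewrite lee_fin dot_mulmx trmxK.
by apply: le_trans (h (A^T *m z)); rewrite lee_fin dot_orthmx//; apply: orthmx_tr.
Qed.

Lemma neglog_anti f g x : 0 <= f x -> f x <= g x -> (neglog g x <= neglog f x)%E.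
Proof.
move=> f0 fg; rewrite /neglog leeN2 lee_lne ?in_itv/= ?lee_fin ?leey ?andbT//.
exact: le_trans f0 fg.
Qed.

Lemma expN_anti phi psi x : phi x != -oo%E -> psi x != -oo%E -> (phi x <= psi x)%E ->
  expN psi x <= expN phi x.
Proof.
by move=> p q pq; rewrite -lee_fin !expNE// lee_expeR leeN2.
Qed.

End LegendreSymmetries.

Section Endomorphism.
Context {R : realType} {n : nat}.
Implicit Types (x y z v w : 'cV[R]_n) (A : 'M[R]_n) (phi psi : 'cV[R]_n -> \bar R)
  (f g : 'cV[R]_n -> R).
Local Notation T := (borelRn R n).
Variables (e : 'cV[R]_n) (mu : {finite_measure set T -> \bar R}).

Local Notation H := (sphere_conv_ne0 e mu).

Lemma dot_lipschitz x : lipschitz_fun (n%:R * `|x|) (dot x).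
Proof. by move=> v w; rewrite -dotBr; exact: dot_norm. Qed.

Lemma centered_dot x : centered mu -> (\int[mu]_(v in sphere) (dot x v)%:E = 0)%E.
Proof.
move=> cm; have ms := @sphere_measurable R n.
have int i : mu.-integrable (sphere : set T) (fun v : T => (v i 0)%:E).
  apply: (@lipschitz_integrable _ _ mu 1 (fun v => v i 0)) => // v w.
  by rewrite mul1r; have := norm_coord (v - w) i; rewrite !mxE.
have int2 i : mu.-integrable (sphere : set T) (fun v : T => (x i 0)%:E * (v i 0)%:E)%E.
  by apply: integrableZl.
rewrite (eq_integral (fun v : T => (\sum_i (x i 0)%:E * (v i 0)%:E)%E)); last first.
  by move=> v _; rewrite sumEFin.
apply: (etrans (integral_sum ms int2 _ _)).
rewrite big1// => i _; apply: (etrans (integralZl ms (int i) _)).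
by rewrite cm mule0.
Qed.

Lemma transform_dot phi y x : centered mu -> lsc_proper phi ->
  H (fun z => phi z + (dot z y)%:E)%E x = H phi x.
Proof.
move=> cm p; rewrite /H; set A := Defs.rot_to e x.
have E v : dot (enorm x *: (A *m v)) y = dot (enorm x *: (A^T *m y)) v.
  by rewrite !dotZl dot_mulmx (dotC v).
under eq_integral do rewrite E.
rewrite (@lsc_integralD _ _ mu (fun v => phi (enorm x *: (A *m v))) (fun v => (dot (enorm x *: (A^T *m y)) v)%:E)).
- by rewrite centered_dot// adde0.
- exact: lsc_proper_scale.
- split=> //; apply: continuous_lsc; exact: lipschitz_continuous (dot_lipschitz _).
Qed.

Hypotheses (n2 : (2 <= n)%N) (ee : dot e e = 1).
Hypothesis inv : forall A, orthmx A -> A *m e = e -> preserves mu A.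

Lemma transform_orthmx phi A x : lsc_proper phi -> orthmx A ->
  H (fun z => phi (A^T *m z)) x = H phi (A^T *m x).
Proof.
move=> p oA; have oA' := orthmx_tr oA.
have [B oB Be] := exists_orthmx x n2 ee.
rewrite (@transformE _ _ e mu n2 ee inv _ x B)//; last by apply: (lsc_proper_comp p); exact: mulmx_continuous.
rewrite (@transformE _ _ e mu n2 ee inv phi _ (A^T *m B))//.
- by apply: eq_integral => v _; rewrite enorm_orthmx// -scalemxAr mulmxA.
- exact: orthmxM.
- by rewrite enorm_orthmx// -mulmxA scalemxAr Be.
Qed.

Definition sphere_endo f := expN (legendre (H (supp f))).

Lemma sphere_endoP f : LCc f -> LCc (sphere_endo f) /\ supp (sphere_endo f) = H (supp f).
Proof.
move=> /LCc_supp[c b _]; apply: LCc_of_supp; first exact: transform_Cvx.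
by apply: transform_bounded0 => //; exact: Cvx_lsc_proper.
Qed.

Lemma neglog_sphere_endo f : LCc f -> neglog (sphere_endo f) = legendre (H (supp f)).
Proof.
move=> Lf; have [c b _] := LCc_supp Lf; apply: neglog_expN.
by case: (legendre_Cvx (transform_Cvx n2 ee inv c b)).
Qed.

Lemma sphere_endo_induced : induced_by e mu sphere_endo.
Proof.
move=> f Lf; have [L ->] := sphere_endoP Lf; split => //.
by have [c b _] := LCc_supp Lf; rewrite (sphere_convE n2 ee inv c b).
Qed.

Lemma sphere_endo_asplund : centered mu -> asplund_endomorphism sphere_endo.
Proof.
move=> cm; split.
- by move=> f /sphere_endoP[].
- move=> f_ f L_ L ec.
  have E_ : (fun k => legendre (H (supp (f_ k)))) = (fun k => neglog (sphere_endo (f_ k))).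
    by apply/funext => k; apply/esym; exact: neglog_sphere_endo (L_ k).
  rewrite -(congr2 (@epi_cvg R n) E_ (esym (neglog_sphere_endo L))).
  have [c0 b _] := LCc_supp L.
  apply: transform_epi => //; last by have [] := (LCcP _).1 L.
  by move=> k; have [] := (LCcP _).1 (L_ k).
- move=> f g Lf Lg; have [Lf' Ef] := sphere_endoP Lf; have [Lg' Eg] := sphere_endoP Lg.
  have [Lfg Efg] := sphere_endoP (asplund_sum_LCc Lf Lg).
  (* On support functions the Asplund sum is pointwise addition, which commutes with integration. *)
  apply: supp_inj => //; first exact: asplund_sum_LCc.
  rewrite Efg; apply/funext => x; apply: esym; apply: (etrans (supp_asplund_sum Lf' Lg' x)).
  rewrite (congr2 (fun u v : 'cV[R]_n -> \bar R => u x + v x)%E Ef Eg).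
  have [cf _ _] := LCc_supp Lf; have [cg _ _] := LCc_supp Lg.
  have pf := Cvx_lsc_proper cf; have pg := Cvx_lsc_proper cg.
  rewrite /H -lsc_integralD; try exact: lsc_proper_scale.
  by apply: eq_integral => v _; apply: esym; exact: supp_asplund_sum Lf Lg _.
- move=> f y Lf; rewrite /sphere_endo; have [c _ _] := LCc_supp Lf.
  congr (expN (legendre _)); apply/funext => x.
  rewrite -(transform_dot y x cm (Cvx_lsc_proper c)); congr (H _ x).
  by apply/funext => z; exact: (legendre_shift (neglog f)).
- move=> f A Lf sA; have oA := SO_orthmx sA; have [c _ _] := LCc_supp Lf.
  rewrite (orthmx_invmx oA) /sphere_endo; apply/funext => x.
  have -> : supp (fun z => f (A^T *m z)) = (fun z => supp f (A^T *m z)).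
    by apply/funext => z; exact: (legendre_orthmx (neglog f)).
  have -> : H (fun z => supp f (A^T *m z)) = (fun z => H (supp f) (A^T *m z)).
    by apply/funext => z; exact: transform_orthmx (Cvx_lsc_proper c) oA.
  exact: (congr1 (fun h => fine (expeR (- h)%E)) (legendre_orthmx (H (supp f)) x oA)).
Qed.

Lemma sphere_endo_monotone : monotone_on_LCc sphere_endo.
Proof.
move=> f g Lf Lg fg x; have [cf bf _] := LCc_supp Lf; have [cg bg _] := LCc_supp Lg.
have pf := Cvx_lsc_proper cf; have pg := Cvx_lsc_proper cg.
have [Nf _ _ _] := legendre_Cvx (transform_Cvx n2 ee inv cf bf).
have [Ng _ _ _] := legendre_Cvx (transform_Cvx n2 ee inv cg bg).
apply: (expN_anti (Ng x) (Nf x)); apply: legendre_anti => y.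
apply: lsc_integral_le; first exact: lsc_proper_scale.
  by apply: lsc_proper_measurable; exact: lsc_proper_scale.
by move=> v _; apply: legendre_anti => z; apply: neglog_anti => //; have [_ _ ->] := (LCcP f).1 Lf.
Qed.

End Endomorphism.

(** * Recovering the measure from the transform *)

Section Uniqueness.
Context {R : realType} {n : nat}.
Local Notation T := (borelRn R n).

Lemma finite_convex_Cvx (C : 'cV[R]_n -> R) (K : R) : 0 <= K -> convex_fun C -> lipschitz_fun K C ->
  Cvx (fun x => (C x)%:E) /\ bounded0 (fun x => (C x)%:E).
Proof.
move=> K0 cC lC; split; last first.
  exists 1 => //; exists (`|C 0| + K) => x x1; rewrite lee_fin.
  by apply: le_trans (ler_norm _) _; apply: lipschitz_bounded.
split.
- by [].
- by move=> x y t t01; rewrite -!EFinM -EFinD lee_fin; exact: cC.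
- exact: (continuous_lsc (lipschitz_continuous lC)).
- by exists 0.
Qed.

(** The identity takes [e] to itself, so at the pole the transform is the plain integral. *)
Lemma transform_pole (e : 'cV[R]_n) (mu : {finite_measure set T -> \bar R}) phi :
  (2 <= n)%N -> dot e e = 1 -> (forall A, orthmx A -> A *m e = e -> preserves mu A) ->
  lsc_proper phi -> sphere_conv_ne0 e mu phi e = (\int[mu]_(v in sphere) phi v)%E.
Proof.
move=> n2 ee inv p; have e1 : enorm e = 1 by apply/sphere_dot.
rewrite (@transformE _ _ e mu n2 ee inv phi e 1%:M)//; last by rewrite e1 scale1r mul1mx.
  by apply: eq_integral => v _; rewrite e1 scale1r mul1mx.
exact: orthmx1.
Qed.

End Uniqueness.

Theorem theorem3 (R : realType) (n : nat) (hn : (3 <= n)%N)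
    (e : 'cV[R]_n) (he : sphere e) :
  (forall mu : {finite_measure set (borelRn R n) -> \bar R},
     on_sphere mu -> SO_fixing_invariant e mu -> centered mu ->
     exists Psi : ('cV[R]_n -> R) -> 'cV[R]_n -> R,
       [/\ induced_by e mu Psi,
           forall Psi' : ('cV[R]_n -> R) -> 'cV[R]_n -> R,
             induced_by e mu Psi' -> forall f, LCc f -> Psi' f = Psi f,
           asplund_endomorphism Psi
         & monotone_on_LCc Psi]) /\
  (forall mu nu : {finite_measure set (borelRn R n) -> \bar R},
     on_sphere mu -> SO_fixing_invariant e mu -> centered mu ->
     on_sphere nu -> SO_fixing_invariant e nu -> centered nu ->
     forall Psi : ('cV[R]_n -> R) -> 'cV[R]_n -> R,
       induced_by e mu Psi -> induced_by e nu Psi ->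
     forall A : set (borelRn R n), measurable A -> mu A = nu A).
Proof.
have ee : dot e e = 1 by apply/sphere_dot.
have n2 : (2 <= n)%N by apply: leq_trans hn.
have inv mu : on_sphere mu -> SO_fixing_invariant e mu ->
    forall A, orthmx A -> A *m e = e -> preserves mu A.
  by move=> smu imu A oA Ae; exact: (preserves_orthmx hn smu imu ee oA Ae).
split=> [mu smu imu cmu|mu nu smu imu cmu snu inu cnu Psi Pmu Pnu].
  have ind := sphere_endo_induced n2 ee (inv mu smu imu).
  exists (sphere_endo e mu); split.
  - exact: ind.
  - move=> Psi' ind' f Lf; have [L1 E1] := ind f Lf; have [L2 E2] := ind' f Lf.
    by apply: supp_inj => //; rewrite E1.
  - exact: sphere_endo_asplund n2 ee (inv mu smu imu) cmu.
  - exact: sphere_endo_monotone n2 ee (inv mu smu imu).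
(* A convex Lipschitz [C] is the support function of some member of [LCc], on which both measures
   induce the same image; its support function at [e] is the integral of [C]. *)
apply: (finite_measure_eq_convex smu snu) => C K K0 cC lC.
have [c b] := finite_convex_Cvx K0 cC lC.
have [L E] := LCc_of_supp c b; have p := Cvx_lsc_proper c.
have [_ Emu] := Pmu _ L; have [_ Enu] := Pnu _ L.
have := Emu; rewrite Enu E (sphere_convE n2 ee (inv _ smu imu) c b) (sphere_convE n2 ee (inv _ snu inu) c b).
move=> /(congr1 (fun h => h e)); rewrite (transform_pole n2 ee (inv _ smu imu) p).
by rewrite (transform_pole n2 ee (inv _ snu inu) p).
Qed.
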